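(* Let $\mathcal T$ be a reduced T-mesh, $\mathbf r$ a smoothness distribution on $\mathcal T$ that is constant along each maximal segment, and $m,m'\ge0$ integers. Let $$\operatorname{MIS}(\mathcal T)=\mathcal A^{(0)}\supseteq\mathcal A^{(1)}\supseteq\cdots\supseteq\mathcal A^{(N)}$$ be a sequence of MIS sets obtained by successive admissible deletions, i.e. for each $k\ge1$ there are an MIS $\rho\in\mathcal A^{(k-1)}$ with $\mathcal A^{(k)}=\mathcal A^{(k-1)}\setminus\{\rho\}$ and a total order $\iota$ of $\operatorname{MIS}(\mathcal T)$ that lists first the MISs in $\operatorname{MIS}(\mathcal T)\setminus\mathcal A^{(k-1)}$, then $\rho$, then the MISs in $\mathcal A^{(k)}$, such that $\omega_\iota(\rho)\ge\theta(\rho)$. Then for every $k=0,\dots,N$, $$\dim\mathcal S_{m,m'}^{\mathbf r}(\mathcal T)=\chi\bigl(\mathcal Q_{m,m'}^{\mathbf r}(\mathcal T^\circ)\bigr)+\dim\mathcal H_{m,m'}^{\mathbf r}(\mathcal A^{(k)};\mathcal T),$$ where the Euler characteristic term is that of the original T-mesh $\mathcal T$ and does not vary with $k$.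
   Context: **T-meshes.** Coordinates on $\mathbb R^2$ are $(s,t)$, with $s$ horizontal and $t$ vertical. Let $\Omega\subset\mathbb R^2$ be a finite union of closed axis-aligned rectangles with pairwise disjoint interiors, with $\Omega$ simply connected and $\Omega^\circ$ connected. A T-mesh on $\Omega$ is a triple $\mathcal T=(\mathcal T_2,\mathcal T_1,\mathcal T_0)$: $\mathcal T_2$ is the finite set of these closed rectangles (cells); $\mathcal T_1=\mathcal T_1^h\cup\mathcal T_1^v$ is a finite set of closed horizontal and vertical segments (edges) contained in $\bigcup_{\sigma\in\mathcal T_2}\partial\sigma$; $\mathcal T_0$ is the set of endpoints of edges (vertices); each $\partial\sigma$ is a finite union of edges; distinct cells $\sigma,\sigma'$ satisfy $\sigma\cap\sigma'=\partial\sigma\cap\partial\sigma'$, a finite union of edges and vertices; distinct edges meet only in vertices. Interior edges $\mathcal T_1^\circ$ are the edges meeting $\Omega^\circ$; the other edges are boundary edges. Interior vertices $\mathcal T_0^\circ$ are the vertices in $\Omega^\circ$. **Maximal segments.** A segment is a connected union of edges lying on one straight line. $\operatorname{MS}(\mathcal T)$ is the set of maximal segments consisting of interior edges. Such a segment is a cross-cut if both endpoints lie on $\partial\Omega$, a ray if exactly one does, and a maximal interior segment (MIS) if it does not meet $\partial\Omega$; $\operatorname{MIS}(\mathcal T)$ is the set of MISs. A boundary maximal segment is a maximal connected union of boundary edges on one line. $\widehat{\operatorname{MS}}(\mathcal T)$ is the set of all cross-cuts, rays, MISs and boundary maximal segments. $\mathcal T$ is reduced if no vertex is inserted merely to divide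 a straight edge into two collinear edges, every vertex lies on exactly one horizontal and exactly one vertical member of $\widehat{\operatorname{MS}}(\mathcal T)$, and the edges are exactly the closed subsegments between consecutive vertices on these members (so an interior and a boundary maximal segment of the same direction never meet collinearly at a common endpoint). **Smoothness.** A smoothness distribution is a map $\mathbf r:\mathcal T_1\to\{-1,0,1,\dots\}$ equal to $-1$ on boundary edges. It is constant along each maximal segment if for every $\rho\in\operatorname{MS}(\mathcal T)$ all edges $\tau\subset\rho$ have the same value $\mathbf r(\tau)=:r(\rho)$. For $\gamma\in\mathcal T_0^\circ$ with horizontal and vertical maximal segments $\rho_h(\gamma),\rho_v(\gamma)$ through it, $r_h(\gamma):=r(\rho_v(\gamma))$ and $r_v(\gamma):=r(\rho_h(\gamma))$. **Spline space and Euler characteristic.** $R_{a,b}=\operatorname{span}_{\mathbb R}\{s^it^j:0\le i\le a,\,0\le j\le b\}$, and $R_{a,b}=0$ if $a<0$ or $b<0$. $\mathcal S_{m,m'}^{\mathbf r}(\mathcal T)$ is the space of piecewise polynomial functions $f$ on $\Omega$ with $f|_\sigma\in R_{m,m'}$ for every cell $\sigma$ and $f$ of class $C^{\mathbf r(\tau)}$ across every interior edge $\tau$; $C^{-1}$ means no matching condition, so $f$ is regarded as a family of polynomials $(f_\sigma)_{\sigma\in\mathcal T_2}$. ($C^r$ across $\tau=$ common edge of $\sigma,\sigma'$ means $f_\sigma-f_{\sigma'}$ is divisible by $\ell_\tau^{r+1}$, where $\ell_\tau$ is a nonzero affine linear polynomial vanishing on the line of $\tau$.) Put $I_\tau^{\mathbf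 r}=\langle\ell_\tau^{\mathbf r(\tau)+1}\rangle\cap R_{m,m'}$ for $\tau\in\mathcal T_1^\circ$ and $I_\gamma^{\mathbf r}=\sum_{\tau\ni\gamma,\tau\in\mathcal T_1^\circ}I_\tau^{\mathbf r}$ for $\gamma\in\mathcal T_0^\circ$. $\mathcal Q_{m,m'}^{\mathbf r}(\mathcal T^\circ)$ is the complex $0\to\bigoplus_{\sigma\in\mathcal T_2}[\sigma]R_{m,m'}\to\bigoplus_{\tau\in\mathcal T_1^\circ}[\tau]R_{m,m'}/I_\tau^{\mathbf r}\to\bigoplus_{\gamma\in\mathcal T_0^\circ}[\gamma]R_{m,m'}/I_\gamma^{\mathbf r}\to0$ with maps induced by the cellular boundary maps relative to $\partial\Omega$; its Euler characteristic is $\chi(\mathcal Q_{m,m'}^{\mathbf r}(\mathcal T^\circ))=\sum_{\sigma\in\mathcal T_2}\dim R_{m,m'}-\sum_{\tau\in\mathcal T_1^\circ}\dim(R_{m,m'}/I_\tau^{\mathbf r})+\sum_{\gamma\in\mathcal T_0^\circ}\dim(R_{m,m'}/I_\gamma^{\mathbf r})$. **Correction spaces.** For a maximal segment $\rho$, $\ell_\rho$ is a nonzero affine linear polynomial vanishing on the line of $\rho$ (normalised as $s-s_0$ for $s=s_0$, $t-t_0$ for $t=t_0$). For an MIS $\rho$, $\mathcal B_\rho=R_{m,m'-r(\rho)-1}$ if $\rho$ is horizontal and $\mathcal B_\rho=R_{m-r(\rho)-1,m'}$ if $\rho$ is vertical. For $\mathcal A\subseteq\operatorname{MIS}(\mathcal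 T)$, $\mathcal M(\mathcal A)=\bigoplus_{\rho\in\mathcal A}[\rho]\mathcal B_\rho$ ($[\rho]$ a formal symbol). $\mathcal R(\mathcal T)\subseteq\mathcal M(\operatorname{MIS}(\mathcal T))$ is the subspace spanned by the vertex relations, for each interior vertex $\gamma=\rho_h\cap\rho_v$ ($\rho_h$ horizontal, $\rho_v$ vertical maximal segment) and each $q\in R_{m-r(\rho_v)-1,\,m'-r(\rho_h)-1}$: if both $\rho_h,\rho_v$ are MISs, $[\rho_v]\ell_{\rho_h}^{r(\rho_h)+1}q-[\rho_h]\ell_{\rho_v}^{r(\rho_v)+1}q$; if exactly one of them is an MIS, the same expression with the term of the non-MIS segment omitted. Put $\mathcal R_{\mathcal A}(\mathcal T):=\mathcal M(\mathcal A)\cap\mathcal R(\mathcal T)$ and $\mathcal H_{m,m'}^{\mathbf r}(\mathcal A;\mathcal T):=\mathcal M(\mathcal A)/\mathcal R_{\mathcal A}(\mathcal T)$. **Relative weight.** For a total order $\iota:\rho_1\succ\cdots\succ\rho_t$ of $\operatorname{MIS}(\mathcal T)$ ($\rho_1$ listed first), $\Gamma_\iota(\rho_i)$ is the set of vertices $\gamma$ on $\rho_i$ with $\gamma\notin\rho_j$ for all $j<i$. With $(a)_+=\max\{a,0\}$, put $\mu_h(\gamma)=(m-r_h(\gamma))_+$ and $\mu_v(\gamma)=(m'-r_v(\gamma))_+$. Then $\omega_\iota(\rho_i)=\sum_{\gamma\in\Gamma_\iota(\rho_i)}\mu_h(\gamma)$ if $\rho_i$ is horizontal, $\omega_\iota(\rho_i)=\sum_{\gamma\in\Gamma_\iota(\rho_i)}\mu_v(\gamma)$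 if $\rho_i$ is vertical. The threshold is $\theta(\rho)=m+1$ for horizontal $\rho$, $m'+1$ for vertical $\rho$. *)

(* Defs.v *)
From HB Require Import structures.
From mathcomp Require Import all_boot all_order all_algebra finmap.
From mathcomp Require Import all_classical all_reals topology normedtype.

Set Implicit Arguments.
Unset Strict Implicit.
Unset Printing Implicit Defensive.

Import Order.TTheory GRing.Theory Num.Theory.
Import numFieldNormedType.Exports.

Local Open Scope classical_set_scope.
Local Open Scope ring_scope.

(** * Topology *)

Definition frontier (X : topologicalType) (A : set X) : set X :=
  closure A `\` interior A.

Definition path_connected (R : realType) (X : topologicalType) (A : set X) :=
  forall x y, A x -> A y ->
  exists f : R -> X,
    [/\ {within `[0, 1], continuous f}, f @` `[0, 1] `<=` A, f 0 = x & f 1 = y].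

(* A homotopy is a function of (parameter of the loop, time); it is based, the
   base point of the loop f being f 0. *)
Definition null_homotopic (R : realType) (X : topologicalType) (A : set X)
    (f : R -> X) :=
  exists H : R * R -> X,
    [/\ {within `[0, 1] `*` `[0, 1], continuous H},
        H @` (`[0, 1] `*` `[0, 1]) `<=` A,
        forall x, x \in `[0, 1]%R -> H (x, 0) = f x /\ H (x, 1) = f 0
      & forall u, u \in `[0, 1]%R -> H (0, u) = f 0 /\ H (1, u) = f 0].

Definition simply_connected (R : realType) (X : topologicalType) (A : set X) :=
  path_connected R A /\
  forall f : R -> X, {within `[0, 1], continuous f} ->
    f @` `[0, 1] `<=` A -> f 0 = f 1 -> null_homotopic A f.

(** * Linear algebra *)

Section LinearAlgebra.
Variables (K : fieldType) (V : vectType K).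
Implicit Types (P : set V) (U W : {vspace V}).

Lemma max_span P : exists X : seq V,
  (forall v, v \in X -> P v) /\ (forall v, P v -> v \in <<X>>%VS).
Proof.
pose Q n := `[< exists X : seq V, (forall v, v \in X -> P v) /\ \dim <<X>> = n >].
have exQ : exists n, Q n.
  by exists 0%N; apply/asboolP; exists [::]; split=> //; rewrite span_nil dimv0.
have ubQ n : Q n -> (n <= \dim {:V})%N.
  by move=> /asboolP[X [_ <-]]; apply/dimvS/subvf.
have [n /asboolP[X [XP dimX]] maxn] := ex_maxnP exQ ubQ.
exists X; split=> // v Pv.
have XvP : Q (\dim <<v :: X>>).
  apply/asboolP; exists (v :: X); split=> // w.
  by rewrite inE => /predU1P[->|/XP].
have sX : (<<X>> <= <<v :: X>>)%VS.
  by apply: sub_span => w; rewrite inE orbC => ->.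
have /eqP -> : <<X>>%VS == <<v :: X>>%VS by rewrite eqEdim sX /= dimX maxn.
by apply: memv_span; rewrite inE eqxx.
Qed.

Lemma vspan_exists P : exists U, (forall v, P v -> v \in U) /\
  forall W, (forall v, P v -> v \in W) -> (U <= W)%VS.
Proof.
have [X [XP PX]] := max_span P; exists <<X>>%VS; split=> // W PW.
by apply/span_subvP => v /XP; apply: PW.
Qed.

(* The linear span of a set of vectors. *)
Definition vspan P : {vspace V} := sval (cid (vspan_exists P)).

Lemma mem_vspan P v : P v -> v \in vspan P.
Proof. exact: (svalP (cid (vspan_exists P))).1. Qed.

Lemma vspan_sub P W : (forall v, P v -> v \in W) -> (vspan P <= W)%VS.
Proof. exact: (svalP (cid (vspan_exists P))).2. Qed.

Lemma vspan_submodE P : P 0 -> (forall a u v, P u -> P v -> P (a *: u + v)) ->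
  forall v, v \in vspan P <-> P v.
Proof.
move=> P0 PD v; split; last exact: mem_vspan.
have [X [XP /vspan_sub/subvP sPX]] := max_span P.
move=> /sPX vX; rewrite (coord_span (X := in_tuple X) vX).
apply: (big_ind P) => // [x y Px Py|i _].
  by rewrite -(scale1r x); apply: PD.
by rewrite -[_ *: _]addr0; apply: PD => //; apply: XP; apply: mem_nth.
Qed.

(* V / W is modelled by the complement W^C of W, with the projection along W as
   the canonical surjection V -> V / W; quotv U W is the image of U in V / W,
   which is U / W when W is contained in U. *)
Definition quot_pi W : 'End(V) := daddv_pi W^C W.

Definition quotv U W : {vspace V} := (quot_pi W @: U)%VS.

Lemma lker_quot_pi W : lker (quot_pi W) = W.
Proof.
have dis : (W^C :&: W = 0)%VS by rewrite capvC capv_compl.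
have dis' : (W :&: W^C = 0)%VS by rewrite capv_compl.
have E v : quot_pi W v + daddv_pi W W^C v = v.
  by apply: daddv_pi_add => //; rewrite addvC addv_complf memvf.
apply/vspaceP => v; rewrite memv_ker; apply/eqP/idP => [v0|vW].
  by rewrite -(E v) v0 add0r memv_pi.
by have := E v; rewrite [X in _ + X]daddv_pi_id // => /(canRL (addrK _)); rewrite subrr.
Qed.

Lemma dim_quotv U W : (W <= U)%VS -> (\dim (quotv U W) = \dim U - \dim W)%N.
Proof.
move=> WU; rewrite -(limg_ker_dim (quot_pi W) U) lker_quot_pi.
by rewrite (capv_idPr WU) addKn.
Qed.

End LinearAlgebra.

(** * Rectangles and axis-parallel segments *)

Record rect (R : realType) := Rect
  { rect_s0 : R; rect_s1 : R; rect_t0 : R; rect_t1 : R }.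

(* The horizontal segment [lo, hi] x {pos}, or the vertical one
   {pos} x [lo, hi]. *)
Record seg (R : realType) := Seg
  { seg_hor : bool; seg_pos : R; seg_lo : R; seg_hi : R }.

Section ChoiceInstances.
Variable R : realType.

Definition rect_code (c : rect R) :=
  (rect_s0 c, rect_s1 c, rect_t0 c, rect_t1 c).
Definition rect_decode (x : R * R * R * R) :=
  Rect x.1.1.1 x.1.1.2 x.1.2 x.2.
Lemma rect_codeK : cancel rect_code rect_decode. Proof. by case. Qed.
HB.instance Definition _ := Choice.copy (rect R) (can_type rect_codeK).

Definition seg_code (e : seg R) := (seg_hor e, seg_pos e, seg_lo e, seg_hi e).
Definition seg_decode (x : bool * R * R * R) := Seg x.1.1.1 x.1.1.2 x.1.2 x.2.
Lemma seg_codeK : cancel seg_code seg_decode. Proof. by case. Qed.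
HB.instance Definition _ := Choice.copy (seg R) (can_type seg_codeK).

End ChoiceInstances.

Section Geometry.
Variable R : realType.
Implicit Types (c : rect R) (e : seg R) (p : R * R).

Definition rect_set c : set (R * R) :=
  [set p | rect_s0 c <= p.1 <= rect_s1 c /\ rect_t0 c <= p.2 <= rect_t1 c].

Definition on_seg e p : bool :=
  if seg_hor e then (p.2 == seg_pos e) && (seg_lo e <= p.1 <= seg_hi e)
  else (p.1 == seg_pos e) && (seg_lo e <= p.2 <= seg_hi e).

Definition seg_set e : set (R * R) := [set p | on_seg e p].

Definition line_pt (hor : bool) (pos x : R) : R * R :=
  if hor then (x, pos) else (pos, x).

Definition seg_end0 e := line_pt (seg_hor e) (seg_pos e) (seg_lo e).
Definition seg_end1 e := line_pt (seg_hor e) (seg_pos e) (seg_hi e).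

Definition collinear e e' :=
  seg_hor e = seg_hor e' /\ seg_pos e = seg_pos e'.

End Geometry.

(** * T-meshes *)

(* The vertices are determined by the edges. *)
Record premesh (R : realType) := PreMesh
  { cells : {fset rect R}; edges : {fset seg R} }.

Section Mesh.
Variables (R : realType) (T : premesh R).
Implicit Types (e : seg R) (rho : {fset seg R}) (p : R * R).

Definition vertices : {fset R * R} :=
  ([fset seg_end0 e | e in edges T] `|` [fset seg_end1 e | e in edges T])%fset.

Definition domain : set (R * R) :=
  \bigcup_(c in [set` cells T]) rect_set c.

(* A finite set of collinear edges is encoded as the set of these edges; this
   is the underlying set of points. *)
Definition support rho : set (R * R) := \bigcup_(e in [set` rho]) seg_set e.

Record is_tmesh : Prop := IsTMesh {
  tmesh_cell : forall c, c \in cells T ->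
    rect_s0 c < rect_s1 c /\ rect_t0 c < rect_t1 c;
  tmesh_disjoint : forall c c', c \in cells T -> c' \in cells T -> c != c' ->
    interior (rect_set c) `&` interior (rect_set c') = set0;
  tmesh_simply_connected : simply_connected R domain;
  tmesh_connected_interior : connected (interior domain);
  tmesh_edge : forall e, e \in edges T -> seg_lo e < seg_hi e;
  tmesh_edge_sub : forall e, e \in edges T ->
    seg_set e `<=` \bigcup_(c in [set` cells T]) frontier (rect_set c);
  tmesh_frontier : forall c, c \in cells T ->
    exists2 E : {fset seg R}, (E `<=` edges T)%fset &
      frontier (rect_set c) = support E;
  tmesh_cellI : forall c c', c \in cells T -> c' \in cells T -> c != c' ->
    rect_set c `&` rect_set c' = frontier (rect_set c) `&` frontier (rect_set c');
  tmesh_cellI_union : forall c c', c \in cells T -> c' \in cells T -> c != c' ->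
    exists (E : {fset seg R}) (G : {fset R * R}),
      [/\ (E `<=` edges T)%fset, (G `<=` vertices)%fset &
          rect_set c `&` rect_set c' = support E `|` [set` G]];
  tmesh_edgeI : forall e e', e \in edges T -> e' \in edges T -> e != e' ->
    seg_set e `&` seg_set e' `<=` [set` vertices]
}.

Definition inner_edges : {fset seg R} :=
  [fset e in edges T | `[< seg_set e `&` interior domain !=set0 >]]%fset.

Definition boundary_edges : {fset seg R} := (edges T `\` inner_edges)%fset.

Definition inner_vertices : {fset R * R} :=
  [fset p in vertices | `[< interior domain p >]]%fset.

(** ** Maximal segments *)

Definition is_segment rho :=
  [/\ rho != fset0,
      forall e e', e \in rho -> e' \in rho -> collinear e e'
    & connected (support rho)].

Definition max_segments (E : {fset seg R}) : {fset {fset seg R}} :=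
  [fset rho in fpowerset E | `[< is_segment rho /\
     forall rho', (rho' `<=` E)%fset -> is_segment rho' ->
       (rho `<=` rho')%fset -> rho' = rho >]]%fset.

Definition MS := max_segments inner_edges.

Definition on_ms rho p : bool := has (fun e => on_seg e p) rho.

(* Only used on nonempty sets of collinear edges, for which direction and line
   can be read off any edge. *)
Definition ms_rep rho : seg R := head (Seg true 0 0 0) rho.
Definition ms_hor rho : bool := seg_hor (ms_rep rho).
Definition ms_pos rho : R := seg_pos (ms_rep rho).

Definition ms_end0 rho : R * R := line_pt (ms_hor rho) (ms_pos rho)
  (\big[Order.min/seg_lo (ms_rep rho)]_(e <- rho) seg_lo e).
Definition ms_end1 rho : R * R := line_pt (ms_hor rho) (ms_pos rho)
  (\big[Order.max/seg_hi (ms_rep rho)]_(e <- rho) seg_hi e).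

Definition is_crosscut rho :=
  frontier domain (ms_end0 rho) /\ frontier domain (ms_end1 rho).

Definition is_ray rho :=
  (frontier domain (ms_end0 rho) /\ ~ frontier domain (ms_end1 rho)) \/
  (~ frontier domain (ms_end0 rho) /\ frontier domain (ms_end1 rho)).

Definition is_mis rho := support rho `&` frontier domain = set0.

Definition MIS : {fset {fset seg R}} :=
  [fset rho in MS | `[< is_mis rho >]]%fset.

Definition hatMS : {fset {fset seg R}} :=
  ([fset rho in MS | `[< is_crosscut rho \/ is_ray rho \/ is_mis rho >]]
     `|` max_segments boundary_edges)%fset.

Record is_reduced : Prop := IsReduced {
  reduced_not_straight : forall p, p \in vertices ->
    ~ exists e e', [/\ e \in edges T, e' \in edges T & e != e'] /\
        [/\ on_seg e p, on_seg e' p, collinear e e' &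
            forall f, f \in edges T -> on_seg f p -> f = e \/ f = e'];
  reduced_vertex : forall p, p \in vertices -> forall hor : bool,
    exists! rho, [/\ rho \in hatMS, ms_hor rho = hor & on_ms rho p];
  reduced_edges : forall e, e \in edges T <->
    exists rho, [/\ rho \in hatMS, seg_set e `<=` support rho, seg_lo e < seg_hi e,
      seg_end0 e \in vertices /\ seg_end1 e \in vertices &
      forall p, p \in vertices -> on_seg e p -> p = seg_end0 e \/ p = seg_end1 e]
}.

(** ** Smoothness distributions *)

Record is_smoothness (r : seg R -> int) : Prop := IsSmoothness {
  smoothness_ge : forall e, e \in edges T -> -1 <= r e;
  smoothness_boundary : forall e, e \in boundary_edges -> r e = -1
}.

Definition constant_along_ms (r : seg R -> int) :=
  forall rho, rho \in MS -> forall e e', e \in rho -> e' \in rho -> r e = r e'.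

(* The common value of r on the edges of rho. *)
Definition ms_r (r : seg R -> int) rho : int := r (ms_rep rho).

(* The maximal segment of given direction through an interior vertex. *)
Definition ms_at (hor : bool) p : {fset seg R} :=
  head fset0 [seq rho <- MS | (ms_hor rho == hor) && on_ms rho p].

End Mesh.

(** * Polynomials of bounded bidegree *)

(* R_{m,m'}: the entry (i, j) is the coefficient of s^i t^j. *)
Notation bipoly R m m' := 'M[R]_(m.+1, m'.+1).

Section Spline.
Variables (R : realType) (m m' : nat).
Notation P := (bipoly R m m').

(* R[s,t] is {poly {poly R}}: s is the variable of the coefficients, t the main
   variable. *)
Definition poly_of (A : P) : {poly {poly R}} :=
  \sum_(i < m.+1) \sum_(j < m'.+1) (A i j *: 'X^i)%:P * 'X^j.

Definition ell (hor : bool) (pos : R) : {poly {poly R}} :=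
  if hor then 'X - pos%:P%:P else ('X - pos%:P)%:P.

(* r + 1 for r >= -1 *)
Definition succz (r : int) : nat := absz (r + 1).

(* R_{a,b} as a subspace of R_{m,m'}, for a <= m and b <= m'. *)
Definition Rspace (a b : int) : {vspace P} :=
  vspan [set A : P | forall (i : 'I_m.+1) (j : 'I_m'.+1),
    A i j != 0 -> (i%:Z <= a) /\ (j%:Z <= b)].

Variables (T : premesh R) (r : seg R -> int).

Definition ell_edge (e : seg R) : {poly {poly R}} :=
  ell (seg_hor e) (seg_pos e) ^+ succz (r e).

Definition ell_ms (rho : {fset seg R}) : {poly {poly R}} :=
  ell (ms_hor rho) (ms_pos rho) ^+ succz (ms_r r rho).

Definition divides (d p : {poly {poly R}}) := exists g, p = d * g.

Definition spline : {vspace {ffun cells T -> P}} :=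
  vspan [set f : {ffun cells T -> P} | forall e, e \in inner_edges T -> forall c c' : cells T,
    seg_set e `<=` rect_set (val c) -> seg_set e `<=` rect_set (val c') ->
    divides (ell_edge e) (poly_of (f c) - poly_of (f c'))].

Definition I_edge (e : seg R) : {vspace P} :=
  vspan [set A | divides (ell_edge e) (poly_of A)].

Definition I_vertex (p : R * R) : {vspace P} :=
  (\sum_(e <- inner_edges T | on_seg e p) I_edge e)%VS.

Definition euler_char : int :=
  \sum_(c <- cells T) (\dim {:P})%:Z
  - \sum_(e <- inner_edges T) (\dim (quotv fullv (I_edge e)))%:Z
  + \sum_(p <- inner_vertices T) (\dim (quotv fullv (I_vertex p)))%:Z.

(** * Correction spaces *)

Definition B_space (rho : {fset seg R}) : {vspace P} :=
  if ms_hor rho then Rspace m%:Z (m'%:Z - ms_r r rho - 1)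
  else Rspace (m%:Z - ms_r r rho - 1) m'%:Z.

(* [rho] is the coordinate rho of a function on MIS(T). *)
Definition M_space (A : {fset {fset seg R}}) :
    {vspace {ffun MIS T -> P}} :=
  vspan [set u : {ffun MIS T -> P} | forall rho : MIS T,
    u rho \in (if val rho \in A then B_space (val rho) else 0%VS)].

(* The terms carried by maximal segments which are not MISs are omitted, since
   rho only ranges over MISs. *)
Definition vertex_relation (u : {ffun MIS T -> P}) :=
  exists2 p, p \in inner_vertices T &
  let rh := ms_at T true p in
  let rv := ms_at T false p in
  (rh \in MIS T \/ rv \in MIS T) /\
  exists2 q : P,
    q \in Rspace (m%:Z - ms_r r rv - 1) (m'%:Z - ms_r r rh - 1) &
    forall rho : MIS T, poly_of (u rho) =
      if val rho == rv then ell_ms rh * poly_of q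
      else if val rho == rh then - (ell_ms rv * poly_of q)
      else 0.

Definition Rel_space : {vspace {ffun MIS T -> P}} := vspan vertex_relation.

Definition H_space (A : {fset {fset seg R}}) : {vspace {ffun MIS T -> P}} :=
  quotv (M_space A) (M_space A :&: Rel_space)%VS.

(** * Relative weights and admissible deletions *)

Definition mu_h (p : R * R) : int :=
  Order.max (m%:Z - ms_r r (ms_at T false p)) 0.

Definition mu_v (p : R * R) : int :=
  Order.max (m'%:Z - ms_r r (ms_at T true p)) 0.

(* A total order on MIS(T) is given by the list of its elements. *)
Definition is_total_order (io : seq {fset seg R}) :=
  uniq io /\ io =i MIS T.

Definition Gamma (io : seq {fset seg R}) (rho : {fset seg R}) : {fset R * R} :=
  [fset p in vertices T | on_ms rho p &&
     all (fun rho' => ~~ on_ms rho' p) (take (index rho io) io)]%fset.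

Definition weight (io : seq {fset seg R}) (rho : {fset seg R}) : int :=
  \sum_(p <- Gamma io rho) if ms_hor rho then mu_h p else mu_v p.

Definition threshold (rho : {fset seg R}) : int :=
  if ms_hor rho then m%:Z + 1 else m'%:Z + 1.

Definition admissible_deletion (A A' : {fset {fset seg R}}) :=
  exists2 rho, rho \in A & A' = (A `\ rho)%fset /\
  exists s1 s2 : seq {fset seg R}, let io := s1 ++ rho :: s2 in
    [/\ is_total_order io, s1 =i (MIS T `\` A)%fset, s2 =i A'
      & threshold rho <= weight io rho].

End Spline.

Section Membership.
Variables (R : realType) (m m' : nat) (T : premesh R) (r : seg R -> int).
Notation P := (bipoly R m m').

Lemma poly_ofE (a : R) (A B : P) :
  poly_of (a *: A + B) = a%:P%:P * poly_of A + poly_of B.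
Proof.
rewrite /poly_of mulr_sumr -big_split; apply: eq_bigr => i _.
rewrite mulr_sumr -big_split; apply: eq_bigr => j _ /=.
by rewrite !mxE scalerDl polyCD mulrDl -scalerA -mul_polyC polyCM mulrA.
Qed.

Lemma poly_of0 : poly_of (0 : P) = 0.
Proof.
by rewrite /poly_of big1 // => i _; rewrite big1 // => j _;
  rewrite mxE scale0r mul0r.
Qed.

Lemma memv_Rspace (a b : int) (A : P) : A \in Rspace R m m' a b <->
  forall i j, A i j != 0 -> (i%:Z <= a) /\ (j%:Z <= b).
Proof.
apply: (vspan_submodE (P := [set A : P | forall (i : 'I_m.+1) (j : 'I_m'.+1),
  A i j != 0 -> (i%:Z <= a) /\ (j%:Z <= b)])) => /= [i j|c u v uP vP i j].
  by rewrite mxE eqxx.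
rewrite !mxE => nz; have [u0|/uP//] := eqVneq (u i j) 0.
by apply: vP; apply: contraNN nz => /eqP ->; rewrite u0 mulr0 addr0.
Qed.

Lemma memv_spline (f : {ffun cells T -> P}) : f \in spline m m' T r <->
  forall e, e \in inner_edges T -> forall c c' : cells T,
    seg_set e `<=` rect_set (val c) -> seg_set e `<=` rect_set (val c') ->
    divides (ell_edge r e) (poly_of (f c) - poly_of (f c')).
Proof.
apply: (vspan_submodE (P := [set f : {ffun cells T -> P} |
  forall e, e \in inner_edges T -> forall c c' : cells T,
    seg_set e `<=` rect_set (val c) -> seg_set e `<=` rect_set (val c') ->
    divides (ell_edge r e) (poly_of (f c) - poly_of (f c'))]))
  => /= [e _ c c' _ _|a u v uP vP e eT c c' ec ec'].
  by exists 0; rewrite !ffunE subrr mulr0.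
have [g Eg] := uP e eT c c' ec ec'; have [h Eh] := vP e eT c c' ec ec'.
exists (a%:P%:P * g + h); rewrite !ffunE !poly_ofE.
by rewrite opprD addrACA -mulrBr Eg Eh mulrDr mulrCA.
Qed.

Lemma memv_I_edge (e : seg R) (A : P) :
  A \in I_edge m m' r e <-> divides (ell_edge r e) (poly_of A).
Proof.
apply: (vspan_submodE (P := [set A : P | divides (ell_edge r e) (poly_of A)]))
  => /= [|a u v [g Eg] [h Eh]]; first by exists 0; rewrite poly_of0 mulr0.
by exists (a%:P%:P * g + h); rewrite poly_ofE Eg Eh mulrDr mulrCA.
Qed.

Lemma memv_M_space (A : {fset {fset seg R}}) (u : {ffun MIS T -> P}) :
  u \in M_space m m' T r A <-> forall rho : MIS T,
    u rho \in (if val rho \in A then B_space m m' r (val rho) else 0%VS).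
Proof.
apply: (vspan_submodE (P := [set u : {ffun MIS T -> P} | forall rho : MIS T,
  u rho \in (if val rho \in A then B_space m m' r (val rho) else 0%VS)]))
  => /= [rho|a v w vP wP rho]; first by rewrite ffunE mem0v.
by rewrite !ffunE memvD ?memvZ.
Qed.

End Membership.

(* Main.v *)
(** The jumps of a spline across the interior edges form a cycle in the cellular
    chain complex of the domain relative to its boundary, and this complex is
    exact at the edges and at the vertices. Exactness at the vertices holds since
    from an interior vertex one can always move right or up along edges until the
    boundary is reached. For exactness at the edges, a cycle can be integrated
    around each point, hence defines a Cech cocycle on the cover of the domain by
    the cells; its sum along a closed chain of cells vanishes, by subdividing the
    square on which a null homotopy of a loop following the chain is defined.
    Counting dimensions gives
      dim S = chi + dim (sum of the I_gamma) - dim (boundaries of the I_tau).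

    Since I_gamma is the sum of the ideals of the two maximal segments through
    gamma, it is a quotient of a space of functions w on the pairs (vertex,
    direction), whose kernel corresponds to the vertex relations. Along a maximal
    segment the boundaries of edges identify all vertices with each other, and
    with 0 if the segment meets the boundary: modulo them, w is determined by
    its sums over the MISs. Hence the last difference is dim M(MIS) - dim R.

    For a deletion, let lambda be a functional on polynomials of degree at most n
    killing the multiples of all (s - s_i)^(k_i). Then lambda((s - x)^n) is
    divisible by all (x - s_i)^(n + 1 - k_i), hence vanishes if the sum of the
    n + 1 - k_i exceeds n. So these multiples span, and every element of B_rho is
    the rho-component of a relation supported on the remaining MISs. *)

From HB Require Import structures.
From mathcomp Require Import all_boot all_order all_algebra finmap.
From mathcomp Require Import all_classical all_reals topology normedtype.
From mathcomp Require Import zify ring lra.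
Require Import Defs.

Set Implicit Arguments.
Unset Strict Implicit.
Unset Printing Implicit Defensive.

Import Order.TTheory GRing.Theory Num.Theory.
Import numFieldNormedType.Exports.

Local Open Scope classical_set_scope.
Local Open Scope ring_scope.

(** * Products of spaces and polynomials of bounded bidegree *)

Section ProductSpaces.
Variables (K : fieldType) (V : vectType K) (I : finType).
Implicit Types (U : I -> {vspace V}) (u : {ffun I -> V}).

Definition single (i : I) (v : V) : {ffun I -> V} :=
  [ffun j => if j == i then v else 0].

Fact single_linear i : linear (single i).
Proof.
move=> a u v; apply/ffunP => j; rewrite !ffunE.
by case: eqP => // _; rewrite scaler0 addr0.
Qed.
HB.instance Definition _ i :=
  GRing.isLinear.Build K V {ffun I -> V} _ (single i) (single_linear i).

Lemma sum_single u : u = \sum_i single i (u i).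
Proof.
apply/ffunP => j; rewrite sum_ffunE (bigD1 j) //= ffunE eqxx big1 ?addr0 //.
by move=> i ij; rewrite ffunE eq_sym (negPf ij).
Qed.

Definition prodv U : {vspace {ffun I -> V}} := vspan [set u : {ffun I -> V} | forall i, u i \in U i].

Lemma memv_prodv U u : u \in prodv U <-> forall i, u i \in U i.
Proof.
apply: (vspan_submodE (P := [set u : {ffun I -> V} | forall i, u i \in U i])).
  by move=> i /=; rewrite ffunE mem0v.
by move=> a v w vP wP i; rewrite !ffunE memvD // memvZ.
Qed.

Lemma single_prodv U i v : v \in U i -> single i v \in prodv U.
Proof.
by move=> Uv; apply/memv_prodv => j; rewrite ffunE; case: eqP => [->|_] //;
  rewrite mem0v.
Qed.

Lemma dim_prodv U : \dim (prodv U) = (\sum_i \dim (U i))%N.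
Proof.
pose W i := (linfun (single i) @: U i)%VS.
have memW i w : w \in W i -> w = single i (w i) /\ w i \in U i.
  case/memv_imgP => v Uv ->; rewrite lfunE /=.
  by have -> : single i v i = v by rewrite ffunE eqxx.
have dW : directv (\sum_i W i).
  apply/directv_sum_independent => w wW w0 i _; have [-> _] := memW i _ (wW i isT).
  have := congr1 (fun f : {ffun I -> V} => f i) w0.
  rewrite sum_ffunE ffunE (bigD1 i) //= big1 ?addr0 => [->|j ji].
    by rewrite linear0.
  by have [-> _] := memW j _ (wW j isT); rewrite ffunE eq_sym (negPf ji).
have -> : prodv U = (\sum_i W i)%VS.
  apply/vspaceP => u; apply/idP/idP => [/memv_prodv uP|].
    rewrite (sum_single u); apply: memv_sumr => i _.
    by apply/memv_imgP; exists (u i) => //; rewrite lfunE.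
  case/memv_sumP => w wW ->; apply: memv_suml => i _.
  by have [e wU] := memW i _ (wW i isT); rewrite e; apply: single_prodv.
rewrite (directvP dW) /=; apply: eq_bigr => i _.
rewrite limg_dim_eq //; apply/eqP; rewrite -subv0; apply/subvP => v.
rewrite memv_cap memv_ker lfunE memv0 => /andP[_ /eqP v0].
by have := congr1 (fun f : {ffun I -> V} => f i) v0; rewrite !ffunE eqxx => ->.
Qed.

End ProductSpaces.

Section Bidegree.
Variable R : realType.
Implicit Types (p d x y : {poly {poly R}}) (a b : nat).

Definition bideg a b p := (size p <= b)%N /\ forall j, (size (p`_j)%R <= a)%N.

Lemma bidegN a b p : bideg a b p -> bideg a b (- p).
Proof. by case=> pb pa; split=> [|j]; rewrite ?coefN size_polyN. Qed.

Lemma bidegP a b p :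
  bideg a b p <-> forall i j, p`_j`_i != 0 -> (i < a)%N /\ (j < b)%N.
Proof.
split=> [[pb pa] i j nz|H]; first split.
- rewrite ltnNge; apply: contraNN nz => ai.
  by rewrite (nth_default 0) // (leq_trans (pa j)).
- rewrite ltnNge; apply: contraNN nz => bj.
  by rewrite (nth_default 0 (s := p)) ?(leq_trans pb) // coef0.
- split=> [|j].
    apply/leq_sizeP => j bj; apply/polyP => i; rewrite coef0; apply/eqP.
    by apply: contraT => /H[_]; rewrite ltnNge bj.
  apply/leq_sizeP => i ai; apply/eqP.
  by apply: contraT => /H[]; rewrite ltnNge ai.
Qed.

(* Multiplying by X - c with c constant does not lose information on the
   coefficients: they are recovered from the top down. *)
Lemma coef_mulXsubC_closed (S : {poly R} -> Prop) (c : R) p :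
  S 0 -> (forall u v, S u -> S v -> S (u + c%:P * v)) ->
  (forall j, S (('X - c%:P%:P) * p)`_j) -> forall j, S p`_j.
Proof.
move=> S0 SD Sp j; have [k] := ubnP (size p - j)%N.
elim: k j => // k IH j; have [pj _|jp] := leqP (size p) j.
  by rewrite nth_default.
move=> kj; have -> : p`_j = (('X - c%:P%:P) * p)`_j.+1 + c%:P * p`_j.+1.
  by rewrite mulrBl coefB coefXM coefCM subrK.
by apply: SD => //; apply: IH; lia.
Qed.

Lemma coef_mulXsubCX_closed (S : {poly R} -> Prop) (c : R) k p :
  S 0 -> (forall u v, S u -> S v -> S (u + c%:P * v)) ->
  (forall j, S (('X - c%:P%:P) ^+ k * p)`_j) -> forall j, S p`_j.
Proof.
move=> S0 SD; elim: k p => [|k IH] p; first by rewrite expr0 mul1r.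
rewrite exprS -mulrA => /(coef_mulXsubC_closed S0 SD); exact: IH.
Qed.

Lemma bideg_ell_dvd h c k a b p : (0 < a)%N -> (0 < b)%N ->
  bideg a b (ell h c ^+ k * p) ->
  if h then bideg a (b - k) p else bideg (a - k) b p.
Proof.
move=> a0 b0; case: h => -[pb pa]; split.
- have [->|p0] := eqVneq p 0; first by rewrite size_poly0.
  rewrite size_monicM ?monic_exp ?monicXsubC // in pb.
  rewrite size_exp_XsubC in pb; have : size p != 0%N by rewrite size_poly_eq0.
  lia.
- apply: (@coef_mulXsubCX_closed (fun u => (size u <= a)%N) c k).
  + by rewrite size_poly0.
  + move=> u v ua va; apply: leq_trans (size_polyD _ _) _; rewrite geq_max ua /=.
    by rewrite mul_polyC; apply: leq_trans (size_scale_leq _ _) _.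
  + exact: pa.
- have [->|p0] := eqVneq p 0; first by rewrite size_poly0.
  by move: pb; rewrite /ell -rmorphXn /= size_Cmul // monic_neq0 ?monic_exp ?monicXsubC.
- move=> j; have := pa j; rewrite /ell -rmorphXn /= coefCM.
  have [->|p0] := eqVneq p`_j 0; first by rewrite size_poly0.
  rewrite size_monicM ?monic_exp ?monicXsubC // size_exp_XsubC.
  by rewrite addSn /= leq_psubRL // lt0n size_poly_eq0.
Qed.

Lemma bideg_ell_mul h c k a b p : (0 < a)%N -> (0 < b)%N ->
  (if h then bideg a (b - k) p else bideg (a - k) b p) ->
  bideg a b (ell h c ^+ k * p).
Proof.
move=> a0 b0; have [->|p0] := eqVneq p 0.
  by rewrite mulr0 => _; split=> [|j]; rewrite ?coef0 size_poly0.
have sp : size p != 0%N by rewrite size_poly_eq0.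
case: h => -[pb pa]; split.
- rewrite size_monicM ?monic_exp ?monicXsubC // size_exp_XsubC; lia.
- rewrite /ell; elim: k {sp pb} p p0 pa => [|k IH] p p0 pa j.
    by rewrite expr0 mul1r.
  rewrite exprSr -mulrA; apply: IH => [|i].
    by rewrite mulf_neq0 // -size_poly_eq0 size_XsubC.
  rewrite mulrBl coefB coefXM coefCM; apply: leq_trans (size_polyD _ _) _.
  rewrite geq_max size_polyN mul_polyC (leq_trans (size_scale_leq _ _)) // andbT.
  by case: eqP; rewrite ?size_poly0.
- rewrite /ell -rmorphXn /= mul_polyC; exact: leq_trans (size_scale_leq _ _) pb.
- move=> j; rewrite /ell -rmorphXn /= coefCM.
  have [->|q0] := eqVneq p`_j 0; first by rewrite mulr0 size_poly0.
  rewrite size_monicM ?monic_exp ?monicXsubC // size_exp_XsubC.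
  by have := pa j; rewrite addSn /= leq_psubRL // lt0n size_poly_eq0.
Qed.

Lemma ell_neq0 h c k : (ell h c : {poly {poly R}}) ^+ k != 0.
Proof.
by rewrite expf_neq0 //; case: h; rewrite /ell ?polyC_eq0 -size_poly_eq0 size_XsubC.
Qed.

(* The two lines being perpendicular, their equations are coprime. *)
Lemma ell_syzygy c c' k k' x y :
  ell true c ^+ k * x + ell false c' ^+ k' * y = 0 ->
  exists q, x = - (ell false c' ^+ k' * q) /\ y = ell true c ^+ k * q.
Proof.
move=> E; pose d := ('X - c'%:P : {poly R}) ^+ k'.
have dE : ell false c' ^+ k' = d%:P by rewrite /ell -rmorphXn.
have [q xE] : exists q, x = - (d%:P * q).
  have : forall j, exists g, x`_j = d * g.
    apply: (@coef_mulXsubCX_closed (fun u => exists g, u = d * g) c k).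
    - by exists 0; rewrite mulr0.
    - by move=> _ _ [g ->] [h ->]; exists (g + c%:P * h); rewrite mulrDr mulrCA.
    - move=> j; exists (- y`_j); move/eqP: E; rewrite addr_eq0 => /eqP ->.
      by rewrite dE coefN coefCM mulrN.
  move/choice => [g xg]; exists (- \poly_(j < size x) g j).
  rewrite mulrN opprK; apply/polyP => j; rewrite coefCM coef_poly.
  case: ltnP => [_|jx]; first exact: xg.
  by rewrite mulr0 nth_default.
exists q; rewrite dE; split=> //.
have : d%:P * (y - ell true c ^+ k * q) = 0.
  by rewrite mulrBr -dE -[_ * y](addKr (ell true c ^+ k * x)) E addr0 xE dE; ring.
by move/eqP; rewrite mulf_eq0 -dE (negPf (ell_neq0 _ _ _)) /= subr_eq0 => /eqP.
Qed.

End Bidegree.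

Section BiPoly.
Variables (R : realType) (m m' : nat).
Notation P := (bipoly R m m').
Implicit Types (A : P) (p : {poly {poly R}}).

Definition of_poly p : P := \matrix_(i, j) p`_j`_i.

Lemma coef_poly_of A j i : (poly_of A)`_j`_i =
  \sum_(k < m.+1) \sum_(l < m'.+1) A k l *+ ((k == i :> nat) && (l == j :> nat)).
Proof.
rewrite /poly_of coef_sum coef_sum; apply: eq_bigr => k _.
rewrite coef_sum coef_sum; apply: eq_bigr => l _.
rewrite coefCM coefXn [j == l]eq_sym; case: eqP => _; last by rewrite mulr0 coef0 andbF.
by rewrite mulr1 coefZ coefXn eq_sym andbT; case: eqP; rewrite ?mulr1 ?mulr0.
Qed.

Lemma coef_poly_of_ord A (i : 'I_m.+1) (j : 'I_m'.+1) : (poly_of A)`_j`_i = A i j.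
Proof.
rewrite coef_poly_of (bigD1 i) //= (bigD1 j) //= !eqxx /=.
rewrite !big1 ?addr0 // => [k ki|l lj].
  by rewrite big1 // => l _; rewrite val_eqE (negPf ki).
by rewrite val_eqE (negPf lj).
Qed.

Lemma bideg_poly_of A : bideg m.+1 m'.+1 (poly_of A).
Proof.
apply/bidegP => i j; rewrite coef_poly_of => nz.
split; rewrite ltnNge; apply: contraNN nz => le; rewrite big1 // => k _;
  rewrite big1 // => l _.
  by rewrite (ltn_eqF (leq_trans (ltn_ord k) le)).
by rewrite andbC (ltn_eqF (leq_trans (ltn_ord l) le)).
Qed.

Lemma poly_ofK : cancel (@poly_of R m m') of_poly.
Proof. by move=> A; apply/matrixP => i j; rewrite mxE coef_poly_of_ord. Qed.

Lemma of_polyK p : bideg m.+1 m'.+1 p -> poly_of (of_poly p) = p.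
Proof.
move=> pP; apply/polyP => j; apply/polyP => i.
case: (ltnP i m.+1) => [im|mi]; last first.
  have [_ /(_ j) s1] := pP; have [_ /(_ j) s2] := bideg_poly_of (of_poly p).
  by rewrite [LHS]nth_default ?[RHS]nth_default ?(leq_trans s1 mi) ?(leq_trans s2 mi).
case: (ltnP j m'.+1) => [jm|mj]; last first.
  have [s1 _] := pP; have [s2 _] := bideg_poly_of (of_poly p).
  have e1 : p`_j = 0 by rewrite nth_default // (leq_trans s1 mj).
  have -> : (poly_of (of_poly p))`_j = 0 by rewrite nth_default // (leq_trans s2 mj).
  by rewrite e1.
by rewrite (coef_poly_of_ord _ (Ordinal im) (Ordinal jm)) mxE.
Qed.

Lemma poly_of_inj : injective (@poly_of R m m').
Proof. exact: can_inj poly_ofK. Qed.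

Lemma poly_ofZ a A : poly_of (a *: A) = a%:P%:P * poly_of A.
Proof. by rewrite -[a *: A]addr0 poly_ofE poly_of0 addr0. Qed.

Lemma poly_ofD A B : poly_of (A + B) = poly_of A + poly_of B.
Proof. by rewrite -[A]scale1r poly_ofE scale1r !polyC1 mul1r. Qed.

Lemma poly_ofN A : poly_of (- A) = - poly_of A.
Proof. by rewrite -scaleN1r poly_ofZ !polyCN !polyC1 mulN1r. Qed.

Lemma poly_ofB A B : poly_of (A - B) = poly_of A - poly_of B.
Proof. by rewrite poly_ofD poly_ofN. Qed.

Definition mulp (d : {poly {poly R}}) (A : P) : P := of_poly (d * poly_of A).

Fact mulp_linear d : linear (mulp d).
Proof.
move=> a A B; apply/matrixP => i j.
by rewrite !mxE poly_ofE mulrDr coefD coefD mulrCA coefCM coefCM.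
Qed.
HB.instance Definition _ d := GRing.isLinear.Build R P P _ (mulp d) (mulp_linear d).

Lemma Rspace_bideg (a b : int) (a' b' : nat) A :
  (forall i : nat, (i%:Z <= a) = (i < a')%N) ->
  (forall j : nat, (j%:Z <= b) = (j < b')%N) ->
  A \in Rspace R m m' a b <-> bideg a' b' (poly_of A).
Proof.
move=> aE bE; split=> [/memv_Rspace H|/bidegP H].
  apply/bidegP => i j nz; have /bidegP /(_ _ _ nz)[im jm] := bideg_poly_of A.
  by have := H (Ordinal im) (Ordinal jm); rewrite -coef_poly_of_ord aE bE; apply.
by apply/memv_Rspace => i j; rewrite -coef_poly_of_ord aE bE; apply: H.
Qed.

End BiPoly.

(** * Rectangles and segments *)

Lemma finite_gap (R : realType) (X : eqType) (s : seq X) (Q : X -> R -> Prop) :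
  (forall x, x \in s -> exists2 d, 0 < d & forall t, 0 < t < d -> Q x t) ->
  exists2 d, 0 < d & forall x, x \in s -> forall t, 0 < t < d -> Q x t.
Proof.
elim: s => [|x s IH] H; first by exists 1.
have [|d d0 dQ] := IH; first by move=> y ys; apply: H; rewrite inE ys orbT.
have [d' d'0 d'Q] := H x (mem_head _ _).
exists (Num.min d d') => [|y]; first by rewrite lt_min d0.
rewrite inE => /predU1P[->|ys] t; rewrite lt_min => /and3P[t0 td td'].
  by apply: d'Q; rewrite t0.
by apply: dQ => //; rewrite t0.
Qed.

Section Coordinates.
Variable R : realType.
Implicit Types (h a b : bool) (p q : R * R) (c : rect R) (e : seg R) (x y t lo hi : R).

Definition pcoord h p : R := if h then p.1 else p.2.
Definition rlo h c := if h then rect_s0 c else rect_t0 c.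
Definition rhi h c := if h then rect_s1 c else rect_t1 c.

Lemma coord_line h x y : pcoord h (line_pt h y x) = x.
Proof. by case: h. Qed.

Lemma coord_lineN h x y : pcoord (~~ h) (line_pt h y x) = y.
Proof. by case: h. Qed.

Lemma line_ptK h p : line_pt h (pcoord (~~ h) p) (pcoord h p) = p.
Proof. by case: h; case: p. Qed.

Lemma coord_inj h p q :
  pcoord h p = pcoord h q -> pcoord (~~ h) p = pcoord (~~ h) q -> p = q.
Proof. by move=> e1 e2; rewrite -(line_ptK h p) e1 e2 line_ptK. Qed.

Lemma on_segE e p : on_seg e p =
  (pcoord (~~ seg_hor e) p == seg_pos e) && (seg_lo e <= pcoord (seg_hor e) p <= seg_hi e).
Proof. by rewrite /on_seg; case: (seg_hor e). Qed.

Lemma mem_rect c p :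
  rect_set c p <-> forall h, rlo h c <= pcoord h p <= rhi h c.
Proof.
split=> [[p1 p2] [] //|H]; split; [exact: (H true)|exact: (H false)].
Qed.

Lemma nbhs_box p (A : set (R * R)) : nbhs p A <->
  exists2 d, 0 < d & forall q, (forall h, `|pcoord h q - pcoord h p| < d) -> A q.
Proof.
rewrite nbhs_ballP; split=> -[d d0 dA]; exists d => // q H.
  by apply: dA; split; rewrite -ball_normE /= distrC; [apply: (H true)|apply: (H false)].
by apply: dA => -[]; case: H => + +; rewrite -!ball_normE /= distrC //; move=> _; rewrite distrC.
Qed.

Lemma interior_rectP c p :
  interior (rect_set c) p <-> forall h, rlo h c < pcoord h p < rhi h c.
Proof.
rewrite /interior /= nbhs_box; split=> [[d d0 H] h|H].
  have sh s : `|s| < d -> rlo h c <= pcoord h p + s <= rhi h c.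
    move=> sd; have /mem_rect/(_ h) : rect_set c (line_pt h (pcoord (~~ h) p) (pcoord h p + s)).
      apply: H => k; have [->|/negPf kh] := eqVneq k h; first by rewrite coord_line addrC addKr.
      have -> : k = ~~ h by case: (k) (h) kh => -[].
      by rewrite coord_lineN subrr normr0.
    by rewrite coord_line.
  have := sh (d / 2); have := sh (- (d / 2)).
  rewrite normrN gtr0_norm; lra.
exists (Num.min (Num.min (pcoord true p - rlo true c) (rhi true c - pcoord true p))
  (Num.min (pcoord false p - rlo false c) (rhi false c - pcoord false p))).
  by rewrite !lt_min; have := H true; have := H false; lra.
move=> q Hq; apply/mem_rect => h; have := Hq true; have := Hq false.
by rewrite !lt_min !ltr_norml; case: h; lra.
Qed.

Lemma closed_rect c : closed (rect_set c).
Proof.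
move=> p clp; apply/mem_rect => h; apply: contrapT => /negP np.
pose d := Num.max (rlo h c - pcoord h p) (pcoord h p - rhi h c).
have d0 : 0 < d by rewrite lt_max; lra.
have [|q [/mem_rect/(_ h) qc /(_ h)]] := clp [set q | forall h, `|pcoord h q - pcoord h p| < d].
  by apply/nbhs_box; exists d.
rewrite /d lt_max ltr_norml ltr_norml; lra.
Qed.

Lemma frontier_rectP c p : (forall h, rlo h c < rhi h c) ->
  frontier (rect_set c) p <->
  rect_set c p /\ exists h, pcoord h p = rlo h c \/ pcoord h p = rhi h c.
Proof.
move=> ndc; split=> [[/closed_rect pc] /interior_rectP ni|[pc [h ph]]]; split=> //.
- apply: contrapT => ne; apply: ni => h; move/mem_rect: pc => /(_ h).
  rewrite !le_eqVlt => /andP[/orP[/eqP e|->] /orP[/eqP e'|->]] //;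
  by case: ne; exists h; rewrite ?e ?e'; auto.
- exact: subset_closure.
- by move/interior_rectP/(_ h); case: ph => ->; rewrite ltxx ?andbF.
Qed.

(* A half-line issued from x, towards +oo if a and towards -oo otherwise, starts
   inside [lo, hi]. *)
Definition in1 a lo hi x := if a then lo <= x < hi else lo < x <= hi.

Definition sg a : R := if a then 1 else -1.

Lemma in1_le a lo hi x : in1 a lo hi x -> lo <= x <= hi.
Proof. by case: a => /=; lra. Qed.

Lemma in1_ex lo hi x : lo < hi -> lo <= x <= hi -> exists a, in1 a lo hi x.
Proof. by move=> lt le; case: (ltP x hi) => H; [exists true|exists false] => /=; lra. Qed.

Lemma in1_oo a lo hi x : lo < x < hi -> in1 a lo hi x.
Proof. by case: a => /=; lra. Qed.

Lemma in1_near a lo hi x : in1 a lo hi x ->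
  exists2 d, 0 < d & forall t, 0 < t < d -> lo < x + sg a * t < hi.
Proof.
case: a => /= H; [exists (hi - x)|exists (x - lo)]; rewrite /sg; try lra;
  by move=> t; lra.
Qed.

Lemma Nin1_near a lo hi x : ~~ in1 a lo hi x ->
  exists2 d, 0 < d & forall t, 0 < t < d -> ~~ (lo <= x + sg a * t <= hi).
Proof.
case: a => /= H; rewrite /sg.
  case: (ltP x lo) => H'; [exists (lo - x)|exists 1]; try lra; move=> t; lra.
case: (ltP hi x) => H'; [exists (x - hi)|exists 1]; try lra; move=> t; lra.
Qed.

(* The open quadrant at p with direction a on the h axis and b on the other axis
   is contained in c near p. *)
Definition inq h a b c p :=
  in1 a (rlo h c) (rhi h c) (pcoord h p) &&
  in1 b (rlo (~~ h) c) (rhi (~~ h) c) (pcoord (~~ h) p).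

Lemma inqC h a b c p : inq (~~ h) b a c p = inq h a b c p.
Proof. by rewrite /inq negbK andbC. Qed.

Lemma bool_forall h (S : bool -> Prop) : S h -> S (~~ h) -> forall k, S k.
Proof. by case: h => ? ? []. Qed.

Lemma inq_split h a b a' b' c p : inq h a b c p -> inq h a' b' c p -> inq h a b' c p.
Proof. by rewrite /inq => /andP[-> _] /andP[_ ->]. Qed.

Definition nondeg c := forall h, rlo h c < rhi h c.

Lemma rect_inq h c p : nondeg c -> rect_set c p -> exists a b, inq h a b c p.
Proof.
move=> nd /mem_rect H; have [a ain] := in1_ex (nd h) (H h).
by have [b bin] := in1_ex (nd (~~ h)) (H (~~ h)); exists a, b; rewrite /inq ain.
Qed.

Definition qshift h a b t p :=
  line_pt h (pcoord (~~ h) p + sg b * t) (pcoord h p + sg a * t).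

Lemma inq_shift h a b c p : inq h a b c p ->
  exists2 d, 0 < d & forall t, 0 < t < d -> interior (rect_set c) (qshift h a b t p).
Proof.
case/andP => /in1_near[d d0 dP] /in1_near[d' d'0 d'P].
exists (Num.min d d') => [|t]; first by rewrite lt_min d0.
rewrite lt_min => /and3P[t0 td td']; apply/interior_rectP.
apply: (@bool_forall h); rewrite ?coord_line ?coord_lineN.
  by apply: dP; rewrite t0.
by apply: d'P; rewrite t0.
Qed.

Lemma Ninq_shift h a b c p : ~~ inq h a b c p ->
  exists2 d, 0 < d & forall t, 0 < t < d -> ~ rect_set c (qshift h a b t p).
Proof.
rewrite negb_and => /orP[|] /Nin1_near[d d0 dP]; exists d => // t td /mem_rect H.
  by have := H h; rewrite coord_line; apply/negP/dP.
by have := H (~~ h); rewrite coord_lineN; apply/negP/dP.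
Qed.

Definition germ e a p :=
  (pcoord (~~ seg_hor e) p == seg_pos e) && in1 a (seg_lo e) (seg_hi e) (pcoord (seg_hor e) p).

Lemma germ_on e a p : germ e a p -> on_seg e p.
Proof. by rewrite on_segE => /andP[-> /in1_le]. Qed.

Lemma on_germ e p : seg_lo e < seg_hi e -> on_seg e p -> exists a, germ e a p.
Proof.
rewrite on_segE => lt /andP[e0 le]; have [a ain] := in1_ex lt le.
by exists a; rewrite /germ e0.
Qed.

Lemma seg_end0_on e : seg_lo e < seg_hi e -> on_seg e (seg_end0 e).
Proof. by rewrite on_segE /seg_end0 coord_line coord_lineN eqxx; lra. Qed.

Lemma seg_end1_on e : seg_lo e < seg_hi e -> on_seg e (seg_end1 e).
Proof. by rewrite on_segE /seg_end1 coord_line coord_lineN eqxx; lra. Qed.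

Lemma seg_setE e : seg_set e = rect_set (if seg_hor e
  then Rect (seg_lo e) (seg_hi e) (seg_pos e) (seg_pos e)
  else Rect (seg_pos e) (seg_pos e) (seg_lo e) (seg_hi e)).
Proof.
apply/seteqP; split=> p; rewrite /seg_set /= /on_seg /rect_set; case: (seg_hor e) => /=.
- by case/andP => /eqP -> ->; rewrite lexx.
- by case/andP => /eqP -> ->; rewrite lexx.
- by case=> -> pp; rewrite andbT eq_le andbC.
- by case=> pp ->; rewrite andbT eq_le andbC.
Qed.

Lemma closed_seg e : closed (seg_set e).
Proof. by rewrite seg_setE; apply: closed_rect. Qed.

Lemma connected_seg e : connected (seg_set e).
Proof.
have -> : seg_set e = line_pt (seg_hor e) (seg_pos e) @` `[seg_lo e, seg_hi e].
  apply/seteqP; split=> p /=.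
    rewrite /seg_set /= on_segE => /andP[/eqP pp pe]; exists (pcoord (seg_hor e) p).
      by rewrite /= in_itv.
    by rewrite -pp line_ptK.
  by case=> x; rewrite /= in_itv /= => xe <-; rewrite /seg_set /= on_segE coord_line coord_lineN eqxx.
apply: connected_continuous_connected; first exact: segment_connected.
apply: continuous_subspaceT => x; rewrite /line_pt; case: (seg_hor e).
  by apply: (@cvg_pair _ _ _ _ (nbhs x) (nbhs (seg_pos e))); [exact: cvg_id|exact: cvg_cst].
by apply: (@cvg_pair _ _ _ _ (nbhs (seg_pos e)) (nbhs x)); [exact: cvg_cst|exact: cvg_id].
Qed.

End Coordinates.

(** * Cells and edges around a point *)

Section MeshGeometry.
Variables (R : realType) (T : premesh R).
Hypotheses (HT : is_tmesh T) (HR : is_reduced T).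
Implicit Types (h a b : bool) (p q z : R * R) (c : rect R) (e : seg R).

Lemma cell_nondeg c : c \in cells T -> nondeg c.
Proof. by move/(tmesh_cell HT) => [s t] []. Qed.

Lemma inq_uniq h a b c c' p : c \in cells T -> c' \in cells T ->
  inq h a b c p -> inq h a b c' p -> c = c'.
Proof.
move=> cT c'T /inq_shift[d d0 dP] /inq_shift[d' d'0 d'P]; apply/eqP/negP => /negP ne.
pose t := Num.min d d' / 2; have t0 : 0 < t < Num.min d d'.
  have : 0 < Num.min d d' by rewrite lt_min d0.
  rewrite /t; lra.
have := tmesh_disjoint HT cT c'T ne; rewrite -subset0 => /(_ (qshift h a b t p)); apply.
by move: t0; rewrite lt_min => /and3P[? ? ?]; split; [apply: dP|apply: d'P]; apply/andP.
Qed.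

Lemma interior_cell_uniq c c' p : c \in cells T -> c' \in cells T ->
  interior (rect_set c) p -> rect_set c' p -> c' = c.
Proof.
move=> cT c'T /interior_rectP ci /(rect_inq true (cell_nondeg c'T))[a [b c'q]].
by apply: inq_uniq c'q _ => //; rewrite /inq !in1_oo.
Qed.

Lemma edge_lt e : e \in edges T -> seg_lo e < seg_hi e.
Proof. exact: tmesh_edge. Qed.

Lemma edge_frontier e p : e \in edges T -> on_seg e p ->
  exists2 c, c \in cells T & frontier (rect_set c) p.
Proof. by move=> eT ep; have [c] := tmesh_edge_sub HT eT ep; exists c. Qed.

Lemma edge_domain e p : e \in edges T -> on_seg e p -> domain T p.
Proof.
move=> eT /(edge_frontier eT)[c cT].
by case/(frontier_rectP p (cell_nondeg cT)) => pc _; exists c.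
Qed.

Lemma edge_notin_interior e c p : e \in edges T -> c \in cells T ->
  on_seg e p -> ~ interior (rect_set c) p.
Proof.
move=> eT cT /(edge_frontier eT)[c' c'T fp] ci.
have /(frontier_rectP p (cell_nondeg c'T))[pc' _] := fp.
by case: fp => _ []; rewrite (interior_cell_uniq cT c'T ci pc').
Qed.

Lemma interior_domainP h p :
  interior (domain T) p <-> forall a b, exists2 c, c \in cells T & inq h a b c p.
Proof.
rewrite /interior /= nbhs_box; split=> [[d d0 dP] a b|H].
  apply: contrapT => no.
  have [|d' d'0 d'P] := @finite_gap R _ (cells T)
      (fun c t => ~ rect_set c (qshift h a b t p)).
    by move=> c cT; apply: Ninq_shift; apply/negP => cq; apply: no; exists c.
  pose t := Num.min d d' / 2; have t0 : 0 < t < Num.min d d'.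
    have : 0 < Num.min d d' by rewrite lt_min d0.
    rewrite /t; lra.
  move: t0; rewrite lt_min => /and3P[t0 td td'].
  have [|c cT pc] := dP (qshift h a b t p); last by apply: (d'P c cT t); rewrite ?t0.
  apply: (@bool_forall h); rewrite ?coord_line ?coord_lineN addrC addKr normrM (gtr0_norm t0).
    by rewrite /sg; case: a {no d'P}; rewrite ?normrN normr1 mul1r.
  by rewrite /sg; case: b {no d'P}; rewrite ?normrN normr1 mul1r.
have {}H (x : bool * bool) : exists2 d, 0 < d & forall q,
    (forall k, `|pcoord k q - pcoord k p| < d) ->
    0 <= sg R x.1 * (pcoord h q - pcoord h p) -> 0 <= sg R x.2 * (pcoord (~~ h) q - pcoord (~~ h) p) ->
    domain T q.
  case: x => a b; have [c cT /andP[ci1 ci2]] := H a b.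
  have [d d0 dP] := in1_near ci1; have [d' d'0 d'P] := in1_near ci2.
  exists (Num.min d d') => [|q qd /= qa qb]; first by rewrite lt_min d0.
  exists c => //; apply/mem_rect; apply: (@bool_forall h).
    have := qd h; rewrite lt_min => /andP[+ _].
    move: qa (in1_le ci1) (dP `|pcoord h q - pcoord h p|).
    rewrite /sg; case: (a) => qa; [rewrite ger0_norm|rewrite ler0_norm]; lra.
  have := qd (~~ h); rewrite lt_min => /andP[_].
  move: qb (in1_le ci2) (d'P `|pcoord (~~ h) q - pcoord (~~ h) p|).
  rewrite /sg; case: (b) => qb; [rewrite ger0_norm|rewrite ler0_norm]; lra.
have [d1 d10 d1P] := H (true, true); have [d2 d20 d2P] := H (true, false).
have [d3 d30 d3P] := H (false, true); have [d4 d40 d4P] := H (false, false).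
exists (Num.min (Num.min d1 d2) (Num.min d3 d4)); first by rewrite !lt_min d10 d20 d30.
move=> q qd; have {}qd k : [/\ `|pcoord k q - pcoord k p| < d1, `|pcoord k q - pcoord k p| < d2,
    `|pcoord k q - pcoord k p| < d3 & `|pcoord k q - pcoord k p| < d4].
  by have := qd k; rewrite !lt_min => /andP[/andP[-> ->] /andP[-> ->]].
have [x0|x0] := lerP 0 (pcoord h q - pcoord h p);
  have [y0|y0] := lerP 0 (pcoord (~~ h) q - pcoord (~~ h) p).
- apply: d1P => [k||]; rewrite /sg /=; [by case: (qd k)|lra|lra].
- apply: d2P => [k||]; rewrite /sg /=; [by case: (qd k)|lra|lra].
- apply: d3P => [k||]; rewrite /sg /=; [by case: (qd k)|lra|lra].
- apply: d4P => [k||]; rewrite /sg /=; [by case: (qd k)|lra|lra].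
Qed.

Lemma interior_inq h a b p : interior (domain T) p ->
  exists2 c, c \in cells T & inq h a b c p.
Proof. by move/(interior_domainP h). Qed.

Lemma edge_end e p : e \in edges T -> p \in vertices T -> on_seg e p ->
  p = seg_end0 e \/ p = seg_end1 e.
Proof. by move=> /(reduced_edges HR)[rho [_ _ _ _ H]]; apply: H. Qed.

Lemma edge_end_coord e p : e \in edges T -> p \in vertices T -> on_seg e p ->
  pcoord (seg_hor e) p = seg_lo e \/ pcoord (seg_hor e) p = seg_hi e.
Proof.
move=> eT pV ep; have [->|->] := edge_end eT pV ep; rewrite /seg_end0 /seg_end1 coord_line; auto.
Qed.

Lemma seg_end0_vertex e : e \in edges T -> seg_end0 e \in vertices T.
Proof.
by move=> eT; rewrite in_fsetU; apply/orP; left; apply/imfsetP; exists e.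
Qed.

Lemma seg_end1_vertex e : e \in edges T -> seg_end1 e \in vertices T.
Proof.
by move=> eT; rewrite in_fsetU; apply/orP; right; apply/imfsetP; exists e.
Qed.

Lemma vertex_on_edge p : p \in vertices T -> exists2 e, e \in edges T & on_seg e p.
Proof.
rewrite in_fsetU => /orP[] /imfsetP[e /= eT ->]; exists e => //.
  by apply/seg_end0_on/edge_lt.
by apply/seg_end1_on/edge_lt.
Qed.

(* Edges with a common germ share points which are not vertices. *)
Lemma germ_uniq e e' a p : e \in edges T -> e' \in edges T ->
  seg_hor e = seg_hor e' -> germ e a p -> germ e' a p -> e = e'.
Proof.
move=> eT e'T hh /andP[/eqP ep ei] /andP[/eqP e'p e'i].
apply/eqP/negP => /negP ne; rewrite -hh in e'p e'i.
have [d d0 dP] := in1_near ei; have [d' d'0 d'P] := in1_near e'i.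
pose t := Num.min d d' / 2; have t0 : 0 < t < Num.min d d'.
  have : 0 < Num.min d d' by rewrite lt_min d0.
  rewrite /t; lra.
move: t0; rewrite lt_min => /and3P[t0 td td'].
pose q := line_pt (seg_hor e) (seg_pos e) (pcoord (seg_hor e) p + sg R a * t).
have [eq e'q /negP] : [/\ on_seg e q, on_seg e' q & q \notin vertices T].
  have := dP t; have := d'P t; rewrite t0 td td' => /(_ isT) A1 /(_ isT) A2; split.
  - by rewrite on_segE coord_line coord_lineN eqxx; lra.
  - by rewrite on_segE -hh coord_line coord_lineN -ep e'p eqxx; lra.
  - apply/negP => qV; have : on_seg e q by rewrite on_segE coord_line coord_lineN eqxx; lra.
    by move/(edge_end_coord eT qV); rewrite coord_line; lra.
apply; exact: (tmesh_edgeI HT eT e'T ne (conj eq e'q)).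
Qed.

Lemma frontier_edge c p : c \in cells T -> frontier (rect_set c) p ->
  exists e, [/\ e \in edges T, on_seg e p & forall q, on_seg e q -> frontier (rect_set c) q].
Proof.
move=> cT; have [E /fsubsetP EE ->] := tmesh_frontier HT cT.
by case=> e eE ep; exists e; split=> // [|q eq]; [apply: EE|exists e].
Qed.

Lemma frontier_germ h a b c p : c \in cells T -> inq h a b c p ->
  pcoord (~~ h) p = rlo (~~ h) c \/ pcoord (~~ h) p = rhi (~~ h) c ->
  exists e, [/\ e \in edges T, seg_hor e = h & germ e a p].
Proof.
move=> cT cq bd; apply: contrapT => no.
have /andP[ci1 ci2] := cq; have [d d0 dP] := in1_near ci1.
pose pt t := line_pt h (pcoord (~~ h) p) (pcoord h p + sg R a * t).
have [|d' d'0 d'P] := @finite_gap R _ (edges T) (fun e t => ~~ on_seg e (pt t)).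
  move=> e eT; have [eh|neh] := eqVneq (seg_hor e) h; last first.
    have eh : h = ~~ seg_hor e by case: (h) (seg_hor e) neh => -[].
    have [lt|le] := ltP 0 (sg R a * (seg_pos e - pcoord h p)).
      exists (sg R a * (seg_pos e - pcoord h p)) => // t /andP[t0 tlt].
      rewrite on_segE -eh /pt coord_line; apply/negP => /andP[/eqP A _].
      by move: tlt; rewrite -A /sg; case: (a); lra.
    exists 1 => // t /andP[t0 tlt].
    rewrite on_segE -eh /pt coord_line; apply/negP => /andP[/eqP A _].
    by move: le; rewrite -A /sg; case: (a); lra.
  have [ep|/eqP ep] := eqVneq (pcoord (~~ h) p) (seg_pos e); last first.
    by exists 1 => // t _; rewrite on_segE eh coord_lineN; case: eqP.
  have [ei|] := boolP (in1 a (seg_lo e) (seg_hi e) (pcoord h p)).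
    by case: no; exists e; split=> //; rewrite /germ eh ep eqxx.
  move/Nin1_near => [d' d'0 d'P]; exists d' => // t /d'P.
  by rewrite on_segE eh coord_lineN coord_line ep eqxx.
pose t := Num.min d d' / 2; have t0 : 0 < t < Num.min d d'.
  have : 0 < Num.min d d' by rewrite lt_min d0.
  rewrite /t; lra.
move: t0; rewrite lt_min => /and3P[t0 td td'].
have [|e [eT + _]] := @frontier_edge c (pt t) cT; last first.
  by apply/negP; apply: d'P; rewrite ?t0.
apply/(frontier_rectP _ (cell_nondeg cT)); split; last first.
  by exists (~~ h); rewrite coord_lineN.
apply/mem_rect; apply: (@bool_forall h); last by rewrite coord_lineN (in1_le ci2).
by have := dP t; rewrite t0 td coord_line => /(_ isT); lra.
Qed.

Lemma corner_vertex c p : c \in cells T ->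
  (forall h, pcoord h p = rlo h c \/ pcoord h p = rhi h c) -> p \in vertices T.
Proof.
move=> cT H; have nd := cell_nondeg cT.
have [|a [b cq]] := @rect_inq R true c p nd.
  by apply/mem_rect => h; have := nd h; case: (H h) => ->; lra.
have [e [eT eh eg]] := frontier_germ cT cq (H _).
have [e' [e'T e'h e'g]] := frontier_germ cT (etrans (inqC true a b c p) cq) (H _).
have ne : e != e' by apply/negP => /eqP ee; move: e'h; rewrite -ee eh.
exact: (tmesh_edgeI HT eT e'T ne (conj (germ_on eg) (germ_on e'g))).
Qed.

(* Otherwise a corner of c would be a vertex inside e. *)
Lemma edge_cell e a b c p : e \in edges T -> germ e a p -> c \in cells T ->
  inq (seg_hor e) a b c p ->
  [/\ rlo (seg_hor e) c <= seg_lo e, seg_hi e <= rhi (seg_hor e) c &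
      seg_pos e = if b then rlo (~~ seg_hor e) c else rhi (~~ seg_hor e) c].
Proof.
move=> eT /andP[/eqP ep ei] cT /andP[ci1 ci2]; set h := seg_hor e in ep ei ci1 ci2 *.
have posE : seg_pos e = if b then rlo (~~ h) c else rhi (~~ h) c.
  rewrite -ep; apply: contrapT => npos.
  have ci2' : rlo (~~ h) c < pcoord (~~ h) p < rhi (~~ h) c.
    by case: (b) ci2 npos => /=; lra.
  have [d d0 dP] := in1_near ci1; have [d' d'0 d'P] := in1_near ei.
  pose t := Num.min d d' / 2; have t0 : 0 < t < Num.min d d'.
    have : 0 < Num.min d d' by rewrite lt_min d0.
    rewrite /t; lra.
  move: t0; rewrite lt_min => /and3P[t0 td td'].
  apply: (@edge_notin_interior e c (line_pt h (seg_pos e) (pcoord h p + sg R a * t)) eT cT).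
    by have := d'P t; rewrite t0 td' on_segE -/h coord_line coord_lineN eqxx => /(_ isT); lra.
  apply/interior_rectP; apply: (@bool_forall h); rewrite ?coord_line ?coord_lineN -?ep //.
  by apply: dP; rewrite t0.
have pc : seg_pos e = rlo (~~ h) c \/ seg_pos e = rhi (~~ h) c.
  by rewrite posE; case: (b); auto.
have corner x : x = rlo h c \/ x = rhi h c -> seg_lo e < x < seg_hi e -> False.
  move=> xc xe; have qV : line_pt h (seg_pos e) x \in vertices T.
    by apply: (corner_vertex cT); apply: (@bool_forall h); rewrite ?coord_line ?coord_lineN.
  have qe : on_seg e (line_pt h (seg_pos e) x).
    by rewrite on_segE coord_line coord_lineN eqxx; lra.
  by have := edge_end_coord eT qV qe; rewrite coord_line; lra.
split=> //.
  rewrite leNgt; apply/negP => lt; apply: (@corner (rlo h c)); first by left.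
  by case: (a) ei ci1 => /=; lra.
rewrite leNgt; apply/negP => lt; apply: (@corner (rhi h c)); first by right.
by case: (a) ei ci1 => /=; lra.
Qed.

Definition is_side e b c :=
  [/\ c \in cells T, rlo (seg_hor e) c <= seg_lo e, seg_hi e <= rhi (seg_hor e) c &
      seg_pos e = if b then rlo (~~ seg_hor e) c else rhi (~~ seg_hor e) c].

Lemma side_inq e a b c p : is_side e b c -> germ e a p -> inq (seg_hor e) a b c p.
Proof.
case=> /cell_nondeg nd lo hi pos /andP[/eqP pp ei]; rewrite /inq pp pos.
have := nd (~~ seg_hor e); case: a ei; case: (b) => /= ? ?; lra.
Qed.

Lemma side_uniq e b c c' : e \in edges T -> is_side e b c -> is_side e b c' -> c = c'.
Proof.
move=> eT ec ec'; have elt := edge_lt eT.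
have [a eg] := on_germ elt (seg_end0_on elt).
have [[cT _ _ _] [c'T _ _ _]] := (ec, ec').
exact: (inq_uniq cT c'T (side_inq ec eg) (side_inq ec' eg)).
Qed.

Lemma side_sub e b c p : is_side e b c -> on_seg e p -> rect_set c p.
Proof.
case=> /cell_nondeg nd lo hi pos; rewrite on_segE => /andP[/eqP pp ei].
apply/mem_rect; apply: (@bool_forall (seg_hor e)); first lra.
by rewrite pp pos; have := nd (~~ seg_hor e); case: (b); lra.
Qed.

Lemma inner_edge_edge e : e \in inner_edges T -> e \in edges T.
Proof. by rewrite !inE => /andP[]. Qed.

Lemma inner_edge_side e b : e \in inner_edges T -> exists c, is_side e b c.
Proof.
rewrite !inE => /andP[eT /asboolP[p [/= ep pi]]].
have [a eg] := on_germ (edge_lt eT) ep.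
have [c cT cq] := interior_inq (seg_hor e) a b pi.
by exists c; have [? ? ?] := edge_cell eT eg cT cq.
Qed.

Lemma inner_edgeI e p : e \in edges T -> on_seg e p -> interior (domain T) p ->
  e \in inner_edges T.
Proof. by move=> eT ep ip; rewrite !inE eT; apply/asboolP; exists p. Qed.

Lemma inner_edge_interior e p : e \in inner_edges T ->
  seg_pos e = pcoord (~~ seg_hor e) p -> seg_lo e < pcoord (seg_hor e) p < seg_hi e ->
  interior (domain T) p.
Proof.
move=> eI pp pe; apply/(interior_domainP (seg_hor e)) => a b.
have [c ec] := inner_edge_side b eI; exists c; first by case: ec.
by apply: side_inq ec _; rewrite /germ pp eqxx in1_oo.
Qed.

Lemma side_neq e c : is_side e true c -> ~ is_side e false c.
Proof.
by move=> [/cell_nondeg nd _ _ E1] [_ _ _ E2]; have := nd (~~ seg_hor e); rewrite -E1 -E2 ltxx.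
Qed.

Lemma germ_separates h a c c' p : c \in cells T -> c' \in cells T -> c != c' ->
  inq h a true c p -> inq h a false c' p -> interior (domain T) p ->
  exists e, [/\ e \in inner_edges T, seg_hor e = h, germ e a p, is_side e true c & is_side e false c'].
Proof.
move=> cT c'T ne cq c'q ip.
have [|e [eT eh eg]] := @frontier_germ h a true c p cT cq.
  left; apply: contrapT => np; case/eqP: ne.
  apply: (inq_uniq cT c'T (h := h) (a := a) (b := false) (p := p)) => //.
  by move: cq; rewrite /inq /= => /andP[->] /=; lra.
exists e; split=> //; first exact: inner_edgeI (germ_on eg) ip.
  by split=> //; have [] := edge_cell eT eg cT (etrans (congr1 (fun h => inq h a true c p) eh) cq).
by split=> //; have [] := edge_cell eT eg c'T (etrans (congr1 (fun h => inq h a false c' p) eh) c'q).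
Qed.

End MeshGeometry.

(** * Maximal segments *)

Lemma in_fset_sep (K : choiceType) (A : {fset K}) (P : pred K) x :
  (x \in [fset y in A | P y]%fset) = (x \in A) && P x.
Proof. by rewrite in_fset inE. Qed.

(* A connected union of finitely many closed sets has a connected
   intersection graph. *)
Lemma connected_cover_ind (X : topologicalType) (I : choiceType) (r : {fset I})
    (F : I -> set X) (S : I -> Prop) :
  (forall i, i \in r -> closed (F i)) -> (forall i, i \in r -> F i !=set0) ->
  connected (\bigcup_(i in [set` r]) F i) ->
  (forall i j, i \in r -> j \in r -> F i `&` F j !=set0 -> S i -> S j) ->
  (exists2 i, i \in r & S i) -> forall i, i \in r -> S i.
Proof.
move=> clF F0 con tr [i0 i0r Si0] j jr; apply: contrapT => nSj.
pose B := \bigcup_(i in [set i | i \in r /\ S i]) F i.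
pose C := \bigcup_(i in [set i | i \in r /\ ~ S i]) F i.
have fin (P : I -> Prop) : finite_set [set i | i \in r /\ P i].
  by apply: sub_finite_set (finite_fset r) => i [].
have clB : closed B by apply: closed_bigcup (fin _) _ => i [ir _]; apply: clF.
have clC : closed C by apply: closed_bigcup (fin _) _ => i [ir _]; apply: clF.
have BC x : B x -> C x -> False.
  move=> [i [ir Si] Fi] [k [kr nSk] Fk]; apply: nSk.
  by apply: (tr i k ir kr _ Si); exists x.
have : B = \bigcup_(i in [set` r]) F i.
  apply: con.
  - by have [x Fx] := F0 _ i0r; exists x; exists i0.
  - exists (~` C); first exact: closed_openC.
    apply/seteqP; split=> x.
      by move=> Bx; split=> [|/(BC x Bx) //]; case: Bx => i [ir _] ?; exists i.
    case=> -[i ir Fi] nC; exists i => //; split=> //.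
    by apply: contrapT => nSi; apply: nC; exists i.
  - exists B => //; apply/seteqP; split=> x; last by case.
    by move=> Bx; split=> //; case: Bx => i [ir _] ?; exists i.
have [x Fx] := F0 _ jr; move=> E.
have Bx : B x by rewrite E; exists j.
by apply: (BC x Bx); exists j.
Qed.

Section MaximalSegments.
Variables (R : realType) (T : premesh R).
Hypotheses (HT : is_tmesh T) (HR : is_reduced T).
Implicit Types (h : bool) (p q z : R * R) (e : seg R) (rho : {fset seg R}).

Lemma max_segmentsP (E : {fset seg R}) rho : rho \in max_segments E <->
  [/\ (rho `<=` E)%fset, is_segment rho &
    forall rho', (rho' `<=` E)%fset -> is_segment rho' -> (rho `<=` rho')%fset -> rho' = rho].
Proof.
split.
  by rewrite in_fset_sep fpowersetE => /andP[? /asboolP[]].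
by case=> ? ? ?; rewrite in_fset_sep fpowersetE; apply/andP; split=> //; apply/asboolP.
Qed.

Lemma ms_rep_in rho : rho != fset0 -> ms_rep rho \in rho.
Proof.
rewrite /ms_rep => /fset0Pn[x xr].
have : x \in (rho : seq _) by [].
rewrite -[ms in head _ ms \in _]/(enum_fset rho) -[head _ _ \in rho]/(head _ (enum_fset rho) \in enum_fset rho).
by case: (enum_fset rho) => // y s _; rewrite mem_head.
Qed.

Lemma segment_hor rho e : is_segment rho -> e \in rho -> seg_hor e = ms_hor rho.
Proof. by case=> r0 col _ er; have [] := col e _ er (ms_rep_in r0). Qed.

Lemma segment_pos rho e : is_segment rho -> e \in rho -> seg_pos e = ms_pos rho.
Proof. by case=> r0 col _ er; have [] := col e _ er (ms_rep_in r0). Qed.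

Lemma on_msP rho p : reflect (exists2 e, e \in rho & on_seg e p) (on_ms rho p).
Proof. exact: hasP. Qed.

Lemma on_ms_pos rho p : is_segment rho -> on_ms rho p ->
  pcoord (~~ ms_hor rho) p = ms_pos rho.
Proof.
move=> sr /on_msP[e er]; rewrite on_segE (segment_hor sr er) (segment_pos sr er).
by case/andP => /eqP.
Qed.

Lemma hatMS_segment rho : rho \in hatMS T -> (rho `<=` edges T)%fset /\ is_segment rho.
Proof.
rewrite in_fsetU => /orP[|/max_segmentsP[sub sr _]]; last first.
  by split=> //; apply: fsubset_trans sub (fsubsetDl _ _).
rewrite in_fset_sep => /andP[/max_segmentsP[sub sr _] _]; split=> //.
by apply/fsubsetP => e /(fsubsetP sub)/inner_edge_edge.
Qed.

Lemma vertex_edge_dir p h : p \in vertices T ->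
  exists e, [/\ e \in edges T, seg_hor e = h & on_seg e p].
Proof.
move=> pV; have [rho [[rT hr /on_msP[e er ep]] _]] := reduced_vertex HR pV h.
have [/fsubsetP sub sr] := hatMS_segment rT.
by exists e; split=> //; [apply: sub|rewrite (segment_hor sr er)].
Qed.

Lemma segmentU1 rho e p : is_segment rho -> on_ms rho p -> on_seg e p ->
  seg_hor e = ms_hor rho -> is_segment (e |` rho)%fset.
Proof.
move=> sr rp ep eh; have [r0 col con] := sr; split.
- by apply/fset0Pn; exists e; rewrite fset1U1.
- have epos : seg_pos e = ms_pos rho.
    by rewrite -(on_ms_pos sr rp) -eh; move: ep; rewrite on_segE => /andP[/eqP].
  have H f : f \in (e |` rho)%fset -> seg_hor f = ms_hor rho /\ seg_pos f = ms_pos rho.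
    by rewrite in_fset1U => /predU1P[->|fr]; rewrite ?(segment_hor sr fr) ?(segment_pos sr fr).
  by move=> f g /H[fh fp] /H[gh gp]; split; rewrite ?fh ?fp.
- have -> : support (e |` rho)%fset = seg_set e `|` support rho.
    apply/seteqP; split=> x.
      case=> f; rewrite /= in_fset1U => /predU1P[->|fr] fx; first by left.
      by right; exists f.
    case=> [ex|[f fr fx]]; first by exists e; rewrite //= fset1U1.
    by exists f; rewrite //= in_fset1U fr orbT.
  apply: connectedU => //; last exact: connected_seg.
  by exists p; split=> //; have /on_msP[f fr fp] := rp; exists f.
Qed.

Lemma segmentU rho rho' p : is_segment rho -> is_segment rho' ->
  on_ms rho p -> on_ms rho' p -> ms_hor rho = ms_hor rho' -> is_segment (rho `|` rho')%fset.
Proof.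
move=> sr sr' rp rp' hh; have [r0 col con] := sr; have [r'0 col' con'] := sr'; split.
- by have [x xr] := fset0Pn _ r0; apply/fset0Pn; exists x; rewrite in_fsetU xr.
- have pp : ms_pos rho' = ms_pos rho by rewrite -(on_ms_pos sr rp) hh (on_ms_pos sr' rp').
  have H f : f \in (rho `|` rho')%fset -> seg_hor f = ms_hor rho /\ seg_pos f = ms_pos rho.
    rewrite in_fsetU => /orP[fr|fr].
      by rewrite (segment_hor sr fr) (segment_pos sr fr).
    by rewrite (segment_hor sr' fr) (segment_pos sr' fr).
  by move=> f g /H[fh fp] /H[gh gp]; split; rewrite ?fh ?fp.
- have -> : support (rho `|` rho')%fset = support rho `|` support rho'.
    apply/seteqP; split=> x.
      by case=> f; rewrite /= in_fsetU => /orP[] fr fx; [left|right]; exists f.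
    by case=> -[f fr fx]; exists f; rewrite //= in_fsetU fr ?orbT.
  apply: connectedU => //.
  by exists p; split; [have /on_msP[f fr fp] := rp|have /on_msP[f fr fp] := rp']; exists f.
Qed.

Lemma inner_vertexP p : p \in inner_vertices T <-> p \in vertices T /\ interior (domain T) p.
Proof.
rewrite in_fset_sep; split=> [/andP[pV /asboolP ip]|[pV ip]]; first by split.
by rewrite pV; apply/asboolP.
Qed.

Lemma MS_at_uniq rho rho' p : rho \in MS T -> rho' \in MS T ->
  ms_hor rho = ms_hor rho' -> on_ms rho p -> on_ms rho' p -> rho = rho'.
Proof.
move=> /max_segmentsP[sub sr mx] /max_segmentsP[sub' sr' mx'] hh rp rp'.
have sU := segmentU sr sr' rp rp' hh.
have subU : (rho `|` rho' `<=` inner_edges T)%fset by rewrite fsubUset sub.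
by rewrite -[LHS](mx _ subU sU (fsubsetUl _ _)) -[RHS](mx' _ subU sU (fsubsetUr _ _)).
Qed.

Lemma ms_atP h p : p \in inner_vertices T ->
  [/\ ms_at T h p \in MS T, ms_hor (ms_at T h p) = h & on_ms (ms_at T h p) p].
Proof.
case/inner_vertexP => pV ip.
have [rho [[rT hr rp] _]] := reduced_vertex HR pV h.
have rM : rho \in MS T.
  move: rT; rewrite in_fsetU => /orP[|/max_segmentsP[/fsubsetP sub _ _]].
    by rewrite in_fset_sep => /andP[].
  have /on_msP[e er ep] := rp; have := sub _ er.
  rewrite in_fsetD => /andP[/negP eI eT]; case: eI; exact: inner_edgeI ep ip.
rewrite /ms_at; set s := [seq _ <- _ | _].
have rs : rho \in s by rewrite mem_filter hr eqxx rp.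
have : head fset0 s \in s by case: (s) rs => // x s' _; rewrite mem_head.
by rewrite mem_filter => /andP[/andP[/eqP-> ->] ->].
Qed.

Lemma ms_at_uniq h p rho : p \in inner_vertices T -> rho \in MS T ->
  ms_hor rho = h -> on_ms rho p -> ms_at T h p = rho.
Proof.
move=> pI rM hr rp; have [aM ah ap] := ms_atP h pI.
by apply: (MS_at_uniq aM rM _ ap rp); rewrite ah hr.
Qed.

Lemma edge_ms_at e p : p \in inner_vertices T -> e \in inner_edges T -> on_seg e p ->
  e \in ms_at T (seg_hor e) p.
Proof.
move=> pI eI ep; have [/max_segmentsP[sub sr mx] ah ap] := ms_atP (seg_hor e) pI.
rewrite -(mx (e |` ms_at T (seg_hor e) p)%fset) ?fset1U1 ?fsubsetU1 //.
  by rewrite fsubUset sub fsub1set eI.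
exact: (segmentU1 sr ap ep).
Qed.

Lemma MS_edge rho e : rho \in MS T -> e \in rho ->
  [/\ e \in inner_edges T, seg_hor e = ms_hor rho & seg_pos e = ms_pos rho].
Proof.
move=> /max_segmentsP[/fsubsetP sub sr _] er.
by rewrite (sub _ er) (segment_hor sr er) (segment_pos sr er).
Qed.

Lemma MIS_MS rho : rho \in MIS T -> rho \in MS T.
Proof. by rewrite in_fset_sep => /andP[]. Qed.

Lemma MIS_vertex rho p : rho \in MIS T -> p \in vertices T -> on_ms rho p ->
  p \in inner_vertices T.
Proof.
rewrite in_fset_sep => /andP[rM /asboolP rI] pV /on_msP[e er ep]; apply/inner_vertexP; split=> //.
have [eI _ _] := MS_edge rM er.
apply: contrapT => np; have : support rho `&` frontier (domain T) !=set0.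
  exists p; split; first by exists e.
  by split=> //; apply: subset_closure; apply: edge_domain (inner_edge_edge eI) ep.
by rewrite rI => -[].
Qed.

Lemma ray_vertex rho : rho \in MS T -> rho \notin MIS T ->
  exists e p, [/\ e \in rho, p = seg_end0 e \/ p = seg_end1 e & p \notin inner_vertices T].
Proof.
move=> rM; rewrite in_fset_sep rM /= => /asboolP rI.
have [x [[e er ex] [_ nx]]] : support rho `&` frontier (domain T) !=set0.
  by apply/set0P/negP => /eqP.
have [eI _ _] := MS_edge rM er.
have nI : x \notin inner_vertices T by apply/negP => /inner_vertexP[].
have eT := inner_edge_edge eI; have := ex; rewrite /seg_set /= on_segE => /andP[/eqP xp /andP[lo hi]].
exists e, x; split=> //.
have [E|ne0] := eqVneq (pcoord (seg_hor e) x) (seg_lo e).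
  by left; rewrite /seg_end0 -xp -E line_ptK.
have [E|ne1] := eqVneq (pcoord (seg_hor e) x) (seg_hi e).
  by right; rewrite /seg_end1 -xp -E line_ptK.
case: nx; apply: (inner_edge_interior HT HR eI (esym xp)).
by rewrite !lt_def ne0 eq_sym ne1 lo hi.
Qed.

(* By connectedness, S spreads between edges which meet, and these share a vertex. *)
Lemma MS_vertex_ind (S : R * R -> Prop) rho : rho \in MS T ->
  (forall e, e \in rho -> S (seg_end0 e) <-> S (seg_end1 e)) ->
  (exists2 e, e \in rho & S (seg_end0 e)) ->
  forall p, p \in vertices T -> on_ms rho p -> S p.
Proof.
move=> rM ends [e0 e0r Se0].
have /max_segmentsP[_ [_ _ con] _] := rM.
have all e : e \in rho -> S (seg_end0 e).
  apply: (connected_cover_ind (r := rho) (F := fun e => seg_set e)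
    (S := fun e => S (seg_end0 e))) => //; last by exists e0.
  - by move=> f _; apply: closed_seg.
  - move=> f fr; exists (seg_end0 f); apply: seg_end0_on; apply: (edge_lt HT).
    by have [/inner_edge_edge] := MS_edge rM fr.
  move=> f g fr gr [x [fx gx]] Sf.
  have [/inner_edge_edge fT _ _] := MS_edge rM fr.
  have [/inner_edge_edge gT _ _] := MS_edge rM gr.
  have [fg|ne] := eqVneq f g; first by rewrite -fg.
  have xV : x \in vertices T by apply: (tmesh_edgeI HT fT gT ne); split.
  have Sx : S x by case: (edge_end HR fT xV fx) => -> //; apply/ends.
  by case: (edge_end HR gT xV gx) Sx => -> //; move/(ends g gr).
move=> p pV /on_msP[e er ep]; have [/inner_edge_edge eT _ _] := MS_edge rM er.
by case: (edge_end HR eT pV ep) => ->; [|apply/(ends e er)]; apply: all.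
Qed.

End MaximalSegments.

(** * Loops and homotopies *)

Section PiecewiseLinear.
Variable R : realType.
Implicit Types (v : nat -> R) (x t u : R) (n i : nat).

Definition clamp x : R := (1 + `|x| - `|x - 1|) / 2.

Lemma clamp_le0 x : x <= 0 -> clamp x = 0.
Proof. by move=> x0; rewrite /clamp ler0_norm // ler0_norm; lra. Qed.

Lemma clamp_ge1 x : 1 <= x -> clamp x = 1.
Proof. by move=> x0; rewrite /clamp ger0_norm ?ger0_norm; lra. Qed.

Lemma clamp_id x : 0 <= x <= 1 -> clamp x = x.
Proof. by move=> x0; rewrite /clamp ger0_norm ?ler0_norm; lra. Qed.

Definition pl v n t := v 0%N + \sum_(i < n) clamp (n%:R * t - i%:R) * (v i.+1 - v i).

Lemma pl_eq v n i t u : (i < n)%N -> 0 <= u <= 1 -> n%:R * t = i%:R + u ->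
  pl v n t = v i + u * (v i.+1 - v i).
Proof.
move=> lt_in u01 nt; rewrite /pl nt.
have E k : (k <= i)%N -> v 0%N +
    \sum_(j < k) clamp (i%:R + u - j%:R) * (v j.+1 - v j) = v k.
  elim: k => [|k IH] ki; first by rewrite big_ord0 addr0.
  rewrite big_ord_recr /= addrA IH ?(ltnW ki) // clamp_ge1 ?mul1r; first by ring.
  have : k.+1%:R <= i%:R :> R by rewrite ler_nat.
  by rewrite -natr1; lra.
rewrite -(subnKC lt_in) big_split_ord big_ord_recr /= !addrA E //.
have -> : i%:R + u - i%:R = u by ring.
rewrite clamp_id // big1 ?addr0 // => j _.
rewrite clamp_le0 ?mul0r //.
have : i.+1%:R <= (i.+1 + j)%:R :> R by rewrite ler_nat leq_addr.
by rewrite -natr1; lra.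
Qed.

Lemma continuous_pl v n : continuous (pl v n).
Proof.
move=> t; rewrite /pl; apply: cvgD; first exact: cvg_cst.
apply: cvg_big => [|i _]; first exact: add_continuous.
apply: cvgM; last exact: cvg_cst.
rewrite /clamp; apply: cvgM; last exact: cvg_cst.
have lin : n%:R * s - i%:R @[s --> t] --> n%:R * t - i%:R.
  by apply: cvgB; [apply: cvgM; [exact: cvg_cst|exact: cvg_id]|exact: cvg_cst].
apply: cvgB; first by apply: cvgD; [exact: cvg_cst|apply: cvg_norm].
by apply: cvg_norm; apply: cvgB => //; exact: cvg_cst.
Qed.

Lemma pl_index n t : (0 < n)%N -> 0 <= t <= 1 ->
  exists i u, [/\ (i < n)%N, 0 <= u <= 1 & n%:R * t = i%:R + u].
Proof.
move=> n0 /andP[t0 t1]; have [t_lt|t_ge] := ltP t 1; last first.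
  have -> : t = 1 by lra.
  exists n.-1, 1; rewrite prednK // mulr1; split=> //; first lra.
  by rewrite natr1 prednK.
have nt0 : 0 <= n%:R * t by rewrite mulr_ge0.
have /andP[lo hi] := truncn_itv nt0.
exists (Num.truncn (n%:R * t)), (n%:R * t - (Num.truncn (n%:R * t))%:R); split.
- rewrite -(ltr_nat R); apply: le_lt_trans lo _.
  by rewrite gtr_pMr // ltr0n.
- by move: lo hi; rewrite -natr1; lra.
- by ring.
Qed.

End PiecewiseLinear.

Section Uniform.
Variable R : realType.

Lemma uniform_box (K : set (R * R)) (H : R * R -> R * R) (d : R) :
  compact K -> {within K, continuous H} -> 0 < d ->
  exists2 d', 0 < d' & forall p q, K p -> K q ->
    (forall h, `|pcoord h q - pcoord h p| < d') ->
    forall h, `|pcoord h (H q) - pcoord h (H p)| < d.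
Proof.
move=> /compact_near_coveringP cK /subspace_continuousP cH d0.
pose P (e : R) p := K p -> forall q, K q ->
  (forall h, `|pcoord h q - pcoord h p| < e) ->
  forall h, `|pcoord h (H q) - pcoord h (H p)| < d.
have /(cK _ (0^'+) P _) : forall x, K x -> \forall x' \near x & e \near 0^'+, P e x'.
  move=> x Kx; have [A B] := nbhs_box (H x) [set y | forall h, `|pcoord h y - pcoord h (H x)| < d / 2].
  have /(cH x Kx) : nbhs (H x) [set y | forall h, `|pcoord h y - pcoord h (H x)| < d / 2].
    by apply: B; exists (d / 2) => //; lra.
  rewrite /= nbhs_simpl /= /within /= => /nbhs_box[e e0 eP].
  exists ([set x' | forall h, `|pcoord h x' - pcoord h x| < e / 2], [set s | s < e / 2]).
    split; first by apply/nbhs_box; exists (e / 2) => //; lra.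
    by apply: nbhs_right_lt; lra.
  move=> [x' s] [/= x'x se] Kx' q Kq qx' h.
  have /(_ h) : forall h, `|pcoord h (H q) - pcoord h (H x)| < d / 2.
    apply: eP Kq => k; have := x'x k; have := qx' k; rewrite !ltr_norml; lra.
  have /(_ h) : forall h, `|pcoord h (H x') - pcoord h (H x)| < d / 2.
    by apply: eP Kx' => k; have := x'x k; rewrite !ltr_norml; lra.
  rewrite !ltr_norml; lra.
rewrite /= => KP.
have [e [e0 eP]] : exists e, 0 < e /\ K `<=` P e.
  near (0 : R)^'+ => e; exists e; split; first by near: e; exact: nbhs_right_gt.
  by near: e.
by exists e => // p q Kp Kq; apply: eP.
Unshelve. all: end_near. Qed.

End Uniform.

Section CechCocycle.
Variables (R : realType) (T : premesh R) (G : zmodType).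
Variable d : rect R -> rect R -> G.
Hypothesis dC : forall c1 c2 c3, c1 \in cells T -> c2 \in cells T -> c3 \in cells T ->
  (exists z, [/\ rect_set c1 z, rect_set c2 z & rect_set c3 z]) ->
  d c1 c2 + d c2 c3 = d c1 c3.
Hypothesis sc : simply_connected R (domain T).
Implicit Types (c : rect R) (z : R * R) (h : bool).

Lemma cocycle_diag c z : c \in cells T -> rect_set c z -> d c c = 0.
Proof.
move=> cT cz; have : d c c + d c c = d c c by apply: dC => //; exists z.
by move/(canRL (addrK _)); rewrite subrr.
Qed.

Lemma cocycle_anti c c' z : c \in cells T -> c' \in cells T ->
  rect_set c z -> rect_set c' z -> d c' c = - d c c'.
Proof.
move=> cT c'T cz c'z; apply/eqP; rewrite -addr_eq0 (dC c'T cT c'T); last by exists z.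
by rewrite (cocycle_diag c'T c'z).
Qed.

Lemma rect_gap : exists2 e : R, 0 < e & forall c c', c \in cells T -> c' \in cells T ->
  forall h, rlo h c - rhi h c' < e -> rlo h c <= rhi h c'.
Proof.
pose Q (x : rect R * rect R) (t : R) := forall h, rlo h x.1 - rhi h x.2 < t -> rlo h x.1 <= rhi h x.2.
have [|e e0 eP] := @finite_gap R _ [seq (c, c') | c <- cells T, c' <- cells T] Q.
  move=> x _; have gap h : exists2 e : R, 0 < e &
      forall t, t < e -> rlo h x.1 - rhi h x.2 < t -> rlo h x.1 <= rhi h x.2.
    have [le|lt] := leP (rlo h x.1) (rhi h x.2); first by exists 1.
    by exists (rlo h x.1 - rhi h x.2); [lra|move=> t; lra].
  have [e1 e10 e1P] := gap true; have [e2 e20 e2P] := gap false.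
  exists (Num.min e1 e2) => [|t]; first by rewrite lt_min e10.
  by rewrite lt_min => /and3P[_ ? ?] []; [apply: e1P|apply: e2P].
exists (e / 2) => [|c c' cT c'T]; first by lra.
by apply: (eP (c, c')) => /=; [apply/allpairsP; exists (c, c')|lra].
Qed.

Lemma rect_helly (e : R) (I : finType) (i0 : I) (C : I -> rect R) (X : I -> R * R) :
  (forall c c', c \in cells T -> c' \in cells T ->
    forall h, rlo h c - rhi h c' < e -> rlo h c <= rhi h c') ->
  (forall i, C i \in cells T /\ rect_set (C i) (X i)) ->
  (forall i j h, `|pcoord h (X i) - pcoord h (X j)| < e) ->
  exists z, forall i, rect_set (C i) z.
Proof.
move=> gap CX close.
have top h : exists z : R, forall i, rlo h (C i) <= z <= rhi h (C i).
  pose j := [arg max_(j > i0) rlo h (C j)]%O; exists (rlo h (C j)) => i.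
  rewrite /j; case: arg_maxP => // k _ kmax; have -> : rlo h (C i) <= rlo h (C k) by exact: kmax.
  have [[kT /mem_rect/(_ h) kX] [iT /mem_rect/(_ h) iX]] := (CX k, CX i).
  by apply: gap => //; have := close k i h; rewrite ltr_norml; lra.
have [z1 z1P] := top true; have [z2 z2P] := top false.
by exists (z1, z2) => i; apply/mem_rect => -[]; [apply: z1P|apply: z2P].
Qed.

Lemma rect_convex c p q z (u : R) : rect_set c p -> rect_set c q -> 0 <= u <= 1 ->
  (forall h, pcoord h z = pcoord h p + u * (pcoord h q - pcoord h p)) -> rect_set c z.
Proof.
move=> /mem_rect cp /mem_rect cq u01 zE; apply/mem_rect => h; rewrite zE.
have := cp h; have := cq h; nra.
Qed.

Lemma rect_domain c z : c \in cells T -> rect_set c z -> domain T z.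
Proof. by exists c. Qed.

Lemma square_sum (N : nat) (C : nat -> nat -> rect R) c0 :
  (forall k l, (k <= N)%N -> (l <= N)%N -> C k l \in cells T) ->
  (forall k l, (k < N)%N -> (l < N)%N -> exists z, [/\ rect_set (C k l) z,
    rect_set (C k.+1 l) z, rect_set (C k l.+1) z & rect_set (C k.+1 l.+1) z]) ->
  d c0 c0 = 0 ->
  (forall l, (l <= N)%N -> C 0%N l = c0 /\ C N l = c0) ->
  (forall k, (k <= N)%N -> C k N = c0) ->
  \sum_(k < N) d (C k 0%N) (C k.+1 0%N) = 0.
Proof.
move=> CT sq c00 lr top; pose S l := \sum_(k < N) d (C k l) (C k.+1 l).
have row l : (l < N)%N -> S l = S l.+1.
  move=> lN; have E (k : 'I_N) : d (C k l) (C k.+1 l) =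
      (d (C k l) (C k l.+1) - d (C k.+1 l) (C k.+1 l.+1)) + d (C k l.+1) (C k.+1 l.+1).
    have [z [z1 z2 z3 z4]] := sq k l (ltn_ord k) lN.
    have T1 := CT k l (ltnW (ltn_ord k)) (ltnW lN); have T2 := CT k.+1 l (ltn_ord k) (ltnW lN).
    have T3 := CT k l.+1 (ltnW (ltn_ord k)) lN; have T4 := CT k.+1 l.+1 (ltn_ord k) lN.
    apply: (addIr (d (C k.+1 l) (C k.+1 l.+1))); rewrite (dC T1 T2 T4); last by exists z.
    rewrite addrAC addrNK (dC T1 T3 T4) //; by exists z.
  rewrite /S (eq_bigr _ (fun k _ => E k)) big_split /=.
  have -> : \sum_(k < N) (d (C k l) (C k l.+1) - d (C k.+1 l) (C k.+1 l.+1)) = 0.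
    pose t k := d (C k l) (C k l.+1).
    have := telescope_sumr t (leq0n N); rewrite big_mkord /t.
    have [-> ->] := lr _ (ltnW lN); have [-> ->] := lr _ lN.
    rewrite subrr => tel; apply: etrans (etrans (congr1 -%R tel) (oppr0 _)).
    by rewrite -sumrN; apply: eq_bigr => k _; rewrite opprB.
  by rewrite add0r.
have all l : (l <= N)%N -> S 0%N = S l.
  elim: l => [//|l IH lN]; rewrite IH; first exact: row.
  exact: ltnW.
rewrite -/(S 0%N) (all N) // /S big1 // => k _.
by rewrite !top // ltnW.
Qed.

(* A closed chain of cells is followed by a piecewise linear loop through
   points of the successive intersections. *)
Lemma closed_chain_sum (n : nat) (s : nat -> rect R) : (0 < n)%N ->
  (forall i, (i <= n)%N -> s i \in cells T) -> s n = s 0%N ->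
  (forall i, (i < n)%N -> exists z, rect_set (s i) z /\ rect_set (s i.+1) z) ->
  \sum_(i < n) d (s i) (s i.+1) = 0.
Proof.
move=> n0 sT sn adj.
have [y yP] : exists y : nat -> R * R, forall i, (i < n)%N ->
    rect_set (s i) (y i) /\ rect_set (s i.+1) (y i).
  have /choice[y yP] : forall i, exists z, (i < n)%N -> rect_set (s i) z /\ rect_set (s i.+1) z.
    move=> i; have [/adj[z zP]|_] := boolP (i < n)%N; first by exists z.
    by exists (0, 0).
  by exists y.
pose Y i := if i == n then y 0%N else y i.
have Yl i : (i < n)%N -> rect_set (s i.+1) (Y i).
  by move=> lt; rewrite /Y (ltn_eqF lt); have [] := yP i lt.
have Yr i : (i <= n)%N -> rect_set (s i) (Y i).
  move=> le; rewrite /Y; case: eqP => [->|/eqP ne]; first by rewrite sn; have [] := yP 0%N n0.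
  by have [] := yP i; rewrite // ltn_neqAle ne.
pose f (t : R) := (pl (fun i => (Y i).1) n t, pl (fun i => (Y i).2) n t).
have fE i t u : (i < n)%N -> 0 <= u <= 1 -> n%:R * t = i%:R + u ->
    rect_set (s i.+1) (f t).
  move=> lt u01 nt; apply: (rect_convex (Yl i lt) (Yr i.+1 lt) u01).
  by case; rewrite /= (pl_eq _ lt u01 nt).
have [_ /(_ f)] := sc; case.
- apply: continuous_subspaceT => t.
  by apply: (@cvg_pair _ _ _ _ (nbhs (pl (fun i => (Y i).1) n t))
    (nbhs (pl (fun i => (Y i).2) n t))); exact: continuous_pl.
- move=> q [t]; rewrite /= in_itv /= => t01 <-.
  have [i [u [lt u01 nt]]] := pl_index n0 t01.
  exact: rect_domain (sT _ lt) (fE i t u lt u01 nt).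
- have e0 : f 0 = Y 0%N.
    have nt : n%:R * 0 = 0%N%:R + 0 :> R by rewrite mulr0 addr0.
    by rewrite /f !(pl_eq _ n0 _ nt) ?lexx ?ler01 // !mul0r !addr0; case: (Y 0%N).
  have lt : (n.-1 < n)%N by rewrite prednK.
  have nt : n%:R * 1 = n.-1%:R + 1 :> R by rewrite mulr1 natr1 prednK.
  rewrite e0 /f !(pl_eq _ lt _ nt) ?lexx ?ler01 // !mul1r prednK //.
  by rewrite [_ + (_ - _)]addrC subrK [_ + (_ - _)]addrC subrK /Y eqxx; case: eqP n0 => [<-|] //; case: (y 0%N).
move=> H [Hc Hd Hbt Hlr]; have f0 : rect_set (s 0%N) (f 0).
  have nt : n%:R * 0 = 0%N%:R + 0 :> R by rewrite mulr0 addr0.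
  have -> : f 0 = Y 0%N.
    by rewrite /f !(pl_eq _ n0 _ nt) ?lexx ?ler01 // !mul0r !addr0; case: (Y 0%N).
  exact: Yr.
have [e e_gt0 gap] := rect_gap.
have [|e' e'_gt0 Hu] := @uniform_box R (`[0, 1] `*` `[0, 1]) H e _ Hc e_gt0.
  by apply: compact_setX; exact: segment_compact.
pose M := (Num.truncn e'^-1).+1; have M0 : (0 < M)%N by [].
pose N := (n * M)%N; have N0 : (0 < N)%N by rewrite muln_gt0 n0.
have Ne : N%:R^-1 < e'.
  have e'V : 0 <= e'^-1 by rewrite invr_ge0 ltW.
  have /andP[_ hi] := truncn_itv e'V; rewrite -[e']invrK ltf_pV2 ?posrE ?invr_gt0 ?ltr0n //.
  by apply: lt_le_trans hi _; rewrite ler_nat leq_pmull.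
pose g (k : nat) : R := k%:R / N%:R.
have NR : 0 < N%:R :> R by rewrite ltr0n.
have g01 k : (k <= N)%N -> 0 <= g k <= 1.
  move=> kN; rewrite /g divr_ge0 ?ler0n //= ler_pdivrMr // mul1r ler_nat //.
have gI k : (k <= N)%N -> `[0, 1]%classic (g k) by move=> kN; rewrite /= in_itv /= g01.
have gS k : g k.+1 = g k + N%:R^-1 by rewrite /g -natr1 mulrDl mul1r.
pose iota k := ((k + M.-1) %/ M)%N.
have ioB k : (k <= N)%N -> (iota k <= n)%N.
  by move=> kN; rewrite /iota -ltnS ltn_divLR // mulSn -/N; lia.
have io0 : iota 0%N = 0%N by rewrite /iota add0n divn_small.
have ioN : iota N = n by rewrite /iota /N divnMDl // divn_small // addn0.
have ioS k : iota k.+1 = iota k \/ iota k.+1 = (iota k).+1.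
  rewrite /iota addSn; have [H1|H1] := boolP (M %| (k + M.-1).+1)%N.
    right; move: H1 => /dvdnP[[|q] E]; first by rewrite mul0n in E.
    rewrite E mulnK //; have -> : (k + M.-1 = q * M + M.-1)%N by move: E; rewrite mulSn; lia.
    by rewrite divnMDl // divn_small ?addn0.
  by left; rewrite divnS // (negPf H1).
have fg k : (k <= N)%N -> rect_set (s (iota k)) (f (g k)).
  case: k => [|k] kN; first by rewrite io0 /g mul0r.
  have E : iota k.+1 = (k %/ M).+1 by rewrite /iota addSn -addnS prednK // divnDr ?dvdnn // divnn M0 addn1.
  rewrite E; apply: (fE _ _ ((k %% M).+1%:R / M%:R)).
  - by rewrite -E ioB.
  - rewrite divr_ge0 ?ler0n //= ler_pdivrMr ?ltr0n // mul1r ler_nat ltn_mod //.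
  - rewrite /g /N natrM {1}(divn_eq k M) -addnS natrD natrM.
    have : M%:R != 0 :> R by rewrite pnatr_eq0.
    have : n%:R != 0 :> R by rewrite pnatr_eq0 -lt0n.
    by move=> n_ M_; field; rewrite ?n_ ?M_.
have [D DP] : exists D : R * R -> rect R, forall z, domain T z -> D z \in cells T /\ rect_set (D z) z.
  have /choice[D DP] : forall z, exists c, domain T z -> c \in cells T /\ rect_set c z.
    move=> z; have [[c cT cz]|no] := pselect (domain T z); first by exists c.
    by exists (s 0%N).
  by exists D.
pose X k l := H (g k, g l).
pose C k l := if l == 0%N then s (iota k) else
  if [|| k == 0%N, k == N | l == N] then s 0%N else D (X k l).
have g0 : g 0%N = 0 by rewrite /g mul0r.
have gN : g N = 1 by rewrite /g divff // lt0r_neq0.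
have CX k l : (k <= N)%N -> (l <= N)%N -> C k l \in cells T /\ rect_set (C k l) (X k l).
  move=> kN lN; rewrite /C /X; case: eqP => [->|_].
    split; first by apply/sT/ioB.
    by rewrite g0; have [-> _] := Hbt _ (gI k kN); apply: fg.
  case: ifP => [side|_]; last first.
    apply: DP; apply: Hd; exists (g k, g l) => //; split; exact: gI.
  split; first exact: sT.
  have [k0|k0] := eqVneq k 0%N.
    by rewrite k0 g0; have [-> _] := Hlr _ (gI l lN).
  have [k1|k1] := eqVneq k N.
    by rewrite k1 gN; have [_ ->] := Hlr _ (gI l lN).
  move: side; rewrite (negPf k0) (negPf k1) /= => /eqP ->.
  by rewrite gN; have [_ ->] := Hbt _ (gI k kN).
have s00 : d (s 0%N) (s 0%N) = 0 by apply: cocycle_diag f0; apply: sT.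
have : \sum_(k < N) d (C k 0%N) (C k.+1 0%N) = 0.
  apply: (@square_sum N C (s 0%N)) => //.
  - by move=> k l kN lN; have [] := CX k l kN lN.
  - move=> k l kN lN.
    pose K (x : bool * bool) := (if x.1 then k.+1 else k).
    pose L (x : bool * bool) := (if x.2 then l.+1 else l).
    have KN x : (K x <= N)%N by rewrite /K; case: x.1; rewrite // ltnW.
    have LN x : (L x <= N)%N by rewrite /L; case: x.2; rewrite // ltnW.
    have [|x x' h|z zP] := @rect_helly e _ (true, true) (fun x => C (K x) (L x))
        (fun x => X (K x) (L x)) gap; first by move=> x; apply: CX.
      apply: Hu; [by split; apply: gI|by split; apply: gI|].
      have NV : 0 < N%:R^-1 :> R by rewrite invr_gt0.
      by case; rewrite /= /K /L; [case: x.1; case: x'.1|case: x.2; case: x'.2];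
        rewrite ?gS ltr_norml; lra.
    exists z; split; [exact: (zP (false, false))|exact: (zP (true, false))
      |exact: (zP (false, true))|exact: (zP (true, true))].
  - move=> l lN; rewrite /C !eqxx /=; case: eqP => [_|_]; first by rewrite io0 ioN sn.
    by rewrite orbT.
  - by move=> k kN; rewrite /C eqxx !orbT; case: eqP N0 => [->|].
rewrite /C /= => E; apply: etrans E; apply: esym.
have P k : (k <= N)%N -> \sum_(j < k) d (s (iota j)) (s (iota j.+1)) =
    \sum_(i < iota k) d (s i) (s i.+1).
  elim: k => [|k IH] kN; first by rewrite io0 !big_ord0.
  rewrite big_ord_recr /= IH ?(ltnW kN) //; have [->|->] := ioS k.
    by rewrite (cocycle_diag (z := f (g k))) ?addr0 //; [apply/sT/ioB/ltnW|apply/fg/ltnW].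
  by rewrite big_ord_recr.
by rewrite P // ioN.
Qed.

Lemma cocycle_exact : exists f : rect R -> G, forall c c', c \in cells T -> c' \in cells T ->
  (exists z, rect_set c z /\ rect_set c' z) -> d c c' = f c' - f c.
Proof.
pose adj : rel (cells T) := fun c c' : cells T => `[< exists z, rect_set (val c) z /\ rect_set (val c') z >].
pose w := fix w (x : cells T) p := if p is y :: p' then d (val x) (val y) + w y p' else 0.
have w_cat x p q : w x (p ++ q) = w x p + w (last x p) q.
  by elim: p x => [|y p IH] x /=; rewrite ?add0r // IH addrA.
have adjC : symmetric adj.
  by move=> x y; apply: asbool_equiv_eq; split=> -[z []]; exists z.
have closed x p : path adj x p -> last x p = x -> w x p = 0.
  move=> xp lx; have [->//|p0] := eqVneq p [::].
  pose s i := val (nth x (x :: p) i).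
  have E : w x p = \sum_(i < size p) d (s i) (s i.+1).
    rewrite /s {lx p0 s}; elim: p x {xp} => [|y p IH] x; first by rewrite big_ord0.
    rewrite /= big_ord_recl /= IH; congr (_ + _); apply: eq_bigr => -[i ip] _ /=.
    by rewrite !(set_nth_default y x) //= ltnS ltnW.
  rewrite E closed_chain_sum //.
  - by rewrite lt0n size_eq0.
  - by move=> i _; rewrite /s; apply: valP.
  - by rewrite /s -last_nth lx.
  - by move=> i ip; have /(pathP x)/(_ i ip)/asboolP := xp.
have back x p : path adj x p -> exists q, [/\ path adj (last x p) q, last (last x p) q = x &
    w (last x p) q = - w x p].
  elim: p x => [|y p IH] x /=; first by exists [::]; rewrite oppr0.
  case/andP => xy /IH[q [pq lq wq]]; exists (rcons q x).
  rewrite rcons_path last_rcons pq lq adjC xy; split=> //.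
  rewrite -cats1 w_cat wq lq /= addr0 opprD addrC; congr (_ - _).
  by move/asboolP: xy => [z [xz yz]]; apply: cocycle_anti xz yz; apply: valP.
have indep x p q : path adj x p -> path adj x q -> last x p = last x q -> w x p = w x q.
  move=> xp xq lpq; have [q' [pq' lq' wq']] := back x q xq.
  have := closed x (p ++ q'); rewrite cat_path xp last_cat lpq pq' w_cat lpq wq' => /(_ isT lq').
  by move/eqP; rewrite subr_eq0 => /eqP.
have csym : connect_sym adj by apply: sym_connect_sym.
have /choice[p pP] : forall c : cells T, exists p, path adj (fingraph.root adj c) p /\ last (fingraph.root adj c) p = c.
  move=> c; have := connect_root adj c; rewrite csym => /connectP[p]; by exists p.
pose f (c : cells T) := w (fingraph.root adj c) (p c).
exists (fun c => if insub c is Some c' then f c' else 0) => c c' cT c'T cc'.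
rewrite (insubT (mem (cells T)) cT) (insubT (mem (cells T)) c'T) /=.
set x := Sub c cT; set x' := Sub c' c'T.
have xx' : adj x x' by apply/asboolP; rewrite !SubK.
have rE : fingraph.root adj x = fingraph.root adj x' by apply/(fingraph.rootP csym); apply: connect1.
have [px lx] := pP x; have [px' lx'] := pP x'.
apply/eqP; rewrite eq_sym subr_eq; apply/eqP; rewrite /f -rE addrC.
have -> : d c c' = w (last (fingraph.root adj x) (p x)) [:: x'] by rewrite lx /= addr0.
rewrite -w_cat; apply: indep.
- by rewrite rE.
- by rewrite cat_path px lx /= xx'.
- by rewrite last_cat /= rE.
Qed.

End CechCocycle.

(** * Integration of jumps *)

Section Jumps.
Variables (R : realType) (T : premesh R) (G : zmodType).
Hypotheses (HT : is_tmesh T) (HR : is_reduced T).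
Implicit Types (h : bool) (p q z : R * R) (e : seg R) (c : rect R) (a : seg R -> G).

(* The value of a on the inner edge with direction h having a germ at z
   towards x (0 if there is none). *)
Definition jump a h (x : bool) z : G :=
  \sum_(e <- inner_edges T | (seg_hor e == h) && germ e x z) a e.

Lemma jump_edge a e x z : e \in inner_edges T -> germ e x z ->
  jump a (seg_hor e) x z = a e.
Proof.
move=> eI eg; rewrite /jump (big_rem e) //= eqxx eg /= big1_seq ?addr0 // => f.
rewrite mem_rem_uniq ?fset_uniq // inE => /andP[/andP[/eqP fh fg] /andP[fe fI]].
case/eqP: fe; apply: (germ_uniq HT HR _ _ _ fg eg); rewrite ?(inner_edge_edge eI) //.
exact: inner_edge_edge fI.
Qed.

Lemma jump0 a h x z : (forall e, e \in inner_edges T -> seg_hor e = h -> ~~ germ e x z) ->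
  jump a h x z = 0.
Proof.
move=> H; rewrite /jump big1_seq // => e /andP[/andP[/eqP eh eg] eI].
by have := H e eI eh; rewrite eg.
Qed.

Definition closed_jump a z :=
  jump a true true z - jump a true false z = jump a false true z - jump a false false z.

Lemma closed_jumpT a z : z \notin vertices T -> closed_jump a z.
Proof.
move=> nV; suff E h : jump a h true z = jump a h false z by rewrite /closed_jump !E !subrr.
rewrite /jump big_seq_cond [RHS]big_seq_cond; apply: eq_bigl => e.
have [eI|//] := boolP (e \in inner_edges T); case: eqP => //= _; have eT := inner_edge_edge eI.
rewrite /germ; case: eqP => //= zp; rewrite /in1.
have n0 : pcoord (seg_hor e) z != seg_lo e.
  apply: contraNneq nV => zl; rewrite -(line_ptK (seg_hor e) z) zp zl; exact: seg_end0_vertex.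
have n1 : pcoord (seg_hor e) z != seg_hi e.
  apply: contraNneq nV => zl; rewrite -(line_ptK (seg_hor e) z) zp zl; exact: seg_end1_vertex.
by rewrite !lt_def n0 eq_sym n1.
Qed.

Lemma same_cell_jump0 a h x c z : c \in cells T ->
  inq h x true c z -> inq h x false c z -> jump a h x z = 0.
Proof.
move=> cT ct cf; apply: jump0 => e eI eh; apply/negP => eg; rewrite -eh in ct cf.
have [c1 e1] := inner_edge_side HT HR true eI.
have [c2 e2] := inner_edge_side HT HR false eI.
have [[c1T _ _ _] [c2T _ _ _]] := (e1, e2).
have E1 : c = c1 := inq_uniq HT cT c1T ct (side_inq HT e1 eg).
have E2 : c = c2 := inq_uniq HT cT c2T cf (side_inq HT e2 eg).
rewrite -E1 in e1; rewrite -E2 in e2; exact: (side_neq HT e1 e2).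
Qed.

(* f is 0 on the quadrant opposite to (al, be) and is integrated from there; only
   the half-line separating (al, true) from (al, false) closes the cycle. *)
Lemma quadrant_potential a z (al be : bool) :
  exists f : bool -> bool -> G,
    (forall y, f true y - f false y = jump a false y z) /\
    (forall x, (closed_jump a z \/ x != al) -> f x true - f x false = jump a true x z).
Proof.
pose s (b : bool) (v : G) := if b then v else - v.
exists (fun x y => (if y == be then s be (jump a true (~~ al) z) else 0) +
  (if x == al then s al (jump a false y z) else 0)); split=> [y|x H].
  by rewrite opprD addrACA subrr add0r; case: al => /=; rewrite ?subr0 // sub0r opprK.
have [xal|nx] := eqVneq x al; last first.
  have -> : x = ~~ al by case: x (al) nx {H} => -[].
  by rewrite !addr0; case: be => /=; rewrite ?subr0 // sub0r opprK.
case: H => [E|/eqP //]; rewrite xal; move: E; rewrite /closed_jump.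
case: al {xal} => /= E.
  have -> : jump a true true z = jump a true false z + (jump a false true z - jump a false false z).
    by rewrite -E addrCA subrr addr0.
  case: be => /=; rewrite add0r ?opprD ?opprK ?addrA //.
  by rewrite [jump a false true z + _]addrC.
have -> : jump a true false z = jump a true true z - (jump a false true z - jump a false false z).
  by rewrite -E opprB addrCA subrr addr0.
case: be => /=; rewrite sub0r ?add0r ?opprD ?opprK ?addrA //.
by rewrite [_ + jump a true true z]addrC.
Qed.

Lemma local_potential a z : (interior (domain T) z -> closed_jump a z) ->
  exists phi : rect R -> G, forall e c c', e \in inner_edges T -> on_seg e z ->
    is_side T e true c -> is_side T e false c' -> phi c - phi c' = a e.
Proof.
move=> cl; have [al [be dom]] : exists al be, closed_jump a z \/
    (forall c, c \in cells T -> ~~ inq true al be c z).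
  have [/cl|ni] := pselect (interior (domain T) z); first by exists true, true; left.
  apply: contrapT => no; apply: ni; apply/(interior_domainP T true z) => al be.
  apply: contrapT => nc; apply: no; exists al, be; right => c cT.
  by apply/negP => cq; apply: nc; exists c.
have [f [fv fh]] := quadrant_potential a z al be.
have fh' x c c' : c \in cells T -> c' \in cells T ->
    inq true x true c z -> inq true x false c' z -> f x true - f x false = jump a true x z.
  move=> cT c'T cq c'q; apply: fh; case: dom => [|no]; [by left|right].
  apply/eqP => xal; rewrite {}xal in cq c'q.
  by case: be no => no; [have := no c cT; rewrite cq|have := no c' c'T; rewrite c'q].
have consistent c x y x' y' : c \in cells T -> inq true x y c z -> inq true x' y' c z ->
    f x y = f x' y'.
  move=> cT q1 q2; have q3 := inq_split q2 q1.
  have E1 : f x y = f x' y.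
    have [->//|ne] := eqVneq x x'.
    have j0 : jump a false y z = 0.
      have [qt qf] : inq true true y c z /\ inq true false y c z.
        by case: x x' ne q1 q3 {q2} => -[] //= _ ? ?.
      apply: (same_cell_jump0 a cT); first by rewrite -[false]/(~~ true) inqC.
      by rewrite -[X in inq X]/(~~ true) inqC.
    apply/eqP; rewrite -subr_eq0; apply/eqP; have := fv y; rewrite j0.
    by case: x x' ne {q1 q2 q3} => -[] //= _ E; rewrite -opprB E oppr0.
  have E2 : f x' y = f x' y'.
    have [->//|ne] := eqVneq y y'.
    have [qt qf] : inq true x' true c z /\ inq true x' false c z.
      by case: y y' ne q2 q3 {q1 E1} => -[] //= _ ? ?.
    apply/eqP; rewrite -subr_eq0; apply/eqP; have := fh' x' c c cT cT qt qf.
    rewrite (same_cell_jump0 a cT qt qf).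
    by case: y y' ne {q1 q2 q3 E1} => -[] //= _ E; rewrite -opprB E oppr0.
  by rewrite E1.
have [phi phiP] : exists phi : rect R -> G, forall c x y, c \in cells T ->
    inq true x y c z -> phi c = f x y.
  have /choice[phi phiP] : forall c, exists g, forall x y, c \in cells T ->
      inq true x y c z -> g = f x y.
    move=> c; have [[x [y [cT cq]]]|no] := pselect (exists x y, c \in cells T /\ inq true x y c z).
      by exists (f x y) => x' y' _; apply: consistent.
    by exists 0 => x y cT cq; case: no; exists x, y.
  by exists phi => c x y; apply: phiP.
exists phi => e c c' eI ez ec ec'.
have [cT c'T] : c \in cells T /\ c' \in cells T by case: ec => ? _ _ _; case: ec'.
have [x eg] := on_germ (edge_lt HT (inner_edge_edge eI)) ez.
have cq := side_inq HT ec eg; have c'q := side_inq HT ec' eg.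
rewrite -(jump_edge a eI eg); case: (seg_hor e) cq c'q => cq c'q.
  by rewrite (phiP c x true) // (phiP c' x false) // (fh' x c c').
rewrite -[false]/(~~ true) inqC in cq; rewrite -[X in inq X]/(~~ true) inqC in c'q.
by rewrite (phiP c true x) // (phiP c' false x) // fv.
Qed.

Lemma vertex_not_inside c c' h p q z : c \in cells T -> c' \in cells T ->
  rlo (~~ h) c = pcoord (~~ h) p -> rhi (~~ h) c' = pcoord (~~ h) p ->
  p \in vertices T -> rlo h c < pcoord h p < rhi h c ->
  rlo h c' < pcoord h p < rhi h c' -> False.
Proof.
move=> cT c'T cp c'p pV pc pc'.
have [e [eT eh ep]] := vertex_edge_dir HR (~~ h) pV.
have [x eg] := on_germ (edge_lt HT eT) ep.
have /andP[_ ei] := eg; rewrite eh in ei; have [d d0 dP] := in1_near ei.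
pose w t := line_pt (~~ h) (pcoord h p) (pcoord (~~ h) p + sg R x * t).
have we t : 0 < t < d -> on_seg e (w t).
  move=> /dP td; rewrite on_segE eh /w coord_line coord_lineN.
  move: eg; rewrite /germ eh negbK => /andP[/eqP <- _]; rewrite eqxx; lra.
have wi k t : interior (rect_set k) (w t) <->
    rlo h k < pcoord h p < rhi h k /\ rlo (~~ h) k < pcoord (~~ h) p + sg R x * t < rhi (~~ h) k.
  have wh : pcoord h (w t) = pcoord h p by rewrite /w; case: (h).
  have wN : pcoord (~~ h) (w t) = pcoord (~~ h) p + sg R x * t by rewrite coord_line.
  rewrite interior_rectP -wh -wN; split=> [H|[H1 H2]]; first by split; apply: H.
  exact: (@bool_forall h).
have ndc := cell_nondeg HT cT (~~ h); have ndc' := cell_nondeg HT c'T (~~ h).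
case: x {eg ei} @w dP we wi => w dP we wi; rewrite /sg in wi.
  pose t := Num.min d (rhi (~~ h) c - rlo (~~ h) c) / 2.
  have := lexx (Num.min d (rhi (~~ h) c - rlo (~~ h) c)); rewrite {1}le_min => /andP[l1 l2].
  have t0 : 0 < Num.min d (rhi (~~ h) c - rlo (~~ h) c) by rewrite lt_min d0; lra.
  have := @edge_notin_interior _ _ HT e c (w t) eT cT; case; first by apply: we; rewrite /t; lra.
  by apply/wi; split=> //; rewrite -cp /t; lra.
pose t := Num.min d (rhi (~~ h) c' - rlo (~~ h) c') / 2.
have := lexx (Num.min d (rhi (~~ h) c' - rlo (~~ h) c')); rewrite {1}le_min => /andP[l1 l2].
have t0 : 0 < Num.min d (rhi (~~ h) c' - rlo (~~ h) c') by rewrite lt_min d0; lra.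
have := @edge_notin_interior _ _ HT e c' (w t) eT c'T; case; first by apply: we; rewrite /t; lra.
by apply/wi; split=> //; rewrite -c'p /t; lra.
Qed.

End Jumps.

Section Integration.
Variables (R : realType) (T : premesh R) (G : zmodType).
Hypotheses (HT : is_tmesh T) (HR : is_reduced T).
Implicit Types (h : bool) (p q z : R * R) (e : seg R) (c : rect R) (a : seg R -> G).

Lemma shared_edge_aux h c c' z z' : c \in cells T -> c' \in cells T ->
  rhi (~~ h) c' <= rlo (~~ h) c -> pcoord h z < pcoord h z' ->
  rect_set c z -> rect_set c' z -> rect_set c z' -> rect_set c' z' ->
  exists e, [/\ e \in inner_edges T, on_seg e z, on_seg e z',
    is_side T e true c & is_side T e false c'].
Proof.
move=> cT c'T le lt /mem_rect cz /mem_rect c'z /mem_rect cz' /mem_rect c'z'.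
set y := pcoord (~~ h) z.
have [Ec Ec'] : rlo (~~ h) c = y /\ rhi (~~ h) c' = y.
  by have := cz (~~ h); have := c'z (~~ h); rewrite -/y; split; lra.
have Ez' : pcoord (~~ h) z' = y by have := cz' (~~ h); have := c'z' (~~ h); lra.
have ndc := cell_nondeg HT cT (~~ h); have ndc' := cell_nondeg HT c'T (~~ h).
have czh := cz h; have c'zh := c'z h; have cz'h := cz' h; have c'z'h := c'z' h.
pose x := line_pt h y ((pcoord h z + pcoord h z') / 2).
have cx b : inq h b true c x.
  rewrite /inq coord_line coord_lineN in1_oo /=; lra.
have c'x b : inq h b false c' x.
  rewrite /inq coord_line coord_lineN in1_oo /=; lra.
have ix : interior (domain T) x.
  by apply/(interior_domainP T h) => b []; [exists c|exists c'].
have ne : c != c' by apply/eqP => E; rewrite E in Ec ndc; lra.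
have [e [eI eh eg ec ec']] := germ_separates HT HR cT c'T ne (cx true) (c'x true) ix.
have eT := inner_edge_edge eI; have elt := edge_lt HT eT.
have := eg; rewrite /germ eh coord_line coord_lineN => /andP[/eqP ep ei].
have inside w : seg_lo e <= w <= seg_hi e -> pcoord h z < w < pcoord h z' ->
    w = seg_lo e \/ w = seg_hi e -> False.
  move=> we wz we'; apply: (@vertex_not_inside R T HT HR c c' h (line_pt h y w)) => //;
    rewrite ?coord_line ?coord_lineN //; try lra.
  by case: we' => ->; rewrite ep -eh; [apply: seg_end0_vertex|apply: seg_end1_vertex].
exists e; split=> //.
  rewrite on_segE eh -/y ep eqxx /=; apply/andP; split; last by move: ei => /=; lra.
  rewrite leNgt; apply/negP => H; apply: (inside (seg_lo e)); [lra| |by left].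
  by move: ei => /=; lra.
rewrite on_segE eh Ez' ep eqxx /=; apply/andP; split; first by move: ei => /=; lra.
rewrite leNgt; apply/negP => H; apply: (inside (seg_hi e)); [lra| |by right].
by move: ei => /=; lra.
Qed.

Lemma shared_edge c c' z z' : c \in cells T -> c' \in cells T -> c != c' -> z <> z' ->
  rect_set c z -> rect_set c' z -> rect_set c z' -> rect_set c' z' ->
  exists e, [/\ e \in inner_edges T, on_seg e z, on_seg e z' &
    (is_side T e true c /\ is_side T e false c') \/
    (is_side T e true c' /\ is_side T e false c)].
Proof.
move=> cT c'T ne zz' cz c'z cz' c'z'.
wlog [h lt] : z z' zz' cz c'z cz' c'z' / exists h, pcoord h z < pcoord h z'.
  move=> wlg; have [h nh] : exists h, pcoord h z != pcoord h z'.
    apply: contrapT => no; apply: zz'; apply: (@coord_inj _ true); apply/eqP;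
      by apply/negPn/negP => nh; apply: no; eexists; exact: nh.
  have [lt|gt] := ltP (pcoord h z) (pcoord h z'); first by apply: wlg; last by exists h.
  have [|e [eI e1 e2 E]] := wlg z' z (nesym zz') cz' c'z' cz c'z.
    by exists h; rewrite lt_def nh.
  by exists e; split.
have [le|gt1] := leP (rhi (~~ h) c') (rlo (~~ h) c).
  have [e [eI ez ez' ec ec']] := shared_edge_aux cT c'T le lt cz c'z cz' c'z'.
  by exists e; split=> //; left.
have [le|gt2] := leP (rhi (~~ h) c) (rlo (~~ h) c').
  have [e [eI ez ez' ec ec']] := shared_edge_aux c'T cT le lt c'z cz c'z' cz'.
  by exists e; split=> //; right.
exfalso; case/eqP: ne.
move: cz c'z cz' c'z' => /mem_rect/(_ h) cz /mem_rect/(_ h) c'z /mem_rect/(_ h) cz' /mem_rect/(_ h) c'z'.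
have ndc := cell_nondeg HT cT (~~ h); have ndc' := cell_nondeg HT c'T (~~ h).
pose lo := Num.max (rlo (~~ h) c) (rlo (~~ h) c').
pose hi := Num.min (rhi (~~ h) c) (rhi (~~ h) c').
have lohi : lo < hi by rewrite lt_min !gt_max; lra.
have [L1 L2] : rlo (~~ h) c <= lo /\ rlo (~~ h) c' <= lo by rewrite !le_max !lexx orbT.
have [H1 H2] : hi <= rhi (~~ h) c /\ hi <= rhi (~~ h) c' by rewrite !ge_min !lexx orbT.
pose x := line_pt h ((lo + hi) / 2) ((pcoord h z + pcoord h z') / 2).
have ic' : interior (rect_set c') x.
  by apply/interior_rectP; apply: (@bool_forall h); rewrite ?coord_line ?coord_lineN; lra.
apply: (interior_cell_uniq HT c'T cT ic'); apply/mem_rect.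
by apply: (@bool_forall h); rewrite ?coord_line ?coord_lineN; lra.
Qed.

Lemma jumps_exact a : (forall p, p \in inner_vertices T -> closed_jump T a p) ->
  exists f : rect R -> G, forall e c c', e \in inner_edges T ->
    is_side T e true c -> is_side T e false c' -> f c - f c' = a e.
Proof.
move=> cl; have cl' z : interior (domain T) z -> closed_jump T a z.
  move=> iz; have [zV|] := boolP (z \in vertices T); last exact: closed_jumpT.
  by apply/cl/inner_vertexP.
have /choice[phi phiP] z := local_potential HT HR (cl' z).
have /choice[w wP] : forall x : rect R * rect R, exists z,
    (exists z, rect_set x.1 z /\ rect_set x.2 z) -> rect_set x.1 z /\ rect_set x.2 z.
  by move=> x; have [[z zP]|no] := pselect (exists z, rect_set x.1 z /\ rect_set x.2 z);
    [exists z|exists (0, 0)].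
have indep c c' z z' : c \in cells T -> c' \in cells T ->
    rect_set c z -> rect_set c' z -> rect_set c z' -> rect_set c' z' ->
    phi z c' - phi z c = phi z' c' - phi z' c.
  move=> cT c'T cz c'z cz' c'z'; have [->|ne] := eqVneq c c'; first by rewrite !subrr.
  have [->//|/eqP zz'] := eqVneq z z'.
  have [e [eI ez ez' [[ec ec']|[ec' ec]]]] := shared_edge cT c'T ne zz' cz c'z cz' c'z'.
    by rewrite -opprB (phiP z e c c') // -(phiP z' e c c') // opprB.
  by rewrite (phiP z e c' c) // -(phiP z' e c' c).
pose d c c' := phi (w (c, c')) c' - phi (w (c, c')) c.
have dE c c' z : c \in cells T -> c' \in cells T -> rect_set c z -> rect_set c' z ->
    d c c' = phi z c' - phi z c.
  move=> cT c'T cz c'z; have [|w1 w2] := wP (c, c'); first by exists z.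
  exact: indep.
have [|f fP] := @cocycle_exact R T G d _ (tmesh_simply_connected HT).
  move=> c1 c2 c3 T1 T2 T3 [z [z1 z2 z3]].
  by rewrite (dE c1 c2 z) // (dE c2 c3 z) // (dE c1 c3 z) // addrC subrKA.
exists f => e c c' eI ec ec'; have eT := inner_edge_edge eI.
have ez := seg_end0_on (edge_lt HT eT).
have cz := side_sub HT ec ez; have c'z := side_sub HT ec' ez.
have [cT c'T] : c \in cells T /\ c' \in cells T by case: ec => ? _ _ _; case: ec'.
rewrite -fP //; last by exists (seg_end0 e).
by rewrite (dE _ _ (seg_end0 e)) // (phiP _ e c c').
Qed.

Lemma closed_jump_diff (f : rect R -> G) a z : interior (domain T) z ->
  (forall e c c', e \in inner_edges T -> is_side T e true c -> is_side T e false c' ->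
    a e = f c - f c') ->
  closed_jump T a z.
Proof.
move=> iz aE.
have /choice[Q QP] : forall x : bool * bool, exists c, c \in cells T /\ inq true x.1 x.2 c z.
  by case=> x y; have [c] := interior_inq true x y iz; exists c.
have E h x : jump T a h x z = f (Q (if h then (x, true) else (true, x))) -
    f (Q (if h then (x, false) else (false, x))).
  set c := Q _; set c' := Q _.
  have [cT c'T cq c'q] : [/\ c \in cells T, c' \in cells T, inq h x true c z & inq h x false c' z].
    split; first by case: (QP (if h then (x, true) else (true, x))).
    - by case: (QP (if h then (x, false) else (false, x))).
    - rewrite /c {c}; case: (h); first by case: (QP (x, true)).
      by rewrite -[false]/(~~ true) inqC; case: (QP (true, x)).
    - rewrite /c' {c'}; case: (h); first by case: (QP (x, false)).
      by rewrite -[X in inq X]/(~~ true) inqC; case: (QP (false, x)).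
  have [cc'|ne] := eqVneq c c'.
    by rewrite -cc' subrr (same_cell_jump0 HT HR a cT cq) // cc'.
  have [e [eI eh eg ec ec']] := germ_separates HT HR cT c'T ne cq c'q iz.
  by rewrite -eh (jump_edge HT HR a eI eg) (aE e c c').
rewrite /closed_jump !E /= !opprB.
set A := f _; set B := f _; set C := f _; set D := f _.
by rewrite addrCA -[RHS]addrA addrC -!addrA; congr (_ + _); rewrite addrCA; congr (_ + _); rewrite addrC.
Qed.

End Integration.

(** * The relative chain complex *)

Section Complex.
Variables (R : realType) (T : premesh R) (P : vectType R).

Definition sideb e b c : bool := `[< @is_side R T e b c >].

Definition bd2 (f : {ffun cells T -> P}) : {ffun inner_edges T -> P} :=
  [ffun e => \sum_(c | sideb (val e) true (val c)) f c
           - \sum_(c | sideb (val e) false (val c)) f c].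

Fact bd2_linear : linear bd2.
Proof.
move=> k f g; apply/ffunP => e; rewrite !ffunE.
have S b : \sum_(c | sideb (val e) b (val c)) (k *: f + g) c =
    k *: \sum_(c | sideb (val e) b (val c)) f c + \sum_(c | sideb (val e) b (val c)) g c.
  by rewrite scaler_sumr -big_split; apply: eq_bigr => c _; rewrite !ffunE.
by rewrite !S scalerBr opprD addrACA.
Qed.
HB.instance Definition _ := GRing.isLinear.Build R _ _ _ bd2 bd2_linear.

(* Horizontal and vertical edges are oriented oppositely, so that the jumps of a
   function on the cells, counted upwards and rightwards, form a cycle. *)
Definition etail (e : seg R) := if seg_hor e then seg_end0 e else seg_end1 e.
Definition ehead (e : seg R) := if seg_hor e then seg_end1 e else seg_end0 e.

Definition bd1 (a : {ffun inner_edges T -> P}) : {ffun inner_vertices T -> P} :=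
  [ffun p => \sum_e (a e *+ (etail (val e) == val p) - a e *+ (ehead (val e) == val p))].

Fact bd1_linear : linear bd1.
Proof.
move=> k a b; apply/ffunP => p; rewrite !ffunE scaler_sumr -big_split; apply: eq_bigr => e _ /=.
by rewrite !ffunE !mulrnDl !scalerMnr scalerBr opprD addrACA.
Qed.
HB.instance Definition _ := GRing.isLinear.Build R _ _ _ bd1 bd1_linear.

Hypotheses (HT : is_tmesh T) (HR : is_reduced T).

Lemma sideb_sum e b (c0 : cells T) (f : {ffun cells T -> P}) : e \in edges T ->
  is_side T e b (val c0) -> \sum_(c | sideb e b (val c)) f c = f c0.
Proof.
move=> eT ec0; rewrite (bigD1 c0) /=; last exact/asboolP.
rewrite big1 ?addr0 // => c /andP[/asboolP ec] /eqP[].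
exact/val_inj/(side_uniq HT eT ec ec0).
Qed.

Lemma side_cell e b : e \in inner_edges T -> exists c : cells T, is_side T e b (val c).
Proof.
by move=> /(inner_edge_side HT HR b)[c ec]; have [cT _ _ _] := ec; exists [` cT]%fset.
Qed.

Lemma bd2E f (e : inner_edges T) (c c' : cells T) : is_side T (val e) true (val c) ->
  is_side T (val e) false (val c') -> bd2 f e = f c - f c'.
Proof.
move=> ec ec'; have eT := inner_edge_edge (valP e).
by rewrite ffunE (sideb_sum _ eT ec) (sideb_sum _ eT ec').
Qed.

Lemma germ_end0 e p : e \in edges T -> p \in vertices T -> germ e true p = (seg_end0 e == p).
Proof.
move=> eT pV; have lt := edge_lt HT eT; apply/idP/eqP => [eg|<-].
  case: (edge_end HR eT pV (germ_on eg)) => // E; move: eg.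
  by rewrite E /germ /in1 /seg_end1 coord_line coord_lineN ltxx !andbF.
by rewrite /germ /in1 /seg_end0 coord_line coord_lineN eqxx lexx.
Qed.

Lemma germ_end1 e p : e \in edges T -> p \in vertices T -> germ e false p = (seg_end1 e == p).
Proof.
move=> eT pV; have lt := edge_lt HT eT; apply/idP/eqP => [eg|<-].
  case: (edge_end HR eT pV (germ_on eg)) => // E; move: eg.
  by rewrite E /germ /in1 /seg_end0 coord_line coord_lineN ltxx andbF.
by rewrite /germ /in1 /seg_end1 coord_line coord_lineN eqxx lexx andbT.
Qed.

Lemma bd1_closed_jump (a : seg R -> P) (p : inner_vertices T) :
  bd1 [ffun e => a (val e)] p = 0 <-> closed_jump T a (val p).
Proof.
have [pV _] := (inner_vertexP T _).1 (valP p).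
pose J h x := jump T a h x (val p).
have -> : bd1 [ffun e => a (val e)] p = (J true true - J true false) - (J false true - J false false).
  rewrite /J /jump !big_seq_fsetE /= ffunE.
  rewrite ![in RHS](big_mkcond (fun _ => _ && _)) /= -!sumrB; apply: eq_bigr => e _.
  rewrite ffunE /etail /ehead !(germ_end0 (inner_edge_edge (valP e)) pV).
  rewrite !(germ_end1 (inner_edge_edge (valP e)) pV).
  case: (seg_hor (val e)) => /=.
    by rewrite subrr subr0 !mulrb.
  by rewrite subrr sub0r !mulrb opprB.
by rewrite /closed_jump -!/(J _ _); split=> [/eqP|->]; rewrite ?subrr // subr_eq0 => /eqP.
Qed.

Lemma bd_exact : limg (linfun bd2) = lker (linfun bd1).
Proof.
apply/vspaceP => a; rewrite memv_ker lfunE /=; apply/memv_imgP/eqP.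
  case=> f _ ->; rewrite lfunE /=; apply/ffunP => p; rewrite [RHS]ffunE.
  pose g c := if insub c is Some c' then f c' else 0.
  have gE (c : cells T) : g (val c) = f c by rewrite /g valK.
  pose a' s := if insub s is Some e then bd2 f e else 0.
  have a'E (e : inner_edges T) : a' (val e) = bd2 f e by rewrite /a' valK.
  have -> : bd2 f = [ffun e => a' (val e)] by apply/ffunP => e; rewrite [RHS]ffunE a'E.
  apply/bd1_closed_jump/(closed_jump_diff HT HR (f := g)).
    by have [] := (inner_vertexP T _).1 (valP p).
  move=> e c c' eI ec ec'; have [cT _ _ _] := ec; have [c'T _ _ _] := ec'.
  rewrite -[c]/(val [` cT]%fset) -[c']/(val [` c'T]%fset) !gE -[e]/(val [` eI]%fset) a'E.
  exact: bd2E.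
move=> a0; pose a' s := if insub s is Some e then a e else 0.
have a'E (e : inner_edges T) : a' (val e) = a e by rewrite /a' valK.
have aE : a = [ffun e => a' (val e)] by apply/ffunP => e; rewrite ffunE a'E.
have [|f fP] := @jumps_exact R T P HT HR a'.
  move=> p pI; rewrite -[p]/(val [` pI]%fset); apply/bd1_closed_jump.
  by rewrite -aE a0 ffunE.
exists [ffun c => f (val c)]; rewrite ?memvf // lfunE /=; apply/ffunP => e.
have [c ec] := side_cell true (valP e); have [c' ec'] := side_cell false (valP e).
by rewrite (bd2E _ ec ec') !ffunE (fP (val e) (val c) (val c') (valP e) ec ec') a'E.
Qed.

(* Otherwise a single cell would contain p in its interior. *)
Lemma vertex_up_edge p : p \in inner_vertices T ->
  exists2 e, e \in inner_edges T & seg_end0 e = p.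
Proof.
move=> /inner_vertexP[pV ip]; apply: contrapT => no.
have noedge h : forall e, e \in inner_edges T -> seg_hor e = h -> ~~ germ e true p.
  move=> e eI _; rewrite germ_end0 ?(inner_edge_edge eI) //; apply/eqP => E.
  by apply: no; exists e.
have same h c c' : c \in cells T -> c' \in cells T -> inq h true true c p -> inq h true false c' p ->
    c = c'.
  move=> cT c'T cq c'q; apply/eqP/negP => /negP ne.
  have [e [eI eh eg _ _]] := germ_separates HT HR cT c'T ne cq c'q ip.
  by have := noedge h e eI eh; rewrite eg.
have [c cT cq] := interior_inq true true true ip.
have [c1 c1T c1q] := interior_inq true true false ip.
have [c2 c2T c2q] := interior_inq false true false ip.
have E1 := same true c c1 cT c1T cq c1q.
have E2 : c = c2 by apply: (same false) => //; rewrite -[X in inq X]/(~~ true) inqC.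
have [e eT ep] := vertex_on_edge HT pV.
apply: (edge_notin_interior HT eT cT ep); apply/interior_rectP.
move: cq c1q c2q; rewrite -E1 -E2 /inq /= => H1 H2 H3 [|] /=; move: H1 H2 H3; rewrite /rlo /rhi /pcoord /=; lra.
Qed.

Lemma bd1_surj : limg (linfun bd1) = fullv.
Proof.
apply/eqP; rewrite eqEsubv subvf /=; apply/subvP => v _; rewrite [v]sum_single.
apply: memv_suml => p0 _; move: (v p0) => {v} x.
(* Modulo boundaries, p is equivalent to the other end of an edge going right or
   up from p, which is lexicographically larger, or is 0 if that end lies on the
   boundary of the domain. *)
pose above (p : inner_vertices T) := [set q : inner_vertices T |
  ((val p).1 < (val q).1) || ((val p).1 == (val q).1) && ((val p).2 < (val q).2)]%SET.
have step (n : nat) : forall p : inner_vertices T, (#|above p| < n)%N ->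
    forall x, single p x \in limg (linfun bd1).
  elim: n => // n IH p pn y; have [e eI ep] := vertex_up_edge (valP p).
  pose e' := [` eI]%fset; have eT := inner_edge_edge eI.
  have elt := edge_lt HT eT.
  have mem : bd1 (single e' y) \in limg (linfun bd1) by rewrite -[bd1 _]lfunE memv_img ?memvf.
  pose q := seg_end1 e.
  have qp : q <> val p.
    rewrite -ep /q => /(congr1 (pcoord (seg_hor e))); rewrite /seg_end0 /seg_end1 !coord_line.
    by move=> E; rewrite E ltxx in elt.
  have bdE : bd1 (single e' y) = [ffun z => (y *+ (etail e == val z) - y *+ (ehead e == val z))].
    apply/ffunP => z; rewrite !ffunE (bigD1 e') //= big1 ?addr0 ?ffunE ?eqxx // => f fe.
    by rewrite ffunE (negPf fe) !mul0rn subrr.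
  pose u : {ffun inner_vertices T -> P} := [ffun z => y *+ (q == val z)].
  have uI : u \in limg (linfun bd1).
    have [qI|qI] := boolP (q \in inner_vertices T); last first.
      have -> : u = 0; last exact: mem0v.
      by apply/ffunP => z; rewrite !ffunE; case: eqP => // E; rewrite E (valP z) in qI.
    have -> : u = single [` qI]%fset y.
      by apply/ffunP => z; rewrite !ffunE -val_eqE /= eq_sym mulrb.
    rewrite ltnS in pn; apply: IH; apply: leq_trans pn; apply: proper_card; apply/properP; split.
      apply/fintype.subsetP => z; rewrite !inE /= -ep /q /seg_end0 /seg_end1.
      case: (seg_hor e) => /= /orP[lt|/andP[/eqP <- lt]]; rewrite ?lt ?elt ?eqxx //=.
        by rewrite (lt_trans elt lt).
      by rewrite (lt_trans elt lt) orbT.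
    exists [` qI]%fset; rewrite !inE /= ?ltxx ?andbF // -ep /q /seg_end0 /seg_end1.
    by case: (seg_hor e) => /=; rewrite ?eqxx elt ?orbT.
  have -> : single p y = (if seg_hor e then 1 else -1) *: bd1 (single e' y) + u.
    apply/ffunP => z; rewrite bdE !ffunE /etail /ehead ep -/q -[z == p]val_eqE eq_sym -mulrb.
    by case: (seg_hor e); rewrite ?scale1r ?scaleN1r ?opprB subrK.
  by rewrite memvD // memvZ.
exact: step.
Qed.

End Complex.

Lemma dim_preim_exact (K : fieldType) (F E V : vectType K) (d2 : 'Hom(F, E)) (d1 : 'Hom(E, V))
    (S : {vspace F}) (I : {vspace E}) :
  limg d2 = lker d1 -> limg d1 = fullv -> (forall f, f \in S <-> d2 f \in I) ->
  (\dim S + \dim {:E} + \dim (d1 @: I) = \dim {:F} + \dim {:V} + \dim I)%N.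
Proof.
move=> ex surj SI.
have kS : (S :&: lker d2 = lker d2)%VS.
  by apply/capv_idPr/subvP => f; rewrite memv_ker => /eqP f0; apply/SI; rewrite f0 mem0v.
have imS : (d2 @: S = I :&: lker d1)%VS.
  apply/vspaceP => a; rewrite -ex memv_cap; apply/memv_imgP/andP.
    by case=> f fS ->; split; [apply/SI|rewrite memv_img ?memvf].
  by case=> aI /memv_imgP[f _ E']; exists f => //; apply/SI; rewrite -E'.
have := limg_ker_dim d2 S; have := limg_ker_dim d1 I.
have := limg_ker_dim d2 fullv; have := limg_ker_dim d1 fullv.
rewrite kS imS ex surj !capfv; lia.
Qed.

Lemma prodv_full (K : fieldType) (V : vectType K) (I : finType) :
  prodv (fun _ : I => fullv : {vspace V}) = fullv.
Proof.
by apply/eqP; rewrite eqEsubv subvf /=; apply/subvP => v _; apply/memv_prodv => i; apply: memvf.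
Qed.

Lemma Posz_sum (I : finType) (f : I -> nat) : (\sum_i f i)%N%:Z = \sum_i (f i)%:Z.
Proof. exact: (big_morph Posz PoszD (erefl _)). Qed.

Section SplineDimension.
Variables (R : realType) (m m' : nat) (T : premesh R) (r : seg R -> int).
Hypotheses (HT : is_tmesh T) (HR : is_reduced T).
Notation P := (bipoly R m m').

Definition I_edges : {vspace {ffun inner_edges T -> P}} :=
  prodv (fun e : inner_edges T => I_edge m m' r (val e)).

Definition I_vertices : {vspace {ffun inner_vertices T -> P}} :=
  prodv (fun p : inner_vertices T => I_vertex m m' T r (val p)).

Lemma cell_of_edge (e : seg R) c : e \in inner_edges T -> c \in cells T ->
  seg_set e `<=` rect_set c -> exists b, is_side T e b c.
Proof.
move=> eI cT sub; have eT := inner_edge_edge eI; have lt := edge_lt HT eT.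
pose x := line_pt (seg_hor e) (seg_pos e) ((seg_lo e + seg_hi e) / 2).
have xg b : germ e b x.
  by rewrite /germ coord_line coord_lineN eqxx in1_oo //; lra.
have cx : rect_set c x by apply/sub/(germ_on (xg true)).
have [a [b cq]] := rect_inq (seg_hor e) (cell_nondeg HT cT) cx.
by exists b; have [? ? ?] := edge_cell HT HR eT (xg a) cT cq.
Qed.

Lemma dividesN (d p : {poly {poly R}}) : divides d p -> divides d (- p).
Proof. by case=> g ->; exists (- g); rewrite mulrN. Qed.

Lemma spline_bd2 (f : {ffun cells T -> P}) :
  f \in spline m m' T r <-> linfun (@bd2 R T P) f \in I_edges.
Proof.
rewrite lfunE /= memv_spline memv_prodv; split=> H.
  move=> e; apply/memv_I_edge; have eI := valP e.
  have [c ec] := side_cell HT HR true eI; have [c' ec'] := side_cell HT HR false eI.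
  rewrite (bd2E HT f ec ec') poly_ofB.
  by apply: H => // p; [apply: side_sub HT _ _ _ _ ec|apply: side_sub HT _ _ _ _ ec'].
move=> e eI c c' ec ec'; have eT := inner_edge_edge eI.
have [b eb] := cell_of_edge eI (valP c) ec.
have [b' eb'] := cell_of_edge eI (valP c') ec'.
have := H [` eI]%fset; move/memv_I_edge => /=.
have [bb'|] := eqVneq b b'.
  rewrite -bb' in eb'; rewrite (val_inj (side_uniq HT eT eb eb')) subrr => _.
  by exists 0; rewrite mulr0.
case: b b' eb eb' => -[] // eb eb' _.
  by rewrite (bd2E HT (e := [` eI]%fset) f eb eb') poly_ofB.
by rewrite (bd2E HT (e := [` eI]%fset) f eb' eb) poly_ofB => /dividesN; rewrite opprB.
Qed.

Lemma dim_spline :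
  (\dim (spline m m' T r))%:Z + (\dim (linfun (@bd1 R T P) @: I_edges))%:Z =
  euler_char m m' T r + (\dim I_vertices)%:Z.
Proof.
have := dim_preim_exact (bd_exact P HT HR) (bd1_surj P HT HR) spline_bd2.
rewrite -!prodv_full !dim_prodv /euler_char !big_seq_fsetE /=.
have E (I : finType) (U : I -> {vspace P}) :
    (\sum_i (\dim (quotv fullv (U i)))%:Z)%R =
    (\sum_(i : I) \dim {:P})%N%:Z - (\sum_i \dim (U i))%N%:Z.
  rewrite !Posz_sum -sumrB; apply: eq_bigr => i _.
  by rewrite dim_quotv ?subvf // subzn // dimvS ?subvf.
rewrite !E -!Posz_sum.
have arith (s d e f v i j : nat) : (s + e + d = f + v + i)%N ->
    s%:Z + d%:Z = f%:Z - (e%:Z - i%:Z) + (v%:Z - j%:Z) + j%:Z by lia.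
exact: arith.
Qed.

End SplineDimension.

(** * Correction spaces *)

Lemma dim_two_quotients (K : fieldType) (W X Y : vectType K) (f : 'Hom(W, X)) (g : 'Hom(W, Y))
    (U Z : {vspace W}) : (U :&: lker g = Z)%VS ->
  (\dim (f @: U) + \dim (g @: (U :&: lker f)) = \dim (g @: U) + \dim (f @: Z))%N.
Proof.
move=> ZE; have ZU : (Z <= U)%VS by rewrite -ZE capvSl.
have E : (Z :&: lker f = U :&: lker f :&: lker g)%VS.
  by rewrite -ZE -!capvA [(lker g :&: _)%VS]capvC.
have := limg_ker_dim f U; have := limg_ker_dim f Z; have := limg_ker_dim g U.
have := limg_ker_dim g (U :&: lker f); rewrite ZE E; lia.
Qed.

Section MulSpaces.
Variables (R : realType) (m m' : nat).
Notation P := (bipoly R m m').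

Definition Bsp (h : bool) (k : int) : {vspace P} :=
  if h then Rspace R m m' m%:Z (m'%:Z - k - 1) else Rspace R m m' (m%:Z - k - 1) m'%:Z.

Lemma Rspace_succz (k l : int) (A : P) : -1 <= k -> -1 <= l ->
  A \in Rspace R m m' (m%:Z - k - 1) (m'%:Z - l - 1) <->
  bideg (m.+1 - succz k) (m'.+1 - succz l) (poly_of A).
Proof.
by move=> k1 l1; apply: Rspace_bideg => i; rewrite /succz; lia.
Qed.

Lemma mem_Bsp h (k : int) (A : P) : -1 <= k ->
  A \in Bsp h k <-> if h then bideg m.+1 (m'.+1 - succz k) (poly_of A)
                   else bideg (m.+1 - succz k) m'.+1 (poly_of A).
Proof.
by move=> k1; rewrite /Bsp; case: h; apply: Rspace_bideg => i; rewrite /succz; lia.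
Qed.

Lemma poly_of_mulp h c (k : int) (A : P) : -1 <= k -> A \in Bsp h k ->
  poly_of (mulp (ell h c ^+ succz k) A) = ell h c ^+ succz k * poly_of A.
Proof. by move=> k1 /(mem_Bsp _ _ k1) AB; rewrite of_polyK //; apply: bideg_ell_mul. Qed.

Lemma divides_mulp h c (k : int) (A : P) : -1 <= k ->
  divides (ell h c ^+ succz k) (poly_of A) <->
  exists2 B, B \in Bsp h k & A = mulp (ell h c ^+ succz k) B.
Proof.
move=> k1; split=> [[g gE]|[B BB ->]]; last by exists (poly_of B); exact: poly_of_mulp.
have gB : if h then bideg m.+1 (m'.+1 - succz k) g else bideg (m.+1 - succz k) m'.+1 g.
  by apply: (@bideg_ell_dvd R h c) => //; rewrite -gE; apply: bideg_poly_of.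
have gP : poly_of (of_poly m m' g) = g.
  apply: of_polyK; apply/bidegP => i j nz.
  by case: h gB {gE} => /bidegP /(_ _ _ nz); lia.
have BB : of_poly m m' g \in Bsp h k by apply/mem_Bsp; rewrite // gP.
exists (of_poly m m' g) => //; apply: (@poly_of_inj R m m').
by rewrite (poly_of_mulp c k1 BB) gP.
Qed.

End MulSpaces.

Section Correction.
Variables (R : realType) (m m' : nat) (T : premesh R) (r : seg R -> int).
Hypotheses (HT : is_tmesh T) (HR : is_reduced T).
Hypotheses (Hr : is_smoothness T r) (Hc : constant_along_ms T r).
Notation P := (bipoly R m m').
Notation kT := (inner_vertices T * bool)%type.
Notation W := {ffun kT -> P}.
Implicit Types (p q : R * R) (h : bool) (rho : {fset seg R}) (x : P).

Definition msk (k : kT) : {fset seg R} := ms_at T k.2 (val k.1).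

Lemma msk_MS k : [/\ msk k \in MS T, ms_hor (msk k) = k.2 & on_ms (msk k) (val k.1)].
Proof. exact: (@ms_atP _ _ HR k.2 (val k.1) (valP k.1)). Qed.

Lemma MS_rep rho : rho \in MS T -> ms_rep rho \in rho.
Proof. by case/max_segmentsP => _ [r0 _ _] _; apply: ms_rep_in. Qed.

Lemma r_ge e : e \in edges T -> -1 <= r e.
Proof. by move=> eT; have := @smoothness_ge R T r Hr e eT. Qed.

Lemma ms_r_ge rho : rho \in MS T -> -1 <= ms_r r rho.
Proof.
by move=> rM; have [/inner_edge_edge/r_ge] := MS_edge rM (MS_rep rM).
Qed.

Lemma ms_edge_r rho e : rho \in MS T -> e \in rho -> ms_r r rho = r e.
Proof. by move=> rM er; apply: (Hc rM (MS_rep rM) er). Qed.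

Lemma ms_edge_ell rho e : rho \in MS T -> e \in rho -> ell_ms r rho = ell_edge r e.
Proof.
move=> rM er; have [_ eh ep] := MS_edge rM er.
by rewrite /ell_ms /ell_edge eh ep (ms_edge_r rM er).
Qed.

Definition B_edge (e : seg R) : {vspace P} := Bsp R m m' (seg_hor e) (r e).

Lemma B_spaceE rho : B_space m m' r rho = Bsp R m m' (ms_hor rho) (ms_r r rho).
Proof. by []. Qed.

Lemma ms_edge_B rho e : rho \in MS T -> e \in rho -> B_space m m' r rho = B_edge e.
Proof.
move=> rM er; have [_ eh ep] := MS_edge rM er.
by rewrite B_spaceE /B_edge eh (ms_edge_r rM er).
Qed.

Definition W0 : {vspace W} := prodv (fun k : kT => B_space m m' r (msk k)).
Definition E0 : {vspace {ffun inner_edges T -> P}} :=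
  prodv (fun e : inner_edges T => B_edge (val e)).

Definition pt_mass p h x : W := [ffun k => if (val k.1 == p) && (k.2 == h) then x else 0].

Fact pt_mass_linear p h : linear (pt_mass p h).
Proof.
move=> a x y; apply/ffunP => k; rewrite !ffunE.
by case: ifP => // _; rewrite scaler0 addr0.
Qed.
HB.instance Definition _ p h := GRing.isLinear.Build R P W _ (pt_mass p h) (pt_mass_linear p h).

Lemma pt_mass_single (k : kT) x : pt_mass (val k.1) k.2 x = single k x.
Proof.
by apply/ffunP => l; rewrite !ffunE; congr (if _ then _ else _).
Qed.

Lemma pt_mass0 p h x : p \notin inner_vertices T -> pt_mass p h x = 0.
Proof.
move=> pI; apply/ffunP => k; rewrite !ffunE; case: eqP => //= E.
by case/negP: pI; rewrite -E; apply: valP.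
Qed.

Definition bdt (a : {ffun inner_edges T -> P}) : W :=
  \sum_e (pt_mass (etail (val e)) (seg_hor (val e)) (a e)
        - pt_mass (ehead (val e)) (seg_hor (val e)) (a e)).

Fact bdt_linear : linear bdt.
Proof.
move=> k a b; rewrite /bdt scaler_sumr -big_split; apply: eq_bigr => e _ /=.
by rewrite !ffunE !pt_mass_linear scalerBr opprD addrACA.
Qed.
HB.instance Definition _ := GRing.isLinear.Build R _ _ _ bdt bdt_linear.

Definition mul_sum (w : W) : {ffun inner_vertices T -> P} :=
  [ffun p => mulp (ell_ms r (msk (p, true))) (w (p, true))
           + mulp (ell_ms r (msk (p, false))) (w (p, false))].

Fact mul_sum_linear : linear mul_sum.
Proof.
by move=> a u v; apply/ffunP => p; rewrite !ffunE !linearP /= scalerDr addrACA.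
Qed.
HB.instance Definition _ := GRing.isLinear.Build R _ _ _ mul_sum mul_sum_linear.

Definition ms_sum (w : W) : {ffun MIS T -> P} :=
  [ffun rho => \sum_(k | msk k == val rho) w k].

Fact ms_sum_linear : linear ms_sum.
Proof.
move=> a u v; apply/ffunP => rho; rewrite !ffunE scaler_sumr -big_split.
by apply: eq_bigr => k _; rewrite !ffunE.
Qed.
HB.instance Definition _ := GRing.isLinear.Build R _ _ _ ms_sum ms_sum_linear.

Lemma ms_sum_single (k : kT) x (rho : MIS T) :
  ms_sum (single k x) rho = if msk k == val rho then x else 0.
Proof.
rewrite ffunE; case: ifP => kr.
  rewrite (bigD1 k) ?kr //= ffunE eqxx big1 ?addr0 // => l /andP[_ /negPf lk].
  by rewrite ffunE lk.
rewrite big1 // => l lr; rewrite ffunE; case: eqP => // E.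
by rewrite -E lr in kr.
Qed.

Lemma limg_mul_sum : (linfun mul_sum @: W0)%VS = I_vertices m m' T r.
Proof.
have IE (e : seg R) (A : P) : e \in edges T -> A \in I_edge m m' r e <->
    exists2 B, B \in B_edge e & A = mulp (ell_edge r e) B.
  by move=> eT; rewrite memv_I_edge; apply/divides_mulp/r_ge.
apply/vspaceP => v; apply/idP/idP.
  case/memv_imgP => w /memv_prodv wW ->; rewrite lfunE /=; apply/memv_prodv => p; rewrite ffunE.
  have side h : mulp (ell_ms r (msk (p, h))) (w (p, h)) \in I_vertex m m' T r (val p).
    have [rM rh /on_msP[e er ep]] := msk_MS (p, h).
    have [eI _ _] := MS_edge rM er.
    rewrite /I_vertex (big_rem e) //= ep; apply: subvP (addvSl _ _) _ _.
    apply/IE; first exact: inner_edge_edge.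
    exists (w (p, h)); last by rewrite (ms_edge_ell rM er).
    by rewrite -(ms_edge_B rM er); apply: wW.
  by rewrite memvD.
move=> /memv_prodv vI; have /choice[w wP] : forall p : inner_vertices T, exists w : bool -> P,
    (forall h, w h \in B_space m m' r (msk (p, h))) /\
    v p = mulp (ell_ms r (msk (p, true))) (w true) + mulp (ell_ms r (msk (p, false))) (w false).
  move=> p; pose J := (linfun (mulp (ell_ms r (msk (p, true)))) @: B_space m m' r (msk (p, true))
    + linfun (mulp (ell_ms r (msk (p, false)))) @: B_space m m' r (msk (p, false)))%VS.
  have : v p \in J.
    apply: subvP (vI p); rewrite /I_vertex big_seq_cond.
    apply: (big_ind (fun U : {vspace P} => (U <= J)%VS)) => [|U V UJ VJ|e /andP[eI ep]].
    - exact: sub0v.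
    - by rewrite subv_add UJ.
    have eT := inner_edge_edge eI; have eM := edge_ms_at HR (valP p) eI ep.
    have [rM _ _] := msk_MS (p, seg_hor e).
    apply/subvP => A /(IE _ _ eT)[B BB ->].
    have BJ : mulp (ell_edge r e) B \in (linfun (mulp (ell_ms r (msk (p, seg_hor e)))) @:
        B_space m m' r (msk (p, seg_hor e)))%VS.
      apply/memv_imgP; exists B; first by rewrite (ms_edge_B rM eM).
      by rewrite lfunE /= (ms_edge_ell rM eM).
    rewrite /J; case: (seg_hor e) BJ => BJ; first exact: subvP (addvSl _ _) _ BJ.
    exact: subvP (addvSr _ _) _ BJ.
  case/memv_addP => _ /memv_imgP[x xB ->] [_ /memv_imgP[y yB ->] ->].
  by exists (fun h => if h then x else y); split=> [[]//|]; rewrite !lfunE.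
apply/memv_imgP; exists [ffun k => w k.1 k.2].
  by apply/memv_prodv => -[p h]; rewrite ffunE; have [] := wP p.
by rewrite lfunE /=; apply/ffunP => p; rewrite !ffunE; have [] := wP p.
Qed.

Lemma limg_mul_sum_bdt :
  (linfun mul_sum @: (linfun bdt @: E0))%VS = (linfun (@bd1 R T P) @: I_edges m m' T r)%VS.
Proof.
pose L (a : {ffun inner_edges T -> P}) : {ffun inner_edges T -> P} :=
  [ffun e => mulp (ell_edge r (val e)) (a e)].
have LE a : mul_sum (bdt a) = bd1 (L a).
  have bdtE (p : inner_vertices T) h : bdt a (p, h) = \sum_(e | seg_hor (val e) == h)
      (a e *+ (etail (val e) == val p) - a e *+ (ehead (val e) == val p)).
    rewrite /bdt sum_ffunE [RHS]big_mkcond; apply: eq_bigr => e _; rewrite !ffunE /=.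
    rewrite (eq_sym _ h) (eq_sym (etail _)) (eq_sym (ehead _)).
    by case: (h == _); rewrite ?andbF ?andbT ?subrr // !mulrb.
  apply/ffunP => p; rewrite !ffunE !bdtE !linear_sum /=.
  rewrite [RHS](bigID (fun e : inner_edges T => seg_hor (val e) == true)) /=.
  have E h : \sum_(e : inner_edges T | seg_hor (val e) == h)
      mulp (ell_ms r (msk (p, h))) (a e *+ (etail (val e) == val p) - a e *+ (ehead (val e) == val p))
    = \sum_(e : inner_edges T | seg_hor (val e) == h)
      (L a e *+ (etail (val e) == val p) - L a e *+ (ehead (val e) == val p)).
    apply: eq_bigr => e /eqP eh; rewrite linearB !linearMn ffunE /=.
    have eI := valP e; have eT := inner_edge_edge eI; have lt := edge_lt HT eT.
    have ellE : on_seg (val e) (val p) -> ell_ms r (msk (p, h)) = ell_edge r (val e).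
      move=> ep; have := edge_ms_at HR (valP p) eI ep; rewrite eh => eM.
      by apply: ms_edge_ell eM; have [] := msk_MS (p, h).
    have [Et|_] := eqVneq (etail (val e)) (val p).
      rewrite ellE // -Et /etail; case: ifP => _; by [apply: seg_end0_on|apply: seg_end1_on].
    have [Eh|_] := eqVneq (ehead (val e)) (val p); last by rewrite !mulr0n.
    rewrite ellE // -Eh /ehead; case: ifP => _; by [apply: seg_end0_on|apply: seg_end1_on].
  rewrite !E; congr (_ + _); apply: eq_bigl => e; by case: (seg_hor _).
apply/vspaceP => v; apply/memv_imgP/memv_imgP.
  case=> _ /memv_imgP[a /memv_prodv aE ->] ->; exists (L a); last by rewrite !lfunE /= LE.
  apply/memv_prodv => e; rewrite ffunE; apply/memv_I_edge/divides_mulp.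
    exact/r_ge/inner_edge_edge/(valP e).
  by exists (a e) => //; apply: aE.
case=> b /memv_prodv bI ->.
have /choice[a aP] : forall e : inner_edges T, exists x, x \in B_edge (val e) /\
    b e = mulp (ell_edge r (val e)) x.
  move=> e; have /memv_I_edge/divides_mulp := bI e.
  by case=> [|x xB xE]; [exact/r_ge/inner_edge_edge/(valP e)|exists x].
have bL : b = L [ffun e => a e] by apply/ffunP => e; rewrite !ffunE; have [] := aP e.
exists (bdt [ffun e => a e]); last by rewrite !lfunE /= LE -bL.
apply/memv_imgP; exists [ffun e => a e]; last by rewrite lfunE.
by apply/memv_prodv => e; rewrite ffunE; have [] := aP e.
Qed.

Lemma MIS_msk (rho : {fset seg R}) : rho \in MIS T -> exists k, msk k = rho.
Proof.
move=> rI; have rM := MIS_MS rI; have er := MS_rep rM.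
have [/inner_edge_edge eT eh _] := MS_edge rM er.
have rp : on_ms rho (seg_end0 (ms_rep rho)).
  by apply/on_msP; exists (ms_rep rho) => //; apply/seg_end0_on/(edge_lt HT).
have pI := MIS_vertex HT rI (seg_end0_vertex eT) rp.
by exists ([` pI]%fset, ms_hor rho); apply: (ms_at_uniq HR pI rM).
Qed.

Lemma mem_M_MIS (u : {ffun MIS T -> P}) : u \in M_space m m' T r (MIS T) <->
  forall rho : MIS T, u rho \in B_space m m' r (val rho).
Proof. by rewrite memv_M_space; split=> H rho; have := H rho; rewrite (valP rho). Qed.

Lemma limg_ms_sum : (linfun ms_sum @: W0)%VS = M_space m m' T r (MIS T).
Proof.
apply/vspaceP => u; apply/idP/idP => [/memv_imgP[w /memv_prodv wW ->]|/mem_M_MIS uM].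
  apply/mem_M_MIS => rho; rewrite lfunE /= ffunE; apply: memv_suml => k /eqP <-; exact: wW.
rewrite [u]sum_single; apply: memv_suml => rho _.
have [k kr] := MIS_msk (valP rho); apply/memv_imgP.
exists (single k (u rho)); first by apply: single_prodv; rewrite kr.
rewrite lfunE /=; apply/ffunP => rho'; rewrite ms_sum_single ffunE kr.
by rewrite val_eqE eq_sym.
Qed.

End Correction.

Section VertexRelations.
Variables (R : realType) (m m' : nat) (T : premesh R) (r : seg R -> int).
Hypotheses (HT : is_tmesh T) (HR : is_reduced T).
Hypotheses (Hr : is_smoothness T r) (Hc : constant_along_ms T r).
Notation P := (bipoly R m m').
Notation kT := (inner_vertices T * bool)%type.
Notation W := {ffun kT -> P}.
Implicit Types (p q : R * R) (h : bool) (rho : {fset seg R}) (x : P).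

Lemma ms_sum_pt_mass p h x (rho : MIS T) : ms_sum (pt_mass T p h x) rho =
  if (p \in inner_vertices T) && (ms_at T h p == val rho) then x else 0.
Proof.
have [pI|pI] := boolP (p \in inner_vertices T); last by rewrite pt_mass0 // linear0 ffunE.
by rewrite -[p]/(val ([` pI]%fset, h).1) -[h]/([` pI]%fset, h).2 pt_mass_single ms_sum_single.
Qed.

Lemma bdt_single (e : inner_edges T) x : bdt (single e x) =
  pt_mass T (etail (val e)) (seg_hor (val e)) x - pt_mass T (ehead (val e)) (seg_hor (val e)) x.
Proof.
rewrite /bdt (bigD1 e) //= big1 ?addr0 ?ffunE ?eqxx // => f fe.
by rewrite ffunE (negPf fe) !linear0 ?subrr ?addr0.
Qed.

Lemma etail_on (e : seg R) : e \in edges T -> on_seg e (etail e).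
Proof.
by move=> /(edge_lt HT) lt; rewrite /etail; case: ifP => _; [apply: seg_end0_on|apply: seg_end1_on].
Qed.

Lemma ehead_on (e : seg R) : e \in edges T -> on_seg e (ehead e).
Proof.
by move=> /(edge_lt HT) lt; rewrite /ehead; case: ifP => _; [apply: seg_end1_on|apply: seg_end0_on].
Qed.

Lemma etail_vertex (e : seg R) : e \in edges T -> etail e \in vertices T.
Proof. by move=> eT; rewrite /etail; case: ifP => _; [apply: seg_end0_vertex|apply: seg_end1_vertex]. Qed.

Lemma ehead_vertex (e : seg R) : e \in edges T -> ehead e \in vertices T.
Proof. by move=> eT; rewrite /ehead; case: ifP => _; [apply: seg_end1_vertex|apply: seg_end0_vertex]. Qed.

Lemma MIS_end_transfer (e : seg R) p q (rho : MIS T) : e \in inner_edges T ->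
  on_seg e p -> on_seg e q -> q \in vertices T ->
  (p \in inner_vertices T) && (ms_at T (seg_hor e) p == val rho) ->
  (q \in inner_vertices T) && (ms_at T (seg_hor e) q == val rho).
Proof.
move=> eI ep eq qV /andP[pI /eqP pr].
have er : e \in val rho by rewrite -pr; apply: edge_ms_at.
have [_ eh _] := MS_edge (MIS_MS (valP rho)) er.
have rq : on_ms (val rho) q by apply/on_msP; exists e.
have qI := MIS_vertex HT (valP rho) qV rq.
by rewrite qI; apply/eqP/(ms_at_uniq HR qI (MIS_MS (valP rho)) (esym eh) rq).
Qed.

Lemma pt_mass_W0 (e : seg R) p x : e \in inner_edges T -> on_seg e p ->
  x \in B_edge m m' r e -> pt_mass T p (seg_hor e) x \in W0 m m' T r.
Proof.
move=> eI ep xB; apply/memv_prodv => k; rewrite ffunE.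
case: andP => [[/eqP kp /eqP kh]|_]; last exact: mem0v.
have pI : p \in inner_vertices T by rewrite -kp; apply: valP.
have eM := edge_ms_at HR pI eI ep; have [rM _ _] := ms_atP HR (seg_hor e) pI.
by rewrite /msk kp kh (ms_edge_B _ _ Hc rM eM).
Qed.

Lemma ker_ms_sum :
  (W0 m m' T r :&: lker (linfun (@ms_sum R m m' T)))%VS = (linfun (@bdt R m m' T) @: E0 m m' T r)%VS.
Proof.
set L := (_ @: _)%VS; apply/vspaceP => w; rewrite memv_cap memv_ker lfunE /=.
apply/andP/idP; last first.
  case/memv_imgP => a /memv_prodv aE ->; rewrite lfunE /=; split.
    apply: memv_suml => e _; have eI := valP e; have eT := inner_edge_edge eI.
    by rewrite memvB // pt_mass_W0 //; first [apply: etail_on|apply: ehead_on|apply: aE].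
  apply/eqP; rewrite /bdt linear_sum big1 // => e _; rewrite linearB /=.
  have eI := valP e; have eT := inner_edge_edge eI.
  apply/eqP; rewrite subr_eq0; apply/eqP/ffunP => rho; rewrite !ms_sum_pt_mass.
  congr (if _ then _ else _); apply/idP/idP.
    exact: (MIS_end_transfer eI (etail_on eT) (ehead_on eT) (ehead_vertex eT)).
  exact: (MIS_end_transfer eI (ehead_on eT) (etail_on eT) (etail_vertex eT)).
case=> /memv_prodv wW /eqP w0.
have edgeL (e : seg R) rho x : rho \in MS T -> e \in rho -> x \in B_space m m' r rho ->
    pt_mass T (seg_end0 e) (ms_hor rho) x - pt_mass T (seg_end1 e) (ms_hor rho) x \in L.
  move=> rM er xB; have [eI eh _] := MS_edge rM er.
  have : linfun (@bdt R m m' T) (single [` eI]%fset x) \in L.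
    by apply/memv_img/single_prodv; rewrite -(ms_edge_B _ _ Hc rM er).
  rewrite lfunE /= bdt_single /= /etail /ehead eh; case: (ms_hor rho) => //.
  by rewrite -memvN opprB.
have moveL rho p q x : rho \in MS T -> p \in vertices T -> q \in vertices T ->
    on_ms rho p -> on_ms rho q -> x \in B_space m m' r rho ->
    pt_mass T p (ms_hor rho) x - pt_mass T q (ms_hor rho) x \in L.
  move=> rM pV qV rp rq xB; pose e0 := ms_rep rho; have e0r := MS_rep rM.
  have base s : s \in vertices T -> on_ms rho s ->
      pt_mass T s (ms_hor rho) x - pt_mass T (seg_end0 e0) (ms_hor rho) x \in L.
    apply: (MS_vertex_ind HT HR (S := fun s => pt_mass T s (ms_hor rho) x -
      pt_mass T (seg_end0 e0) (ms_hor rho) x \in L) rM) => [e er|]; last first.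
      by exists e0 => //; rewrite subrr mem0v.
    have eL := edgeL e rho x rM er xB; split=> H.
      by rewrite -[_ - _](subrKA (pt_mass T (seg_end0 e) (ms_hor rho) x)) memvD // -memvN opprB.
    by rewrite -[_ - _](subrKA (pt_mass T (seg_end1 e) (ms_hor rho) x)) memvD.
  rewrite -[_ - _](subrKA (pt_mass T (seg_end0 e0) (ms_hor rho) x)) memvD ?base //.
  by rewrite -memvN opprB base.
have /choice[b bP] : forall rho, exists q, rho \in MS T -> [/\ q \in vertices T, on_ms rho q &
    rho \notin MIS T -> q \notin inner_vertices T].
  move=> rho; have [rM|] := boolP (rho \in MS T); last by exists (0, 0).
  have [rI|rI] := boolP (rho \in MIS T).
    exists (seg_end0 (ms_rep rho)) => _; have er := MS_rep rM.
    have [/inner_edge_edge eT _ _] := MS_edge rM er.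
    split=> //; first exact: seg_end0_vertex.
    by apply/on_msP; exists (ms_rep rho) => //; apply/seg_end0_on/(edge_lt HT).
  have [e [q [er qe qI]]] := ray_vertex HT HR rM rI; exists q => _.
  have [/inner_edge_edge eT _ _] := MS_edge rM er; split=> //.
    by case: qe => ->; [apply: seg_end0_vertex|apply: seg_end1_vertex].
  by apply/on_msP; exists e => //; case: qe => ->; [apply: seg_end0_on|apply: seg_end1_on]; apply: (edge_lt HT).
pose w' : W := \sum_k pt_mass T (b (msk k)) k.2 (w k).
have ww' : w - w' \in L.
  rewrite [w]sum_single -sumrB; apply: memv_suml => k _; rewrite -pt_mass_single.
  have [kM kh kp] := msk_MS HR k; have [bV bM _] := bP _ kM.
  have [kV _] := (inner_vertexP T _).1 (valP k.1).
  by rewrite -[k.2]kh; apply: moveL.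
suff w'0 : w' = 0 by rewrite w'0 subr0 in ww'.
have E : w' = \sum_(rho : MIS T) pt_mass T (b (val rho)) (ms_hor (val rho)) (ms_sum w rho).
  have E2 (rho : MIS T) : pt_mass T (b (val rho)) (ms_hor (val rho)) (ms_sum w rho) =
      \sum_(k | msk k == val rho) pt_mass T (b (msk k)) k.2 (w k).
    rewrite ffunE linear_sum; apply: eq_bigr => k /eqP kr /=.
    by have [_ <- _] := msk_MS HR k; rewrite kr.
  rewrite (eq_bigr _ (fun (rho : MIS T) _ => E2 rho)) (exchange_big_dep xpredT) //=.
  apply: eq_bigr => k _; have [kM kh kp] := msk_MS HR k.
  have [kI|kI] := boolP (msk k \in MIS T).
    rewrite (bigD1 [` kI]%fset) /=; last exact: eqxx.
    rewrite big1 ?addr0 // => rho /andP[/eqP kr /eqP[]]; exact/val_inj.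
  have [_ _ bI] := bP _ kM; rewrite (pt_mass0 _ _ (bI kI)) big1 //.
by rewrite E w0 big1 // => rho _; rewrite ffunE linear0.
Qed.

Lemma limg_ker_mul_sum :
  (linfun (@ms_sum R m m' T) @: (W0 m m' T r :&: lker (linfun (@mul_sum R m m' T r))))%VS =
  Rel_space m m' T r.
Proof.
have rge (k : kT) : -1 <= ms_r r (msk k) by have [/(ms_r_ge Hr)] := msk_MS HR k.
have relE (p : inner_vertices T) (q : P) (x y : P) (u : {ffun MIS T -> P}) :
    poly_of x = - (ell_ms r (msk (p, false)) * poly_of q) ->
    poly_of y = ell_ms r (msk (p, true)) * poly_of q ->
    u = ms_sum (single (p, true) x + single (p, false) y) <->
    forall rho : MIS T, poly_of (u rho) =
      if val rho == msk (p, false) then ell_ms r (msk (p, true)) * poly_of q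
      else if val rho == msk (p, true) then - (ell_ms r (msk (p, false)) * poly_of q)
      else 0.
  move=> xE yE; have hvne : msk (p, true) != msk (p, false).
    apply/eqP => E; have [_ h1 _] := msk_MS HR (p, true).
    by have [_ h2 _] := msk_MS HR (p, false); rewrite E h2 in h1.
  have sE (rho : MIS T) : poly_of (ms_sum (single (p, true) x + single (p, false) y) rho) =
      if val rho == msk (p, false) then ell_ms r (msk (p, true)) * poly_of q
      else if val rho == msk (p, true) then - (ell_ms r (msk (p, false)) * poly_of q)
      else 0.
    rewrite linearD ffunE !ms_sum_single (eq_sym _ (val rho)) (eq_sym _ (val rho)).
    have [->|_] := eqVneq (val rho) (msk (p, false)).
      by rewrite eq_sym (negPf hvne) add0r.
    by case: eqP => _; rewrite addr0 // poly_of0.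
  split=> [-> rho|H]; first exact: sE.
  by apply/ffunP => rho; apply: (@poly_of_inj R m m'); rewrite H sE.
have ellE h (p : inner_vertices T) : ell_ms r (msk (p, h)) = ell h (ms_pos (msk (p, h))) ^+ succz (ms_r r (msk (p, h))).
  by have [_ hh _] := msk_MS HR (p, h); rewrite /ell_ms hh.
have BE h (p : inner_vertices T) : B_space m m' r (msk (p, h)) = Bsp R m m' h (ms_r r (msk (p, h))).
  by have [_ hh _] := msk_MS HR (p, h); rewrite B_spaceE hh.
apply/eqP; rewrite eqEsubv; apply/andP; split; apply/subvP => u.
  case/memv_imgP => w; rewrite memv_cap memv_ker lfunE /= => /andP[/memv_prodv wW /eqP w0] ->.
  rewrite lfunE /= [w]sum_single.
  have -> : \sum_k single k (w k) = \sum_p (single (p, true) (w (p, true)) + single (p, false) (w (p, false))).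
    rewrite (eq_bigr (fun k => single (k.1, k.2) (w (k.1, k.2)))) => [|[] //].
    rewrite -(pair_bigA _ (fun (p : inner_vertices T) h => single (p, h) (w (p, h)))) /=.
    by apply: eq_bigr => p _; rewrite big_bool.
  rewrite linear_sum; apply: memv_suml => p _ /=.
  set x := w (p, true); set y := w (p, false).
  have xB : x \in Bsp R m m' true (ms_r r (msk (p, true))) by rewrite -BE; apply: wW.
  have yB : y \in Bsp R m m' false (ms_r r (msk (p, false))) by rewrite -BE; apply: wW.
  have : poly_of (mul_sum r w p) = 0 by rewrite w0 ffunE poly_of0.
  rewrite ffunE poly_ofD !ellE (poly_of_mulp _ (rge _) xB) (poly_of_mulp _ (rge _) yB).
  case/ell_syzygy => q [xq yq].
  have [rIx|rIx] := boolP ((msk (p, true) \in MIS T) || (msk (p, false) \in MIS T)); last first.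
    suff -> : ms_sum (single (p, true) x + single (p, false) y) = 0 by apply: mem0v.
    move: rIx; rewrite negb_or => /andP[n1 n2].
    apply/ffunP => rho; rewrite linearD ffunE !ms_sum_single [RHS]ffunE.
    case: eqP n1 => [->|_ _]; first by rewrite (valP rho).
    by case: eqP n2 => [->|_ _]; rewrite ?(valP rho) // addr0.
  have qb : bideg (m.+1 - succz (ms_r r (msk (p, false)))) (m'.+1 - succz (ms_r r (msk (p, true)))) q.
    have /(mem_Bsp true x (rge (p, true)))/bidegN := xB; rewrite xq opprK => xb.
    have [b0|] := posnP (m'.+1 - succz (ms_r r (msk (p, true)))); last first.
      by move=> b0; exact: (bideg_ell_dvd _ b0 xb).
    move: xb; rewrite b0 => -[]; rewrite leqn0 size_poly_eq0 mulf_eq0 (negPf (ell_neq0 _ _ _)) /=.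
    by move=> /eqP -> _; split=> [|j]; rewrite ?coef0 size_poly0.
  have qP : poly_of (of_poly m m' q) = q.
    apply: of_polyK; apply/bidegP => i j nz.
    by have /bidegP /(_ _ _ nz) := qb; lia.
  apply: mem_vspan; exists (val p); first exact: valP.
  split; first by case/orP: rIx; auto.
  exists (of_poly m m' q).
    by apply/Rspace_succz; [exact: (rge (p, false))|exact: (rge (p, true))|rewrite qP].
  apply/(relE p (of_poly m m' q) x y); rewrite ?qP ?ellE //.
move: u; apply/subvP/vspan_sub => u [p pI] /= [_ [q qR uE]].
pose p' : inner_vertices T := [` pI]%fset.
have qb : bideg (m.+1 - succz (ms_r r (msk (p', false)))) (m'.+1 - succz (ms_r r (msk (p', true))))
    (poly_of q) by apply/Rspace_succz.
pose x : P := of_poly m m' (- (ell_ms r (msk (p', false)) * poly_of q)).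
pose y : P := of_poly m m' (ell_ms r (msk (p', true)) * poly_of q).
have a0 : (0 < m.+1)%N by []; have b0 : (0 < m'.+1)%N by [].
have xb : bideg m.+1 (m'.+1 - succz (ms_r r (msk (p', true))))
    (- (ell_ms r (msk (p', false)) * poly_of q)).
  apply: bidegN; have [b1|b1] := posnP (m'.+1 - succz (ms_r r (msk (p', true)))).
    move: qb; rewrite b1 => -[]; rewrite leqn0 size_poly_eq0 => /eqP -> _.
    by rewrite mulr0; split=> [|j]; rewrite ?coef0 size_poly0.
  by rewrite ellE; apply: bideg_ell_mul.
have yb : bideg (m.+1 - succz (ms_r r (msk (p', false)))) m'.+1
    (ell_ms r (msk (p', true)) * poly_of q).
  have [b1|b1] := posnP (m.+1 - succz (ms_r r (msk (p', false)))).
    have -> : poly_of q = 0.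
      by apply/polyP => j; apply/polyP => i; rewrite !coef0; apply/eqP; apply: contraT => nz;
        have /bidegP /(_ _ _ nz)[] := qb; rewrite b1.
    by rewrite mulr0; split=> [|j]; rewrite ?coef0 size_poly0.
  by rewrite ellE; apply: bideg_ell_mul.
have widen a b (g : {poly {poly R}}) : (a <= m.+1)%N -> (b <= m'.+1)%N ->
    bideg a b g -> bideg m.+1 m'.+1 g.
  by move=> am bm /bidegP H; apply/bidegP => i j /H; lia.
have xE : poly_of x = - (ell_ms r (msk (p', false)) * poly_of q).
  by apply: of_polyK; apply: widen xb; rewrite ?leq_subr.
have yE : poly_of y = ell_ms r (msk (p', true)) * poly_of q.
  by apply: of_polyK; apply: widen yb; rewrite ?leq_subr.
have xB : x \in B_space m m' r (msk (p', true)).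
  by rewrite BE; apply/mem_Bsp; rewrite ?xE //; apply: rge.
have yB : y \in B_space m m' r (msk (p', false)).
  by rewrite BE; apply/mem_Bsp; rewrite ?yE //; apply: rge.
have Ex : poly_of (mulp (ell_ms r (msk (p', true))) x) = ell_ms r (msk (p', true)) * poly_of x.
  by rewrite ellE; apply: (poly_of_mulp _ (rge (p', true))); rewrite -BE.
have Ey : poly_of (mulp (ell_ms r (msk (p', false))) y) = ell_ms r (msk (p', false)) * poly_of y.
  by rewrite ellE; apply: (poly_of_mulp _ (rge (p', false))); rewrite -BE.
clearbody x y.
have -> : u = ms_sum (single (p', true) x + single (p', false) y) by apply/(relE p' _ _ _ _ xE yE).
rewrite -[ms_sum _]lfunE; apply: memv_img; rewrite memv_cap memvD ?single_prodv //=.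
rewrite memv_ker lfunE /=; apply/eqP/ffunP => z; rewrite !ffunE /=.
have [<-|zp] := eqVneq p' z.
  rewrite !eqxx /= ![(_, _) == _]xpair_eqE !eqxx /= addr0 add0r.
  apply: (@poly_of_inj R m m'); rewrite poly_ofD poly_of0.
  by rewrite Ex Ey xE yE mulrN mulrCA addNr.
by rewrite ![(_, _) == _]xpair_eqE ![z == _]eq_sym (negPf zp) /= addr0 !linear0 addr0.
Qed.

Lemma dim_I_vertices :
  (\dim (I_vertices m m' T r) + \dim (Rel_space m m' T r) =
   \dim (M_space m m' T r (MIS T)) + \dim (linfun (@bd1 R T P) @: I_edges m m' T r))%N.
Proof.
have := dim_two_quotients (linfun (@mul_sum R m m' T r)) ker_ms_sum.
by rewrite limg_mul_sum // limg_ms_sum // limg_ker_mul_sum limg_mul_sum_bdt.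
Qed.

Lemma Rel_sub_M : (Rel_space m m' T r <= M_space m m' T r (MIS T))%VS.
Proof.
by rewrite -limg_ker_mul_sum -limg_ms_sum // limgS // capvSl.
Qed.

End VertexRelations.

(** * Multiples of powers of linear polynomials *)

Section PowerSpan.
Variable R : realType.

Lemma prod_dvdp (I : eqType) (s : seq I) (c : I -> R) (n : I -> nat) (f : {poly R}) :
  uniq s -> injective c -> (forall i, i \in s -> ('X - (c i)%:P) ^+ n i %| f) ->
  \prod_(i <- s) ('X - (c i)%:P) ^+ n i %| f.
Proof.
move=> us ci; elim: s us => [|i s IH] /=; first by rewrite big_nil dvd1p.
case/andP => ni us H; rewrite big_cons Gauss_dvdp.
  rewrite H ?mem_head //= IH // => j js; apply: H; rewrite inE js orbT //.
elim: s ni {us H IH} => [|j s IH]; first by rewrite big_nil coprimep1.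
rewrite inE negb_or => /andP[ij ni]; rewrite big_cons coprimepMr IH // andbT.
apply/coprimep_expl/coprimep_expr; rewrite coprimep_XsubC root_XsubC.
by apply: contraNneq ij => /ci ->.
Qed.

(* mu_s((s - X)^n), mu acting on polynomials in s: expanding s - X as
   (s - c) - (X - c) shows that it is divisible by (X - c)^(n + 1 - k) as soon as
   mu annihilates the multiples of (s - c)^k of degree at most n. *)
Definition apolar (n : nat) (mu : {poly R} -> R) : {poly R} :=
  \sum_(i < n.+1) ((-1) ^+ i * mu ('X^(n - i)) *+ 'C(n, i)) *: 'X^i.

Lemma apolarE (n : nat) (mu : {linear {poly R} -> R^o}) (c : R) :
  apolar n mu = \sum_(i < n.+1)
    ((-1) ^+ i * mu (('X - c%:P) ^+ (n - i)) *+ 'C(n, i)) *: ('X - c%:P) ^+ i.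
Proof.
pose F (c : R) := \sum_(i < n.+1)
    ((-1) ^+ i * mu (('X - c%:P) ^+ (n - i)) *+ 'C(n, i)) *: ('X - c%:P) ^+ i.
have FE d : F d = map_poly mu (('X%:P - 'X : {poly {poly R}}) ^+ n).
  have -> : 'X%:P - 'X = ('X - d%:P)%:P - map_poly polyC ('X - d%:P) :> {poly {poly R}}.
    by rewrite [map_poly _ _]rmorphB /= map_polyX map_polyC /= polyCB opprB addrA subrK.
  have key (a H : {poly R}) : map_poly mu (a%:P * map_poly polyC H) = mu a *: H.
    apply/polyP => j; rewrite coef_map coefCM coef_map coefZ /=.
    by rewrite mulrC mul_polyC linearZ /= mulrC.
  rewrite exprBn raddf_sum; apply: eq_bigr => i _ /=.
  set A := 'X - d%:P.
  have -> : (-1) ^+ i * A%:P ^+ (n - i) * map_poly polyC A ^+ i *+ 'C(n, i) =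
      (((-1) ^+ i *: A ^+ (n - i)) *+ 'C(n, i))%:P * map_poly polyC (A ^+ i).
    rewrite polyCMn mulrnAl -mul_polyC polyCM !rmorphXn /= polyCN polyC1.
    by rewrite polyCN polyC1.
  by rewrite key linearMn linearZ.
have -> : apolar n mu = F 0.
  by apply: eq_bigr => i _; rewrite polyC0 subr0.
by rewrite FE -(FE c).
Qed.

Lemma power_span (n : nat) (I : finType) (c : I -> R) (k : I -> nat) (g : {poly R}) :
  injective c -> (n.+1 <= \sum_i (n.+1 - k i))%N -> (size g <= n.+1)%N ->
  exists q : I -> {poly R}, (forall i, (size (q i) <= n.+1 - k i)%N) /\
    g = \sum_i ('X - (c i)%:P) ^+ k i * q i.
Proof.
move=> ci big sg.
pose h i (v : 'rV[R]_(n.+1 - k i)) : 'rV[R]_n.+1 := poly_rV (('X - (c i)%:P) ^+ k i * rVpoly v).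
have hlin i : linear (@h i) by move=> a u v; rewrite /h linearP mulrDr -scalerAr linearP.
pose hL i : {linear 'rV[R]_(n.+1 - k i) -> 'rV[R]_n.+1} :=
  HB.pack (@h i) (GRing.isLinear.Build _ _ _ _ (@h i) (hlin i)).
pose W := (\sum_i limg (linfun (hL i)))%VS.
have szk i (q : {poly R}) : (size q <= n.+1 - k i)%N ->
    (size (('X - (c i)%:P) ^+ k i * q)%R <= n.+1)%N.
  move=> sq; have [->|q0] := eqVneq q 0; first by rewrite mulr0 size_poly0.
  rewrite size_monicM ?monic_exp ?monicXsubC // size_exp_XsubC.
  by move: sq; rewrite addSn /= leq_psubRL // lt0n size_poly_eq0.
have WP i (q : {poly R}) : (size q <= n.+1 - k i)%N ->
    poly_rV (('X - (c i)%:P) ^+ k i * q) \in W.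
  move=> sq; apply: (subvP (sumv_sup i _ (subvv _))) => //.
  by apply/memv_imgP; exists (poly_rV q); rewrite ?memvf // lfunE /= /h poly_rV_K.
suff full : W = fullv.
  have : poly_rV g \in W by rewrite full memvf.
  case/memv_sumP => v vW gE.
  have /choice[u uP] : forall i, exists u : {poly R}, (size u <= n.+1 - k i)%N /\
      v i = poly_rV (('X - (c i)%:P) ^+ k i * u).
    move=> i; have /memv_imgP[y _ yE] := vW i isT; exists (rVpoly y).
    by rewrite size_poly; split=> //; rewrite yE lfunE.
  exists u; split=> [i|]; first by have [] := uP i.
  rewrite -(poly_rV_K sg) gE linear_sum; apply: eq_bigr => i _ /=.
  by have [su ->] := uP i; rewrite poly_rV_K // szk.
apply/eqP; rewrite eqEsubv subvf /=; apply/subvP => v _; rewrite -[W]lker_quot_pi memv_ker.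
apply/eqP/rowP => j; rewrite mxE.
pose mu0 (p : {poly R}) : R^o := quot_pi W (poly_rV p) 0 j.
have mulin : linear mu0 by move=> a u w; rewrite /mu0 !linearP !mxE.
pose mu : {linear {poly R} -> R^o} := HB.pack mu0 (GRing.isLinear.Build _ _ _ _ mu0 mulin).
have muW p : poly_rV p \in W -> mu p = 0.
  rewrite -[W in X in X -> _]lker_quot_pi memv_ker => /eqP E.
  by rewrite /mu /= /mu0 E mxE.
have ap0 : apolar n mu = 0.
  have dv i : ('X - (c i)%:P) ^+ (n.+1 - k i) %| apolar n mu.
    rewrite (apolarE _ _ (c i)); 
    apply: (big_ind (fun p : {poly R} => ('X - (c i)%:P) ^+ (n.+1 - k i) %| p)) => [|u w|l _].
    - exact: dvdp0.
    - exact: dvdp_add.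
    have [le|lt] := leqP (k i) (n - l).
      rewrite muW ?mulr0 ?mul0rn ?scale0r ?dvdp0 //.
      rewrite -(subnKC le) exprD; apply: WP; rewrite size_exp_XsubC.
      by have := ltn_ord l; lia.
    by rewrite -mul_polyC; apply/dvdp_mull/dvdp_exp2l; have := ltn_ord l; lia.
  have := prod_dvdp (index_enum_uniq I) ci (fun i _ => dv i).
  apply: contraTeq => nz; apply/negP => /(dvdp_leq nz).
  have -> : size (\prod_i ('X - (c i)%:P) ^+ (n.+1 - k i)) = (\sum_i (n.+1 - k i)).+1.
    rewrite size_prod => [|i _]; last by rewrite expf_neq0 // polyXsubC_eq0.
    rewrite (eq_bigr (fun i => (n.+1 - k i) + 1)%N) => [|i _]; last by rewrite size_exp_XsubC addn1.
    by rewrite big_split /= sum1_card -addSn addnK.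
  have : (size (apolar n mu) <= n.+1)%N.
    apply: leq_trans (size_sum _ _ _) _; apply/bigmax_leqP => i _.
    by apply: leq_trans (size_scale_leq _ _) _; rewrite size_polyXn.
  by move=> le1 le2; have := leq_trans le2 le1; rewrite ltnNge big.
have muX i : (i <= n)%N -> mu 'X^i = 0.
  move=> le; have := congr1 (fun p : {poly R} => p`_(n - i)) ap0.
  have lt : (n - i < n.+1)%N by rewrite ltnS leq_subr.
  rewrite coef0 coef_sum (bigD1 (Ordinal lt)) //= big1 ?addr0 => [|l li]; last first.
    rewrite coefZ coefXn; case: eqP => [E|]; last by rewrite mulr0.
    by case/eqP: li; apply: val_inj.
  rewrite coefZ coefXn eqxx mulr1 subKn // => /eqP; rewrite mulrn_eq0 mulf_eq0 signr_eq0 /=.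
  by rewrite -leqn0 leqNgt bin_gt0 leq_subr /= => /eqP.
have -> : quot_pi W v 0 j = mu (rVpoly v) by rewrite /mu /= /mu0 rVpolyK.
have -> : rVpoly v = \sum_(i < n.+1) v 0 i *: 'X^i.
  by rewrite /rVpoly poly_def; apply: eq_bigr => i _; rewrite valK.
rewrite linear_sum big1 // => i _; rewrite linearZ muX; first exact: mulr0.
exact: (ltn_ord i).
Qed.

End PowerSpan.

(** * Deletions *)

Section EllSpan.
Variable R : realType.

Lemma ell_span_ver (n b : nat) (I : finType) (c : I -> R) (k : I -> nat) (g : {poly {poly R}}) :
  injective c -> (n.+1 <= \sum_i (n.+1 - k i))%N -> bideg n.+1 b g ->
  exists Q : I -> {poly {poly R}}, (forall i, bideg (n.+1 - k i) b (Q i)) /\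
    g = \sum_i ell false (c i) ^+ k i * Q i.
Proof.
move=> ci big [gb ga].
have /choice[q qP] := fun j => power_span ci big (ga j).
exists (fun i => \poly_(j < b) q j i); split=> [i|].
  split=> [|j]; first exact: size_poly.
  by rewrite coef_poly; case: ifP => _; [have [] := qP j|rewrite size_poly0].
apply/polyP => j; rewrite coef_sum.
have [jb|bj] := ltnP j b; last first.
  rewrite nth_default ?(leq_trans gb) // big1 // => i _.
  by rewrite /ell -rmorphXn /= coefCM coef_poly ltnNge bj /= mulr0.
have [_ ->] := qP j; apply: eq_bigr => i _.
by rewrite /ell -rmorphXn /= coefCM coef_poly jb.
Qed.

Lemma bideg_swap (a b : nat) (g : {poly {poly R}}) : bideg a b g -> bideg b a (swapXY g).
Proof.
move/bidegP => H; apply/bidegP => i j; rewrite coef_swapXY => /H; lia.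
Qed.

Lemma swapXY_ell h (c : R) : swapXY (ell h c) = ell (~~ h) c.
Proof.
by case: h; rewrite /ell /= ?rmorphB /= ?swapXY_X ?swapXY_Y ?swapXY_polyC ?map_polyC
  ?map_polyXsubC /= ?polyCB ?map_polyX.
Qed.

Lemma ell_span_hor (n b : nat) (I : finType) (c : I -> R) (k : I -> nat) (g : {poly {poly R}}) :
  injective c -> (n.+1 <= \sum_i (n.+1 - k i))%N -> bideg b n.+1 g ->
  exists Q : I -> {poly {poly R}}, (forall i, bideg b (n.+1 - k i) (Q i)) /\
    g = \sum_i ell true (c i) ^+ k i * Q i.
Proof.
move=> ci big /bideg_swap /(ell_span_ver ci big)[Q [QB QE]].
exists (fun i => swapXY (Q i)); split=> [i|]; first exact/bideg_swap.
rewrite -[g]swapXYK QE rmorph_sum; apply: eq_bigr => i _.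
by rewrite rmorphM rmorphXn; congr (_ ^+ _ * _); exact: (swapXY_ell false).
Qed.

End EllSpan.

Section Deletion.
Variables (R : realType) (m m' : nat) (T : premesh R) (r : seg R -> int).
Hypotheses (HT : is_tmesh T) (HR : is_reduced T).
Hypotheses (Hr : is_smoothness T r) (Hc : constant_along_ms T r).
Notation P := (bipoly R m m').
Notation kT := (inner_vertices T * bool)%type.
Implicit Types (A : {fset {fset seg R}}) (h : bool) (rho : {fset seg R}).

Definition rel_vector (p : inner_vertices T) (q : {poly {poly R}}) : {ffun MIS T -> P} :=
  [ffun rho => of_poly m m' (
    if val rho == msk (p, false) then ell_ms r (msk (p, true)) * q
    else if val rho == msk (p, true) then - (ell_ms r (msk (p, false)) * q) else 0)].

Lemma rel_vectorP p q : (msk (p, true) \in MIS T) || (msk (p, false) \in MIS T) ->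
  bideg (m.+1 - succz (ms_r r (msk (p, false)))) (m'.+1 - succz (ms_r r (msk (p, true)))) q ->
  (rel_vector p q \in Rel_space m m' T r) /\
  (forall rho : MIS T, poly_of (rel_vector p q rho) =
    if val rho == msk (p, false) then ell_ms r (msk (p, true)) * q
    else if val rho == msk (p, true) then - (ell_ms r (msk (p, false)) * q) else 0).
Proof.
move=> hv qb.
have ellE h : ell_ms r (msk (p, h)) = ell h (ms_pos (msk (p, h))) ^+ succz (ms_r r (msk (p, h))).
  by have [_ hh _] := msk_MS HR (p, h); rewrite /ell_ms hh.
have qB : bideg m.+1 m'.+1 q by apply/bidegP => i j; move/bidegP: qb => /(_ i j) + /[dup] nz => /(_ nz); lia.
have b1 : bideg m.+1 m'.+1 (ell_ms r (msk (p, true)) * q).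
  rewrite ellE; apply: bideg_ell_mul => //.
  by apply/bidegP => i j; move/bidegP: qb => /(_ i j) + /[dup] nz => /(_ nz); lia.
have b2 : bideg m.+1 m'.+1 (ell_ms r (msk (p, false)) * q).
  rewrite ellE; apply: bideg_ell_mul => //.
  by apply/bidegP => i j; move/bidegP: qb => /(_ i j) + /[dup] nz => /(_ nz); lia.
have E (rho : MIS T) : poly_of (rel_vector p q rho) =
    if val rho == msk (p, false) then ell_ms r (msk (p, true)) * q
    else if val rho == msk (p, true) then - (ell_ms r (msk (p, false)) * q) else 0.
  rewrite ffunE; apply: of_polyK; case: ifP => _ //; case: ifP => _; first exact: bidegN.
  by split=> [|j]; rewrite ?coef0 size_poly0.
split=> //; apply: mem_vspan; exists (val p); first exact: valP.
have qE : poly_of (of_poly m m' q) = q by exact: of_polyK.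
split; first by case/orP: hv; auto.
exists (of_poly m m' q); last by rewrite qE; exact: E.
have [/(ms_r_ge Hr) g1 _ _] := msk_MS HR (p, false).
have [/(ms_r_ge Hr) g2 _ _] := msk_MS HR (p, true).
by apply/Rspace_succz; rewrite ?qE.
Qed.

Lemma poly_of_sum (I : finType) (F : I -> P) : poly_of (\sum_i F i) = \sum_i poly_of (F i).
Proof. by apply: (big_morph _ (@poly_ofD R m m')); apply: poly_of0. Qed.

Lemma ms_at_ell h (p : inner_vertices T) : ell_ms r (msk (p, h)) =
  ell h (pcoord (~~ h) (val p)) ^+ succz (ms_r r (msk (p, h))).
Proof.
have [/max_segmentsP[_ sr _] hh on] := msk_MS HR (p, h).
by rewrite /ell_ms -(on_ms_pos sr on) hh.
Qed.

Lemma deletion_vector A rho x : (A `<=` MIS T)%fset -> rho \in A ->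
  (exists s1 s2 : seq {fset seg R}, let io := s1 ++ rho :: s2 in
    [/\ is_total_order T io, s1 =i (MIS T `\` A)%fset &
        threshold m m' rho <= weight m m' T r io rho]) ->
  x \in B_space m m' r rho ->
  exists u : {ffun MIS T -> P}, [/\ u \in Rel_space m m' T r, u \in M_space m m' T r A &
    forall rho' : MIS T, val rho' = rho -> u rho' = x].
Proof.
move=> AM rA [s1 [s2 /= [[uio _] s1E wt]]] xB; set io := s1 ++ rho :: s2 in uio wt.
have rI : rho \in MIS T by apply: (fsubsetP AM).
have rM := MIS_MS rI; have [_ sr _] := (max_segmentsP _ _).1 rM.
have takeE : take (index rho io) io = s1.
  rewrite /io index_cat; have /negPf -> : rho \notin s1 by rewrite s1E in_fsetD rA.
  by rewrite /= eqxx addn0 take_size_cat.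
pose Gm := Gamma T io rho; set h := ms_hor rho.
have GP (g : Gm) : [/\ val g \in inner_vertices T, on_ms rho (val g) &
    forall rho', rho' \in (MIS T `\` A)%fset -> ~~ on_ms rho' (val g)].
  have := valP g; rewrite /= in_fset_sep takeE => /andP[gV /andP[gr /allP gs]].
  have gI := MIS_vertex HT rI gV gr; split=> //.
  by move=> rho' r'; apply: gs; rewrite s1E.
pose iv (g : Gm) : inner_vertices T := [` let: And3 H _ _ := GP g in H]%fset.
have mskE g : msk (iv g, h) = rho.
  by have [gI gr _] := GP g; apply: (ms_at_uniq HR gI rM).
pose k (g : Gm) := succz (ms_r r (msk (iv g, ~~ h))).
pose c (g : Gm) := pcoord h (val g).
have ci : injective c.
  move=> g g' E; apply/val_inj/(coord_inj E).
  have [[_ gr _] [_ g'r _]] := (GP g, GP g').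
  by rewrite (on_ms_pos sr gr) (on_ms_pos sr g'r).
pose n := if h then m else m'.
have big : (n.+1 <= \sum_g (n.+1 - k g))%N.
  rewrite -lez_nat Posz_sum; have -> : n.+1%:Z = threshold m m' rho.
    by rewrite /threshold /n -/h; case: (h); lia.
  apply: le_trans wt _; rewrite /weight big_seq_fsetE /= le_eqVlt; apply/orP; left; apply/eqP.
  apply: eq_bigr => g _; have [/(ms_r_ge Hr) ge _ _] := msk_MS HR (iv g, ~~ h).
  rewrite /k /n -/h /mu_h /mu_v; move: ge; rewrite /msk /=.
  have arith (a : nat) (l : int) : -1 <= l -> Num.max (a%:Z - l) 0 = (a.+1 - succz l)%N%:Z.
    by rewrite /succz maxEle; case: ifP; lia.
  by case: (h) => /= ge; apply: arith.
have rge : -1 <= ms_r r rho by exact: (ms_r_ge Hr rM).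
have xb := (mem_Bsp _ _ rge).1 xB; rewrite -/h in xb.
have [Q QB QE] : exists2 Q : Gm -> {poly {poly R}}, (forall g,
    bideg (m.+1 - succz (ms_r r (msk (iv g, false)))) (m'.+1 - succz (ms_r r (msk (iv g, true)))) (Q g)) &
    poly_of x = \sum_g ell (~~ h) (c g) ^+ k g * Q g.
  move: xb big; rewrite /n /k; case E : h => /= xb big.
    have [Q [QB QE]] := ell_span_ver ci big xb; exists Q => // g.
    have := mskE g; rewrite E => ->; exact: QB.
  have [Q [QB QE]] := ell_span_hor ci big xb; exists Q => // g.
  have := mskE g; rewrite E => ->; exact: QB.
pose sQ g := if h then - Q g else Q g.
have sQB g : bideg (m.+1 - succz (ms_r r (msk (iv g, false)))) (m'.+1 - succz (ms_r r (msk (iv g, true)))) (sQ g).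
  by rewrite /sQ; case: (h); [apply: bidegN|].
have hv g : (msk (iv g, true) \in MIS T) || (msk (iv g, false) \in MIS T).
  by have := mskE g; case: (h) => ->; rewrite rI ?orbT.
pose u : {ffun MIS T -> P} := \sum_g rel_vector (iv g) (sQ g).
have uRel : u \in Rel_space m m' T r.
  by apply: memv_suml => g _; have [] := rel_vectorP (hv g) (sQB g).
have hvne g : msk (iv g, h) != msk (iv g, ~~ h).
  apply/eqP => E; have [_ h1 _] := msk_MS HR (iv g, h).
  by have [_ + _] := msk_MS HR (iv g, ~~ h); rewrite -E h1 /=; case: (h).
exists u; split=> //.
  have /mem_M_MIS uM := subvP (Rel_sub_M _ _ HT HR Hr) _ uRel.
  apply/memv_M_space => rho'; case: ifP => r'A; first exact: uM.
  rewrite memv0 /u sum_ffunE big1 // => g _; apply: (@poly_of_inj R m m').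
  have [_ ->] := rel_vectorP (hv g) (sQB g); rewrite poly_of0.
  have ner b : (val rho' == msk (iv g, b)) = false.
    apply/negP => /eqP E; have [bh|/eqP bh] := eqVneq b h.
      by move: r'A; rewrite E bh mskE rA.
    have [_ _ on] := msk_MS HR (iv g, b); have [_ _ /(_ (val rho'))] := GP g.
    by rewrite in_fsetD r'A (valP rho') E on => /(_ isT).
  by rewrite !ner.
move=> rho' E; apply: (@poly_of_inj R m m'); rewrite sum_ffunE poly_of_sum QE.
apply: eq_bigr => g _; have [_ ->] := rel_vectorP (hv g) (sQB g).
have -> : val rho' = rho by exact: E.
have := hvne g; have := ms_at_ell (~~ h) (iv g); have := mskE g; rewrite /sQ /k /c.
case: (h) => /= <- -> ne.
  by rewrite (negPf ne) eqxx mulrN opprK.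
by rewrite eqxx.
Qed.

Lemma H_deletion A A' : (A `<=` MIS T)%fset -> admissible_deletion m m' T r A A' ->
  \dim (H_space m m' T r A) = \dim (H_space m m' T r A').
Proof.
move=> AM [rho rA [-> [s1 [s2 /= [io s1E s2E wt]]]]].
have rI : rho \in MIS T by apply: (fsubsetP AM).
have MM : (M_space m m' T r (A `\ rho)%fset <= M_space m m' T r A)%VS.
  apply/subvP => u /memv_M_space uM; apply/memv_M_space => rho'.
  have := uM rho'; rewrite in_fsetD1; case: (val rho' \in A); rewrite ?andbF ?andbT //.
  by case: ifP => // _; rewrite memv0 => /eqP ->; apply: mem0v.
have sum : (M_space m m' T r (A `\ rho)%fset + M_space m m' T r A :&: Rel_space m m' T r)%VS =
    M_space m m' T r A.
  apply/eqP; rewrite eqEsubv subv_add MM capvSl /=; apply/subvP => v vM.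
  have /memv_M_space vM' := vM; have := vM' [` rI]%fset; rewrite /= rA => xB.
  have [|u [uR uM uE]] := deletion_vector AM rA _ xB; first by exists s1, s2.
  rewrite -[v](subrK u) memv_add // ?memv_cap ?uM //.
  apply/memv_M_space => rho'; rewrite in_fsetD1; have [E|ne] := eqVneq (val rho') rho.
    rewrite /= !ffunE uE // memv0 subr_eq0; apply/eqP; congr (v _); exact: val_inj.
  have /memv_M_space : v - u \in M_space m m' T r A by rewrite memvB.
  by move/(_ rho').
have := dimv_sum_cap (M_space m m' T r (A `\ rho)%fset) (M_space m m' T r A :&: Rel_space m m' T r)%VS.
have -> : (M_space m m' T r (A `\ rho)%fset :&: (M_space m m' T r A :&: Rel_space m m' T r))%VS =
    (M_space m m' T r (A `\ rho)%fset :&: Rel_space m m' T r)%VS.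
  by rewrite capvA (capv_idPl MM).
rewrite sum /H_space !dim_quotv ?capvSl // => E.
have := dimvS (capvSl (M_space m m' T r A) (Rel_space m m' T r)).
have := dimvS (capvSl (M_space m m' T r (A `\ rho)%fset) (Rel_space m m' T r)).
by move: E; lia.
Qed.

End Deletion.

Theorem mainTheorem10 (R : realType) (T : premesh R) (r : seg R -> int)
    (m m' N : nat) (A : nat -> {fset {fset seg R}}) :
  is_tmesh T -> is_reduced T ->
  is_smoothness T r -> constant_along_ms T r ->
  A 0%N = MIS T ->
  (forall k : nat, (k < N)%N -> admissible_deletion m m' T r (A k) (A k.+1)) ->
  forall k : nat, (k <= N)%N ->
    (\dim (spline m m' T r))%:Z
    = euler_char m m' T r + (\dim (H_space m m' T r (A k)))%:Z.
Proof.
move=> HT HR Hr Hc A0 del.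
have step k : (k <= N)%N -> (A k `<=` MIS T)%fset /\
    \dim (H_space m m' T r (A k)) = \dim (H_space m m' T r (MIS T)).
  elim: k => [|k IH] kN; first by rewrite A0.
  have [Ak <-] := IH (ltnW kN); have dk := del k kN; split.
    by have [rho _ [-> _]] := dk; apply: fsubset_trans (fsubsetDl _ _) Ak.
  by rewrite (H_deletion HT HR Hr Ak dk).
move=> k /step[_ ->].
have := dim_spline m m' r HT HR; have := dim_I_vertices m m' HT HR Hr Hc.
have RM := Rel_sub_M m m' HT HR Hr; have := dimvS RM.
rewrite /H_space dim_quotv ?capvSl // (capv_idPr RM); lia.
Qed.
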